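(* Let $p\ge1$, $N\ge0$, and let $S=\{s_{j-k}\}_{k,j=0}^N$ be a positive definite block Toeplitz matrix with $p\times p$ blocks, $s_{-k}=s_k^*$. Fix $\alpha_0$ with $\alpha_0+\alpha_0^*=s_0$, and put $\alpha_k=s_{-k}$ for $1\le k\le N$. Let $\Phi_1$ be the $(N+1)p\times p$ block column with all blocks $I_p$, $\Phi_2$ the block column with blocks $\alpha_0,\ \alpha_0+\alpha_1,\ \dots,\ \alpha_0+\dots+\alpha_N$, $\Pi=[\Phi_1\ \ \Phi_2]$, and $A=\{a_{j-k}\}_{k,j=0}^N$ with $a_r=0$ ($r>0$), $a_0=\frac i2I_p$, $a_r=iI_p$ ($r<0$). Let $w_A(N,\mu)=I_{2p}-iJ\Pi^*S^{-1}(A-\mu I_{(N+1)p})^{-1}\Pi$ and $$\mathcal W(\lambda)=\{\mathcal W_{ij}(\lambda)\}_{i,j=1}^2=\Big(\frac{\lambda-i}{\lambda}\Big)^{N+1}w_A\big(N,-\bar\lambda/2\big)^*K.$$ Let $R,Q$ be $p\times p$ matrix functions meromorphic in $\mathbb C_-$, well defined at $\lambda=-i$, with $R^*R+Q^*Q>0$ and $R^*R\le Q^*Q$, and let $\varphi=i(\mathcal W_{21}R+\mathcal W_{22}Q)(\mathcal W_{11}R+\mathcal W_{12}Q)^{-1}$. Then $i\varphi(-i)=\alpha_0$, and the Taylor coefficients $\alpha_k$ at $z=0$ of $i\varphi\big(i\frac{z+1}{z-1}\big)$ satisfy $\alpha_k=s_{-k}$ for $0<k\le N$. Moreover, setting $s_{-k}=s_k^*:=\alpha_k$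 for $k>N$, one has $\{s_{j-k}\}_{k,j=0}^M\ge0$ for all $M>N$; and every sequence $(s_{-k})_{k>N}$ of $p\times p$ matrices such that, with $s_k:=s_{-k}^*$, all $\{s_{j-k}\}_{k,j=0}^M$ ($M>N$) are nonnegative (i.e. every nonnegative extension of $S$) is obtained in this way for a suitable pair $R,Q$.
   Context: $\mathbb C_-$ is the open lower half-plane; $J=\begin{bmatrix}0&I_p\\ I_p&0\end{bmatrix}$, $K=\frac1{\sqrt2}\begin{bmatrix}I_p&-I_p\\ I_p&I_p\end{bmatrix}$; $I_r$ is the $r\times r$ identity matrix; $\mathcal W_{ij}$ are $p\times p$ blocks. *)

(* Defs.v *)
From HB Require Import structures.
From mathcomp Require Import all_boot all_order all_algebra.
From mathcomp Require Import all_classical all_reals all_analysis.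
From mathcomp Require Import complex.
Set Implicit Arguments.
Unset Strict Implicit.
Unset Printing Implicit Defensive.
Import Order.TTheory GRing.Theory Num.Theory.
Import numFieldTopology.Exports numFieldNormedType.Exports.
Local Open Scope ring_scope.
Local Open Scope classical_set_scope.

(* The usual (metric) topology of C = R[i], |.| being the complex modulus;
   it is the generic topology of numFieldTypes, made canonical on R[i]. *)
HB.instance Definition _ (R : realType) := PseudoPointedMetric.copy R[i] (R[i])^o.

Section Defs.
Variable R : realType.
Local Notation C := (R[i]).

Definition adjmx m n (A : 'M[C]_(m, n)) : 'M[C]_(n, m) := \matrix_(i, j) (A j i)^*.

Definition psdmx n (A : 'M[C]_n) : Prop :=
  forall x : 'cV[C]_n, 0 <= (adjmx x *m A *m x) 0 0.
Definition pdmx n (A : 'M[C]_n) : Prop :=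
  forall x : 'cV[C]_n, x != 0 -> 0 < (adjmx x *m A *m x) 0 0.

Definition pser_to m n (c : nat -> 'M[C]_(m, n)) (z : C) (f : 'M[C]_(m, n)) : Prop :=
  (fun K => \sum_(k < K) z ^+ k *: c k) @ \oo --> f.

Definition analytic_at m n (f : C -> 'M[C]_(m, n)) (z0 : C) : Prop :=
  exists (c : nat -> 'M[C]_(m, n)) (r : C), 0 < r /\
    forall z, `|z - z0| < r -> pser_to c (z - z0) (f z).

Definition taylor_at0 m n (f : C -> 'M[C]_(m, n)) (c : nat -> 'M[C]_(m, n)) : Prop :=
  exists r : C, 0 < r /\ forall z, `|z| < r -> pser_to c z (f z).

(* f is meromorphic on the open set D: near every point z0 of D, f is given
   by a Laurent series with finitely many negative powers (values at the
   centre itself being irrelevant) *)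
Definition meromorphic_on m n (D : set C) (f : C -> 'M[C]_(m, n)) : Prop :=
  forall z0, D z0 -> exists (k : nat) (c : nat -> 'M[C]_(m, n)) (r : C), 0 < r /\
    forall z, 0 < `|z - z0| < r -> pser_to c (z - z0) ((z - z0) ^+ k *: f z).

Definition lower_hp : set C := [set z | 'Im z < 0].

(* block Toeplitz matrix {s_{j-k}}_{k,j=0}^M, given sm k = s_{-k}, s_k = s_{-k}^* *)
Definition toep_blk p (sm : nat -> 'M[C]_p) (k j : nat) : 'M[C]_p :=
  if (j <= k)%N then sm (k - j)%N else adjmx (sm (j - k)%N).
Definition toeplitz p (M : nat) (sm : nat -> 'M[C]_p) :=
  \mxblock_(k < M.+1, j < M.+1) toep_blk sm k j.

Definition Jmx p : 'M[C]_(p + p) := block_mx 0 1%:M 1%:M 0.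
Definition Kmx p : 'M[C]_(p + p) :=
  (sqrtC (2 : C))^-1 *: block_mx 1%:M (- 1%:M) 1%:M 1%:M.

Definition alph p (sm : nat -> 'M[C]_p) (a0 : 'M[C]_p) (k : nat) : 'M[C]_p :=
  if k == 0%N then a0 else sm k.

Definition Phi1 p N : 'M[C]_(\sum_(k < N.+1) p, p) := \mxcol_(k < N.+1) (1%:M : 'M[C]_p).
Definition Phi2 p N (sm : nat -> 'M[C]_p) (a0 : 'M[C]_p) : 'M[C]_(\sum_(k < N.+1) p, p) :=
  \mxcol_(k < N.+1) (\sum_(l < k.+1) alph sm a0 l).
Definition Pimx p N sm a0 := row_mx (Phi1 p N) (Phi2 N sm a0).

Definition Amx p N : 'M[C]_(\sum_(k < N.+1) p) :=
  \mxblock_(k < N.+1, j < N.+1)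
     (if (j < k)%N then ('i : C)%:M else if j == k then ('i / 2 : C)%:M
      else (0 : 'M[C]_p)).

Definition wA p N (sm : nat -> 'M[C]_p) (a0 : 'M[C]_p) (mu : C) : 'M[C]_(p + p) :=
  1%:M - 'i *: (Jmx p *m adjmx (Pimx N sm a0) *m invmx (toeplitz N sm)
                 *m invmx (Amx p N - mu%:M) *m Pimx N sm a0).

Definition Wmx p N sm a0 (l : C) : 'M[C]_(p + p) :=
  ((l - 'i) / l) ^+ N.+1 *: (adjmx (wA N sm a0 (- l^* / 2)) *m Kmx p).

Definition phi p N sm a0 (Rf Qf : C -> 'M[C]_p) (l : C) : 'M[C]_p :=
  let W := Wmx N sm a0 l in
  'i *: ((dlsubmx W *m Rf l + drsubmx W *m Qf l)
          *m invmx (ulsubmx W *m Rf l + ursubmx W *m Qf l)).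

Definition admissible_pair p (Rf Qf : C -> 'M[C]_p) : Prop :=
  [/\ meromorphic_on lower_hp Rf, meromorphic_on lower_hp Qf,
      analytic_at Rf (- 'i), analytic_at Qf (- 'i) &
      forall z, lower_hp z -> analytic_at Rf z -> analytic_at Qf z ->
        pdmx (adjmx (Rf z) *m Rf z + adjmx (Qf z) *m Qf z) /\
        psdmx (adjmx (Qf z) *m Qf z - adjmx (Rf z) *m Rf z)].

Definition iphi_disc p N sm a0 (Rf Qf : C -> 'M[C]_p) (z : C) : 'M[C]_p :=
  'i *: phi N sm a0 Rf Qf ('i * (z + 1) / (z - 1)).

End Defs.

(* Main.v *)
(* Put z = (l + i) / (l - i), which maps the lower half-plane onto the unit disc and
   -i to 0. Up to a scalar factor, W(l) equals What(z) K, and the displacement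
   identity for S (S minus its shift has rank 2p) shows that What(z) is J-contractive
   for |z| < 1. It also gives alpha(z) X + Y = O(z^(N+1)) for the blocks X, Y of
   What(z) K (R; Q), where alpha is the prescribed Taylor polynomial; hence
   f = i phi = - Y X^-1 interpolates. The Cayley transform (X + Y) (X - Y)^-1 of f is
   contractive wherever R and Q are analytic, and its singularities are removable, so
   it is analytic on the whole disc. By Parseval its Taylor coefficients define a
   causal contraction on finite sequences, and the Cayley transform turns this into
   positivity of the Toeplitz forms of the coefficients of f.

   Conversely, let f be the power series of an extension and r the column of (the
   opposites of) its tails of order 1, ..., N + 1. Evaluating the Toeplitz forms on
   geometric sequences yields the fundamental matrix inequality
   f + f^* - (1 - |z|^2) r^* S^-1 r >= 0, whose left-hand side is minus the J-form of
   What(z)^-1 (1; -f). So (R; Q) = K^-1 What^-1 (1; -f) is an admissible pair, and it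
   gives back f.

   Analyticity is handled through jets, i.e. asymptotic Taylor expansions of every
   order at each point. A maximum principle and averages over roots of unity bound the
   coefficients of these expansions as Cauchy's formula would. *)
Require Import Defs.
From HB Require Import structures.
From mathcomp Require Import all_boot all_order all_algebra.
From mathcomp Require Import all_classical all_reals all_analysis.
From mathcomp Require Import complex.
From mathcomp Require Import ring lra zify.
From mathcomp Require Import cyclic separable cyclotomic.
Set Implicit Arguments.
Unset Strict Implicit.
Unset Printing Implicit Defensive.
Import Order.TTheory GRing.Theory Num.Theory.
Import numFieldTopology.Exports numFieldNormedType.Exports.
Local Open Scope ring_scope.
Local Open Scope classical_set_scope.

(** * Jets of complex functions *)

(** [admissible_pair] constrains R and Q only at the points where both are analytic, and f is not
    known to be bounded. The Cayley transform V = (1 - f) (1 + f)^-1 is bounded by 1 at those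
    points, and this bound is what allows the missing values to be filled in and a single Taylor
    series to be obtained on the unit disc. The coefficients of f are computed near 0 only; there V
    (1 + f) = 1 - f links the two sequences of coefficients, and the contraction inequality is
    stated for V alone.

    The disc variable is natural because A = (i/2) (1 + L) (1 - L)^-1 with L the block shift: in z,
    the resolvent of the adjoint of A becomes that of a nilpotent matrix. Strict positivity of S is
    what makes X invertible: a vector killed by X has zero state, and then the nondegeneracy of (R,
    Q) kills it.

    In the converse no inverse of What is computed. The state that belongs to f is built from the
    tails of its series, which make sense at z = 0 too; the series converge on the whole disc
    because two-vector sections of the Toeplitz forms bound all coefficients of an extension. *)

Section Modulus.
Variable R : realType.
Local Notation C := (R[i]).

(** The real-valued modulus: [|z|] is an element of C, whereas radii and error bounds are compared
    as real numbers. *)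
Definition cabs (z : C) : R := Normc.normc z.
Arguments cabs : simpl never.

Lemma normcR (z : C) : `|z| = real_complex R (cabs z).
Proof. by []. Qed.

Lemma cabs0 : cabs 0 = 0. Proof. exact: Normc.normc0. Qed.
Lemma cabs1 : cabs 1 = 1. Proof. exact: Normc.normc1. Qed.
Lemma cabsM x y : cabs (x * y) = cabs x * cabs y. Proof. exact: Normc.normcM. Qed.
Lemma cabsV x : cabs x^-1 = (cabs x)^-1. Proof. exact: Normc.normcV. Qed.
Lemma cabsN x : cabs (- x) = cabs x. Proof. exact: normcN. Qed.
Lemma cabsD x y : cabs (x + y) <= cabs x + cabs y. Proof. exact: le_normcD. Qed.
Lemma cabsC x y : cabs (x - y) = cabs (y - x). Proof. by rewrite -cabsN opprB. Qed.
Lemma cabsB x y : cabs (x - y) <= cabs x + cabs y.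
Proof. by rewrite -(cabsN y); exact: cabsD. Qed.
Lemma cabs_subr x y : cabs x - cabs y <= cabs (x - y).
Proof. by rewrite lerBlDr; apply: le_trans (cabsD _ _); rewrite subrK. Qed.

Lemma cabs_ge0 z : 0 <= cabs z.
Proof. by rewrite -lecR -normcR normr_ge0. Qed.

Lemma cabs_eq0 z : (cabs z == 0) = (z == 0).
Proof.
apply/eqP/eqP => [|->]; last exact: cabs0.
exact: Normc.eq0_normc.
Qed.

Lemma cabs_gt0 z : (0 < cabs z) = (z != 0).
Proof. by rewrite lt0r cabs_ge0 andbT cabs_eq0. Qed.

Lemma cabsX z n : cabs (z ^+ n) = cabs z ^+ n.
Proof. by elim: n => [|n IH]; rewrite ?expr0 ?cabs1 // !exprS cabsM IH. Qed.

Lemma cabsR (x : R) : cabs (real_complex R x) = `|x|.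
Proof. by rewrite /cabs /= expr0n /= addr0 sqrtr_sqr. Qed.

Lemma cabs_nat n : cabs n%:R = n%:R.
Proof. by rewrite -(rmorph_nat (real_complex R)) cabsR normr_nat. Qed.

Lemma cabs_conj z : cabs z^* = cabs z.
Proof.
by apply: (@complexI R); rewrite -!normcR norm_conjC.
Qed.

Lemma cabs_sum n (F : 'I_n -> C) : cabs (\sum_(k < n) F k) <= \sum_(k < n) cabs (F k).
Proof.
elim/big_ind2: _ => //; first by rewrite cabs0.
by move=> x1 x2 y1 y2 h1 h2; apply: le_trans (cabsD _ _) (lerD h1 h2).
Qed.

Lemma sqr_cabs z : real_complex R (cabs z ^+ 2) = z * z^*.
Proof. by rewrite rmorphXn /= -normcR normCK. Qed.

Lemma cabs_sqrE (a b : R) : cabs (Complex a b) ^+ 2 = a ^+ 2 + b ^+ 2.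
Proof. by rewrite /cabs /= sqr_sqrtr // addr_ge0 ?sqr_ge0. Qed.

Lemma cabs_Re z : `|complex.Re z| <= cabs z.
Proof. by rewrite -lecR -normcR; exact: normc_ge_Re. Qed.

Lemma cabs_Im z : `|complex.Im z| <= cabs z.
Proof.
case: z => a b /=; rewrite -(@ler_pXn2r _ 2) ?nnegrE ?cabs_ge0 //.
by rewrite cabs_sqrE real_normK ?num_real // lerDr sqr_ge0.
Qed.

Lemma ltcabs z (r : R) : (`|z| < real_complex R r) = (cabs z < r).
Proof. by rewrite normcR ltcR. Qed.

(** The constants in jets carry no sign; [B] is replaced by [|B|] whenever the power of the radius
    it multiplies is enlarged. *)
Lemma ler_absM (B x y : R) : 0 <= x -> x <= y -> B * x <= `|B| * y.
Proof.
move=> x0 xy; apply: (le_trans (y := `|B| * x)); first by rewrite ler_wpM2r ?ler_norm.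
by rewrite ler_wpM2l.
Qed.

Lemma cabs_le_eps (z : C) : (forall e : R, 0 < e -> cabs z <= e) -> z = 0.
Proof.
move=> h; apply/eqP; rewrite -cabs_eq0 eq_le cabs_ge0 andbT.
by apply/ler_addgt0Pr => e e0; rewrite add0r; exact: h.
Qed.

End Modulus.
Arguments cabs : simpl never.

Section Jets.
Variable R : realType.
Local Notation C := (R[i]).
Implicit Types (f g : C -> C) (a z w : C).

(* An asymptotic Taylor expansion of every order; holding at every point of an
   open set, this is equivalent to analyticity, and it is stable under all the
   usual operations for trivial reasons. *)
Definition jet f a := forall n : nat, exists (P : {poly C}) (B d : R),
  0 < d /\ forall w, cabs w < d -> cabs (f (a + w) - P.[w]) <= B * cabs w ^+ n.

Lemma poly_bounded (P : {poly C}) (r : R) : 0 <= r ->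
  exists2 B : R, 0 <= B & forall w, cabs w <= r -> cabs P.[w] <= B.
Proof.
move=> r0; elim/poly_ind: P => [|P c [B B0 hB]].
  by exists 0 => // w _; rewrite horner0 cabs0.
exists (B * r + cabs c) => [|w hw]; first by rewrite addr_ge0 ?mulr_ge0 ?cabs_ge0.
rewrite hornerMXaddC; apply: le_trans (cabsD _ _) _.
by rewrite cabsM lerD2r ler_pM ?cabs_ge0 ?hB.
Qed.

(** The comparison function [h] may depend on the order; for a composition it is a polynomial in the
    inner function. *)
Lemma jet_approx f a :
  (forall n, exists2 h, jet h a & exists (B d : R), 0 < d /\
     forall w, cabs w < d -> cabs (f (a + w) - h (a + w)) <= B * cabs w ^+ n) ->
  jet f a.
Proof.
move=> H n; have [h /(_ n) [P [B [d [d0 hP]]]] [B' [d' [d'0 hh]]]] := H n.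
exists P, (B' + B), (Num.min d' d); split; first by rewrite lt_min d'0 d0.
move=> w; rewrite lt_min => /andP[/hh h1 /hP h2].
rewrite mulrDl (_ : _ - _ = f (a + w) - h (a + w) + (h (a + w) - P.[w])); last by ring.
by apply: le_trans (cabsD _ _) (lerD h1 h2).
Qed.

Lemma jet_near f g a (d : R) : 0 < d -> (forall w, cabs w < d -> f (a + w) = g (a + w)) ->
  jet g a -> jet f a.
Proof.
move=> d0 fg jg; apply: jet_approx => n; exists g => //; exists 0, d; split=> // w /fg ->.
by rewrite subrr cabs0 mul0r.
Qed.

Lemma eq_jet f g a : f =1 g -> jet g a -> jet f a.
Proof. by move=> fg; apply: (@jet_near _ _ _ 1) => // w _; rewrite fg. Qed.

Lemma jet_poly (P : {poly C}) a : jet (fun z => P.[z]) a.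
Proof.
move=> n; exists (P \Po ('X + a%:P)), 0, 1; split=> // w _.
by rewrite horner_comp !hornerE [w + a]addrC subrr cabs0 ?mul0r.
Qed.

Lemma jet_cst c a : jet (fun=> c) a.
Proof. by apply: eq_jet (jet_poly c%:P a) => z; rewrite hornerE. Qed.

Lemma jet_id a : jet (fun z => z) a.
Proof. by apply: eq_jet (jet_poly 'X a) => z; rewrite hornerE. Qed.

Lemma jetD f g a : jet f a -> jet g a -> jet (fun z => f z + g z) a.
Proof.
move=> jf jg n; have [P [B [d [d0 hP]]]] := jf n; have [Q [B' [d' [d'0 hQ]]]] := jg n.
exists (P + Q), (B + B'), (Num.min d d'); split; first by rewrite lt_min d'0 d0.
move=> w; rewrite lt_min => /andP[/hP h1 /hQ h2].
rewrite mulrDl hornerD opprD addrACA.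
by apply: le_trans (cabsD _ _) (lerD h1 h2).
Qed.

Lemma jet_bounded f a : jet f a ->
  exists (B d : R), [/\ 0 <= B, 0 < d & forall w, cabs w < d -> cabs (f (a + w)) <= B].
Proof.
move=> /(_ 0%N) [P [B [d [d0 hP]]]]; have [B' B'0 hB'] := poly_bounded P (ltW d0).
exists (`|B| + B'), d; split=> // [|w hw]; first by rewrite addr_ge0.
rewrite -[f _](subrK P.[w]); apply: le_trans (cabsD _ _) (lerD _ _).
  by apply: le_trans (hP w hw) _; rewrite expr0 mulr1 ler_norm.
by apply: hB'; exact: ltW.
Qed.

Lemma jetM f g a : jet f a -> jet g a -> jet (fun z => f z * g z) a.
Proof.
move=> jf jg n; have [P [B [d [d0 hP]]]] := jf n; have [Q [B' [d' [d'0 hQ]]]] := jg n.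
have [Bg [dg [Bg0 dg0 hg]]] := jet_bounded jg.
have [BP BP0 hBP] := poly_bounded P (ltW d0).
exists (P * Q), (`|B| * Bg + BP * `|B'|), (Num.min d (Num.min d' dg)); split.
  by rewrite !lt_min d0 d'0 dg0.
move=> w; rewrite !lt_min => /and3P[hw /hQ h2 /hg h3]; have h1 := hP w hw.
have h4 := hBP w (ltW hw).

rewrite hornerM (_ : _ - _ = (f (a + w) - P.[w]) * g (a + w) + P.[w] * (g (a + w) - Q.[w]));
  last by ring.
apply: le_trans (cabsD _ _) _; rewrite !cabsM mulrDl mulrAC -mulrA lerD // ?mulrA.
  rewrite ler_pM ?cabs_ge0 //; apply: le_trans h1 _.
  by rewrite ler_wpM2r ?exprn_ge0 ?cabs_ge0 ?ler_norm.
rewrite -mulrA ler_pM ?cabs_ge0 //; apply: le_trans h2 _.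
by rewrite ler_wpM2r ?exprn_ge0 ?cabs_ge0 ?ler_norm.
Qed.

Lemma jetN f a : jet f a -> jet (fun z => - f z) a.
Proof.
move=> jf; apply: eq_jet (jetM (jet_cst (-1) a) jf) => z; by rewrite mulN1r.
Qed.

Lemma jetB f g a : jet f a -> jet g a -> jet (fun z => f z - g z) a.
Proof. by move=> jf /jetN; exact: jetD. Qed.

Lemma jetX f n a : jet f a -> jet (fun z => f z ^+ n) a.
Proof.
move=> jf; elim: n => [|n IH]; first exact: jet_cst.
by apply: eq_jet (jetM jf IH) => z; rewrite exprS.
Qed.

Lemma jet_sum (I : Type) (r : seq I) (P : pred I) (F : I -> C -> C) a :
  (forall i, jet (F i) a) -> jet (fun z => \sum_(i <- r | P i) F i z) a.
Proof.
move=> jF; elim: r => [|i r IH].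
  by apply: eq_jet (jet_cst 0 a) => z; rewrite big_nil.
case Pi : (P i); last by apply: eq_jet IH => z; rewrite big_cons Pi.
by apply: eq_jet (jetD (jF i) IH) => z; rewrite big_cons Pi.
Qed.

Lemma jet_prod (I : Type) (r : seq I) (P : pred I) (F : I -> C -> C) a :
  (forall i, jet (F i) a) -> jet (fun z => \prod_(i <- r | P i) F i z) a.
Proof.
move=> jF; elim: r => [|i r IH].
  by apply: eq_jet (jet_cst 1 a) => z; rewrite big_nil.
case Pi : (P i); last by apply: eq_jet IH => z; rewrite big_cons Pi.
by apply: eq_jet (jetM (jF i) IH) => z; rewrite big_cons Pi.
Qed.

Lemma jet_lip f a : jet f a -> exists (B d : R), [/\ 0 <= B, 0 < d &
  forall w, cabs w < d -> cabs (f (a + w) - f a) <= B * cabs w].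
Proof.
move=> /(_ 1%N) [P [B [d [d0 hP]]]].
have [Q [q hQ]] : exists Q q, P = Q * 'X + q%:P.
  by elim/poly_ind: P hP => [|P c _] hP; [exists 0, 0; rewrite mul0r addr0|exists P, c].
(* For positive order the error bound vanishes at w = 0, so a jet determines the value at the centre
   as well. *)
have fa : f a = q.
  have := hP 0; rewrite cabs0 expr1 mulr0 => /(_ d0) h.
  apply/eqP; rewrite -subr_eq0 -cabs_eq0 eq_le cabs_ge0 andbT.
  by move: h; rewrite addr0 hQ !hornerE.
have [B' B'0 hB'] := poly_bounded Q (ltW d0).
exists (`|B| + B'), d; split=> // [|w hw]; first by rewrite addr_ge0.
rewrite (_ : _ - _ = f (a + w) - P.[w] + Q.[w] * w); last first.
  by rewrite hQ !hornerE fa; ring.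
apply: le_trans (cabsD _ _) _; rewrite mulrDl lerD //.
  by apply: le_trans (hP w hw) _; rewrite expr1 ler_wpM2r ?cabs_ge0 ?ler_norm.
by rewrite cabsM ler_wpM2r ?cabs_ge0 // hB' ?ltW.
Qed.

Lemma jet_comp f g a : jet g a -> jet f (g a) -> jet (fun z => f (g z)) a.
Proof.
move=> jg jf; apply: jet_approx => n.
have [P [B [d [d0 hP]]]] := jf n; have [L [d' [L0 d'0 hL]]] := jet_lip jg.
exists (fun z => P.[g z - g a]).
  have jh : jet (fun z => g z - g a) a by apply: jetB => //; exact: jet_cst.
  elim/poly_ind: P {hP} => [|P c IH].
    by apply: eq_jet (jet_cst 0 a) => z; rewrite horner0.
  apply: eq_jet (jetD (jetM IH jh) (jet_cst c a)) => z.
  by rewrite hornerMXaddC.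
(* The increment of [g] has to stay within the radius [d] of the jet of [f]; [L] may be 0, hence
   [L + 1]. *)
exists (`|B| * L ^+ n), (Num.min d' (d / (L + 1))); split.
  by rewrite lt_min d'0 divr_gt0 // ltr_wpDl.
move=> w; rewrite lt_min ltr_pdivlMr ?ltr_wpDl // => /andP[/hL h1 h2].
have h3 : cabs (g (a + w) - g a) < d.
  apply: le_lt_trans h1 (le_lt_trans _ h2); rewrite mulrC ler_wpM2l ?cabs_ge0 //.
  by rewrite lerDl.
rewrite -{1}(subrK (g a) (g (a + w))) [_ + g a]addrC.
apply: le_trans (hP _ h3) _; rewrite -mulrA ler_absM ?exprn_ge0 ?cabs_ge0 //.
by rewrite -exprMn lerXn2r ?nnegrE ?mulr_ge0 ?cabs_ge0.
Qed.

(** The expansion of 1/f is the inverse [u] of P modulo X^n, taken from a Bezout relation; it exists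
    because P(0) = f(a) is nonzero. *)
Lemma jetV f a : jet f a -> f a != 0 -> jet (fun z => (f z)^-1) a.
Proof.
move=> jf fa0 n; have [L [d' [L0 d'0 hL]]] := jet_lip jf.
(* Order n + 1 rather than n, so that [P.[0] = f a] also for n = 0; the extra factor |w| is absorbed
   in the constant as [d]. *)
have [P [B [d [d0 hP]]]] := jf n.+1.
have P0 : P.[0] = f a.
  apply/eqP; rewrite eq_sym -subr_eq0 -cabs_eq0 eq_le cabs_ge0 andbT.
  by have := hP 0; rewrite cabs0 expr0n mulr0 addr0; apply.
have /Bezout_eq1_coprimepP [[u v] /= huv] : coprimep P 'X^n.
  case: n {jf hP} => [|n]; first by rewrite expr0 coprimep1.
  by rewrite coprimep_pexpr // coprimepX /root P0.
have fa1 : 0 < cabs (f a) by rewrite cabs_gt0.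
have [Bu Bu0 hBu] := poly_bounded u (ltW d0).
have [Bv Bv0 hBv] := poly_bounded v (ltW d0).
exists u, ((Bv + Bu * `|B| * d) * (2 / cabs (f a))).
exists (Num.min d (Num.min d' (cabs (f a) / 2 / (L + 1)))); split.
  by rewrite !lt_min d0 d'0 !divr_gt0 // ltr_wpDl.
move=> w; rewrite !lt_min ltr_pdivlMr ?ltr_wpDl // => /and3P[h1 /hL h2 h3].
have h4 : cabs (f a) / 2 <= cabs (f (a + w)).
  have h5 := cabs_subr (f a) (f a - f (a + w)).
  rewrite subKr [cabs (f a - _)]cabsC in h5.
  have h6 : cabs (f (a + w) - f a) <= cabs (f a) / 2.
    apply: le_trans h2 (le_trans _ (ltW h3)); rewrite mulrC ler_wpM2l ?cabs_ge0 //.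
    by rewrite lerDl.
  by lra.
have h5 : f (a + w) != 0 by rewrite -cabs_gt0; apply: lt_le_trans h4; rewrite divr_gt0.
have e1 : 1 = u.[w] * P.[w] + v.[w] * w ^+ n.
  by have := congr1 (horner^~ w) huv; rewrite hornerD !hornerM hornerXn hornerC.
rewrite (_ : _ - _ = (v.[w] * w ^+ n - u.[w] * (f (a + w) - P.[w])) / f (a + w)); last first.
  by apply: (mulIf h5); rewrite mulfVK // mulrBl mulVf // {1}e1; ring.
rewrite cabsM cabsV -mulrA [_ / _ * _]mulrC mulrA ler_pM ?cabs_ge0 ?invr_ge0 ?cabs_ge0 //.
  apply: le_trans (cabsB _ _) _; rewrite !cabsM cabsX mulrDl lerD //.
    by rewrite ler_wpM2r ?exprn_ge0 ?cabs_ge0 // hBv // ltW.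
  rewrite -!mulrA ler_pM ?cabs_ge0 ?hBu ?(ltW h1) //.
  apply: le_trans (hP _ h1) _; rewrite exprS.
  apply: ler_absM; first by rewrite ?mulr_ge0 ?exprn_ge0 ?cabs_ge0.
  by rewrite ler_wpM2r ?exprn_ge0 ?cabs_ge0 // ltW.
by rewrite -[2 / _]invrK invf_div lef_pV2 // posrE ?divr_gt0 // cabs_gt0.
Qed.

Lemma jet_div f g a : jet f a -> jet g a -> g a != 0 -> jet (fun z => f z / g z) a.
Proof. by move=> jf jg /(jetV jg); exact: jetM. Qed.

Lemma cabs_small_eq0 (c : C) (B d : R) : 0 < d ->
  (forall w, w != 0 -> cabs w < d -> cabs c <= B * cabs w) -> c = 0.
Proof.
move=> d0 h; apply: cabs_le_eps => e e0.
pose x := Num.min (d / 2) (e / (`|B| + 1)).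
have x0 : 0 < x by rewrite lt_min !divr_gt0 // ltr_wpDl.
have xd : x < d by rewrite gt_min ltr_pdivrMr // ltr_pMr // ltr1n.
have xe : x * (`|B| + 1) <= e by rewrite -ler_pdivlMr ?ltr_wpDl // ge_min lexx orbT.
have := h (real_complex R x); rewrite -cabs_gt0 cabsR gtr0_norm // => /(_ x0 xd) h1.
apply: le_trans h1 (le_trans _ xe); rewrite mulrC ler_pM2l //.
by apply: le_trans (ler_norm _) _; rewrite lerDl.
Qed.

(** The centre is left out because quotients are controlled only away from it. *)
Lemma poly_small (P : {poly C}) n (B d : R) : 0 < d ->
  (forall w, w != 0 -> cabs w < d -> cabs P.[w] <= B * cabs w ^+ n) ->
  exists Q, P = Q * 'X^n.
Proof.
move=> d0; elim: n P => [|n IH] P hP; first by exists P; rewrite expr0 mulr1.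
have [Q [q hQ]] : exists Q q, P = Q * 'X + q%:P.
  by elim/poly_ind: P hP => [|P c _] hP; [exists 0, 0; rewrite mul0r addr0|exists P, c].
have [B' B'0 hB'] := poly_bounded Q (ltW d0).
have q0 : q = 0.
  apply: (@cabs_small_eq0 _ (`|B| * d ^+ n + B') d) => // w w0 wd.
  rewrite (_ : q = P.[w] - Q.[w] * w); last by rewrite hQ !hornerE; ring.
  apply: le_trans (cabsB _ _) _; rewrite mulrDl lerD //.
    apply: le_trans (hP w w0 wd) _; rewrite exprSr mulrA ler_wpM2r ?cabs_ge0 //.
    rewrite ler_absM ?exprn_ge0 ?cabs_ge0 //.
    by rewrite lerXn2r ?nnegrE ?cabs_ge0 ?ltW.
  by rewrite cabsM ler_wpM2r ?cabs_ge0 // hB' ?ltW.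
have [|Q' Q'E] := IH Q; last by exists Q'; rewrite hQ q0 addr0 Q'E -mulrA -exprSr.
move=> w w0 wd; have := hP w w0 wd.
by rewrite hQ q0 !hornerE /= cabsM exprSr mulrA ler_pM2r ?cabs_gt0.
Qed.

(** The polynomial of the expansion of order n + m is itself O(w^m), hence divisible by X^m; its
    quotient gives an expansion of order n away from the centre. *)
Lemma jet_quot f a m (B d : R) : jet f a -> 0 < d ->
  (forall w, w != 0 -> cabs w < d -> cabs (f (a + w)) <= B * cabs w ^+ m) ->
  exists v, jet (fun z => if z == a then v else f z / (z - a) ^+ m) a.
Proof.
move=> jf d0 hf.
have E n : exists Q B' d', 0 < d' /\ forall w, w != 0 -> cabs w < d' ->
    cabs (f (a + w) / w ^+ m - Q.[w]) <= B' * cabs w ^+ n.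
  have [P [B' [d' [d'0 hP]]]] := jf (n + m)%N.
  have [|w w0|Q hQ] := @poly_small P m (B + `|B'| * d' ^+ n) (Num.min d d').
  - by rewrite lt_min d0 d'0.
  - rewrite lt_min => /andP[/(hf w w0) h1 h3]; have h2 := hP _ h3.
    rewrite (_ : P.[w] = f (a + w) - (f (a + w) - P.[w])); last by ring.
    apply: le_trans (cabsB _ _) _; rewrite mulrDl lerD //.
    apply: le_trans h2 _; rewrite exprD mulrA ler_wpM2r ?exprn_ge0 ?cabs_ge0 //.
    apply: ler_absM; rewrite ?exprn_ge0 ?cabs_ge0 //.
    by rewrite lerXn2r ?nnegrE ?cabs_ge0 ?ltW.
  exists Q, B', d'; split=> // w w0 wd.
  have wm : w ^+ m != 0 by rewrite expf_neq0.
  have -> : f (a + w) / w ^+ m - Q.[w] = (f (a + w) - P.[w]) / w ^+ m.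
    by rewrite hQ hornerM hornerXn mulrBl mulfK.
  rewrite cabsM cabsV ler_pdivrMr ?cabs_gt0 // cabsX -mulrA -exprD.
  exact: hP.
have [Q1 [B1 [d1 [d10 h1]]]] := E 1%N.
(* The value at the centre has to serve all orders: expansions of order at least 1 agree at 0 with
   [Q1], since their difference is O(w). *)
exists Q1.[0] => n; have [Q [B' [d' [d'0 hQ]]]] := E n.+1.
have [|w w0|Q2 hQ2] := @poly_small (Q - Q1) 1 (B1 + `|B'| * d' ^+ n) (Num.min d1 d').
- by rewrite lt_min d10 d'0.
- rewrite lt_min => /andP[/(h1 w w0) h2 h3]; have h4 := hQ _ w0 h3.
  rewrite !hornerE (_ : _ - _ = (f (a + w) / w ^+ m - Q1.[w]) - (f (a + w) / w ^+ m - Q.[w]));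
    last by ring.
  apply: le_trans (cabsB _ _) _; rewrite mulrDl lerD //.
  apply: le_trans h4 _; rewrite exprSr mulrA ler_wpM2r ?exprn_ge0 ?cabs_ge0 //.
  apply: ler_absM; rewrite ?exprn_ge0 ?cabs_ge0 //.
  by rewrite lerXn2r ?nnegrE ?cabs_ge0 ?ltW.
exists Q, (`|B'| * d'), d'; split=> // w wd.
have [->|w0] := eqVneq w 0.
  rewrite addr0 eqxx -cabsN opprB.
  have -> : Q.[0] - Q1.[0] = 0 by rewrite -hornerN -hornerD hQ2 !hornerE ?mulr0.
  by rewrite cabs0 !mulr_ge0 ?exprn_ge0 // ltW.
rewrite [a + w]addrC addrK -subr_eq0 addrK (negPf w0) [w + a]addrC.
apply: le_trans (hQ w w0 wd) _; rewrite exprS mulrA ler_wpM2r ?exprn_ge0 ?cabs_ge0 //.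
by apply: ler_absM; rewrite ?cabs_ge0 ?ltW.
Qed.

End Jets.

(** * The maximum principle *)

Section MaxPrinciple.
Variable R : realType.
Local Notation C := (R[i]).
Implicit Types (f g : C -> C) (a z w : C).

Let ei : C := Complex 0 1.

Let cabs_ei : cabs ei = 1.
Proof. by rewrite /cabs /= expr0n /= expr1n add0r sqrtr1. Qed.

(** Convexity of the squared modulus: the bound is linear in [x], hence compatible with the
    cancellation of Taylor terms over several points. *)
Lemma cabs_sqr_tangent (c x : C) :
  cabs c ^+ 2 + 2 * complex.Re (c^* * (x - c)) <= cabs x ^+ 2.
Proof.
case: x c => [x1 x2] [c1 c2]; rewrite !cabs_sqrE.
have -> : ((Complex c1 c2)^* = Complex c1 (- c2))%R by [].
rewrite /= -subr_ge0 (_ : _ - _ = (x1 - c1) ^+ 2 + (x2 - c2) ^+ 2); last by ring.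
by rewrite addr_ge0 ?sqr_ge0.
Qed.

(* The mean over the four points a + s i^j of a second order Taylor polynomial
   is its value at a; hence |f|^2 is subharmonic up to a cubic error. *)
Lemma subharmonic_mean f a : jet f a -> exists (K d : R), [/\ 0 <= K, 0 < d &
  forall w, cabs w < d -> 4 * cabs (f a) ^+ 2 - K * cabs w ^+ 3 <=
   cabs (f (a + w)) ^+ 2 + cabs (f (a - w)) ^+ 2 +
   (cabs (f (a + ei * w)) ^+ 2 + cabs (f (a - ei * w)) ^+ 2)].
Proof.
move=> /(_ 3%N) [P [B [d [d0 hP]]]].
have [c [b [b2 [Q hQ]]]] : exists c b b2 Q, P = c%:P + b *: 'X + b2 *: 'X^2 + Q * 'X^3.
  have S (p : {poly C}) : exists Q q, p = Q * 'X + q%:P.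
    by elim/poly_ind: p => [|p q _]; [exists 0, 0; rewrite mul0r addr0|exists p, q].
  have [Q1 [c h1]] := S P; have [Q2 [b h2]] := S Q1; have [Q3 [b2 h3]] := S Q2.
  exists c, b, b2, Q3; rewrite h1 h2 h3 -!mul_polyC; ring.
have [BQ BQ0 hBQ] := poly_bounded Q (ltW d0).
have fa : f a = c.
  have := hP 0; rewrite cabs0 expr0n mulr0 addr0 => /(_ d0) h.
  apply/eqP; rewrite -subr_eq0 -cabs_eq0 eq_le cabs_ge0 andbT.
  by move: h; rewrite hQ !hornerE /= ?expr0n /= ?mulr0 ?addr0.
pose E : R := `|B| + BQ.
have E0 : 0 <= E by rewrite addr_ge0.
have err w : cabs w < d -> cabs (f (a + w) - (c + b * w + b2 * w ^+ 2)) <= E * cabs w ^+ 3.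
  move=> wd; have h := hP w wd.
  rewrite (_ : _ - _ = f (a + w) - P.[w] + Q.[w] * w ^+ 3); last first.
    by rewrite hQ !hornerE; ring.
  apply: le_trans (cabsD _ _) _; rewrite mulrDl lerD //.
    by apply: le_trans h _; rewrite ler_wpM2r ?exprn_ge0 ?cabs_ge0 ?ler_norm.
  by rewrite cabsM cabsX ler_wpM2r ?exprn_ge0 ?cabs_ge0 // hBQ // ltW.
(* Each of the four points contributes a Taylor error E s^3, multiplied by 2 |c| in the tangent
   bound. *)
exists (8 * cabs c * E), d; split=> //; first by rewrite !mulr_ge0 ?cabs_ge0.
move=> w sd; rewrite fa; set s := cabs w in sd *.
have e1 := err w; have e2 := err (- w); have e3 := err (ei * w); have e4 := err (- (ei * w)).
rewrite !cabsN !cabsM cabs_ei mul1r -/s in e1 e2 e3 e4.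
have {e1 e2 e3 e4} [e1 e2 e3 e4] := And4 (e1 sd) (e2 sd) (e3 sd) (e4 sd).
have := cabs_sqr_tangent c (f (a + w)); have := cabs_sqr_tangent c (f (a - w)).
have := cabs_sqr_tangent c (f (a + ei * w)); have := cabs_sqr_tangent c (f (a - ei * w)).
set x1 := f (a + w) in e1 *; set x2 := f (a - w) in e2 *.
set x3 := f (a + _) in e3 *; set x4 := f (a - _) in e4 *.
move=> c4 c3 c2 c1.
have : 2 * (complex.Re (c^* * (x1 - c)) + complex.Re (c^* * (x2 - c)) +
        complex.Re (c^* * (x3 - c)) + complex.Re (c^* * (x4 - c))) >= - (8 * cabs c * E * s ^+ 3).
  rewrite -!raddfD /= -!mulrDr.
  have -> : x1 - c + (x2 - c) + (x3 - c) + (x4 - c) =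
     (x1 - (c + b * w + b2 * w ^+ 2)) + (x2 - (c + b * - w + b2 * (- w) ^+ 2)) +
     (x3 - (c + b * (ei * w) + b2 * (ei * w) ^+ 2)) +
     (x4 - (c + b * - (ei * w) + b2 * (- (ei * w)) ^+ 2)).
    have e : ei ^+ 2 = -1 by rewrite sqr_i.
    rewrite !sqrrN !exprMn e; ring.
  move: (_ - _) (_ - _) (_ - _) (_ - _) e1 e2 e3 e4 => y4 y3 y2 y1 e1 e2 e3 e4.
  have h : cabs (c^* * (y1 + y2 + y3 + y4)) <= cabs c * (4 * (E * s ^+ 3)).
    rewrite cabsM cabs_conj ler_wpM2l ?cabs_ge0 //.
    have h1 := cabsD (y1 + y2 + y3) y4; have h2 := cabsD (y1 + y2) y3; have h3 := cabsD y1 y2.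
    lra.
  have h2 := cabs_Re (c^* * (y1 + y2 + y3 + y4)).
  have : - complex.Re (c^* * (y1 + y2 + y3 + y4)) <= cabs c * (4 * (E * s ^+ 3)).
    by apply: le_trans h; apply: le_trans h2; rewrite -normrN ler_norm.
  by lra.
lra.
Qed.

Lemma compact_disc (rho : R) :
  compact [set p : R * R | p.1 ^+ 2 + p.2 ^+ 2 <= rho ^+ 2].
Proof.
have cK : compact (`[(- `|rho|)%R, `|rho|%R] `*` `[(- `|rho|)%R, `|rho|%R]).
  by apply: compact_setX; exact: segment_compact.
apply: (subclosed_compact _ cK).
  have cc : continuous (fun p : R * R => p.1 ^+ 2 + p.2 ^+ 2).
    move=> p; apply: cvgD; apply: cvgM; (exact: cvg_fst || exact: cvg_snd).
  apply: (preimage_closed (f := fun p : R * R => p.1 ^+ 2 + p.2 ^+ 2)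
      (D := [set x : R | x <= rho ^+ 2])); last exact: closed_le.
  by move=> p _; exact: cc.
move=> [x y] /= h; have h1 : x ^+ 2 <= rho ^+ 2 by rewrite (le_trans _ h) // lerDl sqr_ge0.
have h2 : y ^+ 2 <= rho ^+ 2 by rewrite (le_trans _ h) // lerDr sqr_ge0.
split; rewrite /= in_itv /= -ler_norml.
  by rewrite -(@ler_pXn2r _ 2) ?nnegrE // !real_normK ?num_real.
by rewrite -(@ler_pXn2r _ 2) ?nnegrE // !real_normK ?num_real.
Qed.

Lemma jet_continuous_abs f (x y : R) : jet f (Complex x y) ->
  {for (x, y), continuous (fun p : R * R => cabs (f (Complex p.1 p.2)))}.
Proof.
move=> /jet_lip [L [d [L0 d0 hL]]]; apply/cvgrPdist_le => e e0.
(* A ball of [R * R] is a square: coordinates within r only give modulus at most 2 r, whence the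
   margins 4 and 2. *)
pose r := Num.min (d / 4) (e / (L + 1) / 2).
have r0 : 0 < r by rewrite lt_min !divr_gt0 // ltr_wpDl.
near=> q.
have : ball (x, y) r q by near: q; apply: (@nbhsx_ballx R (R * R)%type (x, y) r r0).
move=> [/= b1 b2]; rewrite /ball /= in b1 b2.
have e1 : Complex q.1 q.2 = Complex x y + Complex (q.1 - x) (q.2 - y).
  by apply/eqP; rewrite eq_complex /= !addrA ![_ + q.1]addrC ![_ + q.2]addrC !addrK !eqxx.
have wr : cabs (Complex (q.1 - x) (q.2 - y)) <= 2 * r.
  rewrite -(@ler_pXn2r _ 2) ?nnegrE ?cabs_ge0 ?mulr_ge0 ?(ltW r0) // cabs_sqrE.
  have h1 : (q.1 - x) ^+ 2 <= r ^+ 2.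
    by rewrite -real_normK ?num_real // distrC lerXn2r ?nnegrE ?(ltW r0) // ltW.
  have h2 : (q.2 - y) ^+ 2 <= r ^+ 2.
    by rewrite -real_normK ?num_real // distrC lerXn2r ?nnegrE ?(ltW r0) // ltW.
by have := sqr_ge0 r; rewrite exprMn; lra.
have h := hL (Complex (q.1 - x) (q.2 - y)).
rewrite -e1 in h.
have [r1 r2] : r <= d / 4 /\ r <= e / (L + 1) / 2.
  by rewrite /r !ge_min !lexx orbT.
have wd : cabs (Complex (q.1 - x) (q.2 - y)) < d.
  by lra.
have h2 : L * cabs (Complex (q.1 - x) (q.2 - y)) <= e.
  have h3 : 2 * r * (L + 1) <= e by rewrite -ler_pdivlMr ?ltr_wpDl //; lra.
  have := cabs_ge0 (Complex (q.1 - x) (q.2 - y)).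
  nra.
have h3 := cabs_subr (f (Complex x y)) (f (Complex q.1 q.2)).
have h4 := cabs_subr (f (Complex q.1 q.2)) (f (Complex x y)).
rewrite cabsC in h3; rewrite ler_norml.
have := h wd.
lra.
Unshelve. all: by end_near.
Qed.

Lemma sum_sqr_shift (a w : C) :
  cabs (a + w) ^+ 2 + cabs (a - w) ^+ 2 = 2 * cabs a ^+ 2 + 2 * cabs w ^+ 2.
Proof. by case: a w => [a1 a2] [w1 w2]; rewrite !cabs_sqrE /=; ring. Qed.

(* The term e |z|^2 beats the cubic error of subharmonic_mean and thus excludes an
   interior maximum of |f|^2 + e |z|^2. *)
Lemma max_principle_eps f (rho B e : R) : 0 <= rho -> 0 < e ->
  (forall z, cabs z <= rho -> jet f z) ->
  (forall z, cabs z = rho -> cabs (f z) <= B) ->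
  forall z, cabs z <= rho -> cabs (f z) ^+ 2 <= B ^+ 2 + e * rho ^+ 2.
Proof.
move=> rho0 e0 jf fB z zrho.
pose u (p : R * R) := cabs (f (Complex p.1 p.2)) ^+ 2 + e * (p.1 ^+ 2 + p.2 ^+ 2).
pose K := [set p : R * R | p.1 ^+ 2 + p.2 ^+ 2 <= rho ^+ 2].
have inK x y : (x, y) \in K = (cabs (Complex x y) <= rho).
  by rewrite -(@ler_pXn2r _ 2) ?nnegrE ?cabs_ge0 // cabs_sqrE; apply/idP/idP; rewrite inE.
have K0 : K !=set0 by exists (0, 0); rewrite /K /= !expr0n /= addr0 sqr_ge0.
have cu : {within K, continuous u}.
  apply: continuous_in_subspaceT => -[x y]; rewrite inK => xyK.
  have jc := jet_continuous_abs (jf _ xyK).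
  apply: cvgD.
    rewrite (_ : (fun p : R * R => _) =
      (fun p : R * R => cabs (f (Complex p.1 p.2)) * cabs (f (Complex p.1 p.2)))) //.
    exact: (cvgM jc jc).
  apply: cvgM; first exact: cvg_cst.
  by apply: cvgD; apply: cvgM; (exact: cvg_fst || exact: cvg_snd).
have [[x y] xyK xymax] := compact_EVT_max K0 (@compact_disc rho) cu.
pose a := Complex x y; have arho : cabs a <= rho by rewrite -inK.
have umax w : cabs w <= rho -> cabs (f w) ^+ 2 + e * cabs w ^+ 2 <= cabs (f a) ^+ 2 + e * cabs a ^+ 2.
  case: w => w1 w2 hw; have := xymax (w1, w2); rewrite inK => /(_ hw).
  by rewrite /u /a !cabs_sqrE.
have [ar|ar] := leP rho (cabs a).
  have {}ar : cabs a = rho by apply/eqP; rewrite eq_le arho.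
  have := umax z zrho; have := fB a ar; have := cabs_ge0 (f a); have := sqr_ge0 (cabs z).
  rewrite ar; nra.
exfalso.
have [k [d [k0 d0 hk]]] := subharmonic_mean (jf a arho).
(* The first two bounds keep the four points in the range of the mean inequality and in the disc;
   the third gives k s^3 <= e s^2. *)
pose s := Num.min (Num.min (d / 2) (rho - cabs a)) (e / (k + 1)).
have k1 : 0 < k + 1 by rewrite ltr_wpDl.
have s0 : 0 < s by rewrite !lt_min subr_gt0 ar !divr_gt0.
have [s1 s2 s3] : [/\ s <= d / 2, s <= rho - cabs a & s <= e / (k + 1)].
  by rewrite /s !ge_min !lexx !orbT.
pose w := real_complex R s; have ws : cabs w = s by rewrite cabsR gtr0_norm.
have iws : cabs (ei * w) = s by rewrite cabsM cabs_ei mul1r ws.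
have h := hk w; rewrite ws in h.
have {}h : 4 * cabs (f a) ^+ 2 - k * s ^+ 3 <=
   cabs (f (a + w)) ^+ 2 + cabs (f (a - w)) ^+ 2 +
   (cabs (f (a + ei * w)) ^+ 2 + cabs (f (a - ei * w)) ^+ 2) by apply: h; lra.
(* By the parallelogram law the term e |z|^2 gains 4 e s^2 over the four points; maximality at [a]
   bounds this gain by the cubic error k s^3. *)
have := sum_sqr_shift a w; have := sum_sqr_shift a (ei * w); rewrite ws iws.
have D v : cabs v = s -> cabs (a + v) <= rho.
  by move=> vs; have := cabsD a v; rewrite vs; lra.
have u1 := umax _ (D _ ws); have u2 := umax (a - w); have u3 := umax _ (D _ iws).
have u4 := umax (a - ei * w).
have {}u2 := u2 (D (- w) _); have {}u4 := u4 (D (- (ei * w)) _).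
rewrite !cabsN ws iws in u2 u4; have {}u2 := u2 erefl; have {}u4 := u4 erefl.
move=> /(congr1 ( *%R e)) m1 /(congr1 ( *%R e)) m2.
have h5 : 4 * e * s ^+ 2 <= k * s ^+ 3 by lra.
have h1 : s * (k + 1) <= e by rewrite -ler_pdivlMr.
have h2 : k * s * s ^+ 2 <= e * s ^+ 2.
  by rewrite ler_wpM2r ?sqr_ge0 //; move: h1 s0; rewrite mulrDr mulr1 mulrC; lra.
have h3 : 0 < e * s ^+ 2 by rewrite mulr_gt0 ?exprn_gt0.
have h4 : k * s ^+ 3 = k * s * s ^+ 2 by ring.
lra.
Qed.

Lemma max_principle f (rho B : R) : 0 <= rho ->
  (forall z, cabs z <= rho -> jet f z) ->
  (forall z, cabs z = rho -> cabs (f z) <= B) ->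
  forall z, cabs z <= rho -> cabs (f z) <= B.
Proof.
move=> rho0 jf fB z zr.
have B0 : 0 <= B.
  apply: le_trans (fB (real_complex R rho) _); first exact: cabs_ge0.
  by rewrite cabsR ger0_norm.
rewrite -(@ler_pXn2r _ 2) ?nnegrE ?cabs_ge0 //; apply/ler_addgt0Pr => e e0.
have r1 : 0 < rho ^+ 2 + 1 by rewrite ltr_wpDl ?sqr_ge0.
apply: le_trans (max_principle_eps rho0 (divr_gt0 e0 r1) jf fB zr) _.
by rewrite lerD2l mulrAC ler_pdivrMr // ler_pM2l // lerDl.
Qed.

End MaxPrinciple.

(** * Power series *)

Section ScalarSeries.
Variable R : realType.
Local Notation C := (R[i]).
Implicit Types (f g : C -> C) (a z w : C) (c : nat -> C).

Definition psum c z n : C := \sum_(k < n) z ^+ k * c k.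

Definition sersum c z (s : C) := forall e : R, 0 < e ->
  exists N, forall n, (N <= n)%N -> cabs (psum c z n - s) <= e.

Lemma psumS c z n : psum c z n.+1 = psum c z n + z ^+ n * c n.
Proof. by rewrite /psum big_ord_recr. Qed.

Lemma psumSl c z n : psum c z n.+1 = c 0%N + z * psum (fun k => c k.+1) z n.
Proof.
rewrite /psum big_ord_recl expr0 mul1r mulr_sumr; congr (_ + _).
by apply: eq_bigr => k _; rewrite exprS mulrA.
Qed.

Lemma geom_small (q B e : R) : 0 <= q < 1 -> 0 < e ->
  exists N, forall n, (N <= n)%N -> B * q ^+ n <= e.
Proof.
move=> /andP[q0 q1] e0; have h : `|q| < 1 by rewrite ger0_norm.
have /cvgrPdist_le /(_ _ e0) [N _ hN] := cvg_geometric B h.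
exists N => n Nn; have := hN n Nn; rewrite /= sub0r normrN; apply: le_trans.
exact: ler_norm.
Qed.

Lemma geom_sum_le (q : R) n : 0 <= q < 1 -> \sum_(k < n) q ^+ k <= (1 - q)^-1.
Proof.
move=> /andP[q0 q1]; have h : 0 < 1 - q by rewrite subr_gt0.
rewrite -[leRHS]mul1r ler_pdivlMr // -[1 - q]opprB mulrN mulrC -subrX1 opprB.
by rewrite lerBlDr lerDl exprn_ge0.
Qed.

Lemma psum_diff_le c z (B q : R) n m : 0 <= q < 1 -> (n <= m)%N ->
  (forall k, cabs z ^+ k * cabs (c k) <= B * q ^+ k) ->
  cabs (psum c z m - psum c z n) <= B * q ^+ n / (1 - q).
Proof.
move=> q01 nm hc; have B0 : 0 <= B.
  by have := hc 0%N; rewrite !expr0 mul1r mulr1; apply: le_trans; exact: cabs_ge0.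
rewrite -(subnKC nm); set p := (m - n)%N.
have -> : psum c z (n + p) - psum c z n = \sum_(k < p) z ^+ (n + k) * c (n + k)%N.
  by rewrite /psum big_split_ord /= [LHS]addrC addKr.
apply: le_trans (cabs_sum _) _.
apply: (le_trans (y := \sum_(k < p) B * q ^+ n * q ^+ k)).
  by apply: ler_sum => k _; rewrite cabsM cabsX -mulrA -exprD hc.
rewrite -mulr_sumr ler_wpM2l ?geom_sum_le ?mulr_ge0 ?exprn_ge0 //.
by case/andP: q01.
Qed.

Lemma sersum_tail c z s (B q : R) n : 0 <= q < 1 -> sersum c z s ->
  (forall k, cabs z ^+ k * cabs (c k) <= B * q ^+ k) ->
  cabs (psum c z n - s) <= B * q ^+ n / (1 - q).
Proof.
move=> q01 cs hc; apply/ler_addgt0Pr => e /cs [N hN].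
have h1 := hN (maxn N n) (leq_maxl _ _); have h2 := psum_diff_le q01 (leq_maxr N n) hc.
rewrite (_ : psum c z n - s = (psum c z (maxn N n) - s) -
  (psum c z (maxn N n) - psum c z n)); last by ring.
by apply: le_trans (cabsB _ _) _; rewrite addrC lerD.
Qed.

Lemma sersum_bound c z s (B q : R) : 0 <= q < 1 -> sersum c z s ->
  (forall k, cabs z ^+ k * cabs (c k) <= B * q ^+ k) -> cabs s <= B / (1 - q).
Proof.
move=> q01 cs hc; have := sersum_tail 0 q01 cs hc.
by rewrite expr0 mulr1 /psum big_ord0 sub0r cabsN.
Qed.

Lemma sersum_unique c z s s' : sersum c z s -> sersum c z s' -> s = s'.
Proof.
move=> h h'; apply/eqP; rewrite -subr_eq0; apply/eqP; apply: cabs_le_eps => e e0.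
have e2 : 0 < e / 2 by lra.
have [N hN] := h _ e2; have [N' hN'] := h' _ e2.
have := hN _ (leq_maxl N N'); have := hN' _ (leq_maxr N N').
set p := psum _ _ _ => h1 h2; rewrite (_ : s - s' = (p - s') - (p - s)); last by ring.
by apply: le_trans (cabsB _ _) _; lra.
Qed.

Lemma eq_sersum c c' z s : c =1 c' -> sersum c z s -> sersum c' z s.
Proof.
move=> cc h e /h [N hN]; exists N => n /hN; rewrite /psum.
by under eq_bigr do rewrite cc.
Qed.

Lemma sersum_shift c z s : sersum (fun k => c k.+1) z s -> sersum c z (c 0%N + z * s).
Proof.
move=> h e e0; have e1 : 0 < e / (cabs z + 1) by rewrite divr_gt0 // ltr_wpDl ?cabs_ge0.
have [N hN] := h _ e1; exists N.+1 => -[//|n] Nn; rewrite psumSl.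
rewrite (_ : _ - _ = z * (psum (fun k => c k.+1) z n - s)); last by ring.
rewrite cabsM; apply: le_trans (ler_wpM2l (cabs_ge0 z) (hN n Nn)) _.
rewrite mulrCA ger_pMr // ler_pdivrMr ?mul1r ?ltr_wpDl ?cabs_ge0 //.
by rewrite lerDl.
Qed.

Lemma real_series_cvg (u : nat -> R) (B q : R) : 0 <= q < 1 ->
  (forall k, `|u k| <= B * q ^+ k) ->
  exists s, forall e : R, 0 < e -> exists N, forall n, (N <= n)%N -> `|\sum_(k < n) u k - s| <= e.
Proof.
move=> q01 hu; have : cvgn (series u).
  apply: normed_cvg; apply: (@series_le_cvg _ _ (geometric B q)) => //.
  - by move=> n; exact: normr_ge0.
  - by move=> n; exact: (le_trans (normr_ge0 _) (hu n)).
  - by apply: is_cvg_geometric_series; rewrite ger0_norm; case/andP: q01.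
move=> /cvgrPdist_le cu; exists (limn (series u)) => e /cu [N _ hN].
exists N => n /hN; rewrite /series /= distrC.
by rewrite big_mkord.
Qed.

Lemma sersum_exists c z (B q : R) : 0 <= q < 1 ->
  (forall k, cabs z ^+ k * cabs (c k) <= B * q ^+ k) -> exists s, sersum c z s.
Proof.
move=> q01 hc.
have hc' k : cabs (z ^+ k * c k) <= B * q ^+ k by rewrite cabsM cabsX.
have [x hx] := real_series_cvg q01 (fun k => le_trans (cabs_Re _) (hc' k)).
have [y hy] := real_series_cvg q01 (fun k => le_trans (cabs_Im _) (hc' k)).
exists (Complex x y) => e e0; have e2 : 0 < e / 2 by lra.
have [N hN] := hx _ e2; have [N' hN'] := hy _ e2.
exists (maxn N N') => n; rewrite geq_max => /andP[/hN h1 /hN' h2].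
have -> : psum c z n - Complex x y =
   Complex (\sum_(k < n) complex.Re (z ^+ k * c k) - x) (\sum_(k < n) complex.Im (z ^+ k * c k) - y).
  have e1 : complex.Re (psum c z n) = \sum_(k < n) complex.Re (z ^+ k * c k).
    exact: (raddf_sum (@complex.Re R)).
  have e3 : complex.Im (psum c z n) = \sum_(k < n) complex.Im (z ^+ k * c k).
    exact: (raddf_sum (@complex.Im R)).
  by case: (psum c z n) e1 e3 => a b /= -> ->.
set a := _ - x in h1 *; set b := _ - y in h2 *.
rewrite -(@ler_pXn2r _ 2) ?nnegrE ?cabs_ge0 ?(ltW e0) // cabs_sqrE.
have h3 : a ^+ 2 <= (e / 2) ^+ 2 by rewrite -real_normK ?num_real // lerXn2r ?nnegrE ?(ltW e2).
have h4 : b ^+ 2 <= (e / 2) ^+ 2 by rewrite -real_normK ?num_real // lerXn2r ?nnegrE ?(ltW e2).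
have := sqr_ge0 e; rewrite exprMn in h3 h4; lra.
Qed.

Lemma sersum_terms c z s : sersum c z s -> exists B : R, forall k, cabs z ^+ k * cabs (c k) <= B.
Proof.
move=> /(_ 1 ltr01) [N hN]; exists (2 + \sum_(k < N) cabs (z ^+ k * c k)) => k.
have S0 : 0 <= \sum_(k < N) cabs (z ^+ k * c k) by apply: sumr_ge0 => i _; exact: cabs_ge0.
rewrite -cabsX -cabsM; have [kN|Nk] := ltnP k N.
  rewrite (bigD1 (Ordinal kN)) //=.
  have : 0 <= \sum_(i < N | i != Ordinal kN) cabs (z ^+ i * c i).
    by apply: sumr_ge0 => i _; exact: cabs_ge0.
  by lra.
have h1 := hN k Nk; have h2 := hN k.+1 (leqW Nk).
rewrite (_ : z ^+ k * c k = (psum c z k.+1 - s) - (psum c z k - s)); last first.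
  by rewrite psumS; ring.
by apply: le_trans (cabsB _ _) _; lra.
Qed.

Lemma sersum_geom c r f rho : 0 < rho < r -> (forall z, cabs z < r -> sersum c z (f z)) ->
  exists B : R, forall k, cabs (c k) * rho ^+ k <= B.
Proof.
move=> /andP[r0 rr] h; have rA : cabs (real_complex R rho) = rho by rewrite cabsR gtr0_norm.
have [|B hB] := @sersum_terms c (real_complex R rho) (f (real_complex R rho)).
  by apply: h; rewrite rA.
by exists B => k; have := hB k; rewrite rA mulrC.
Qed.

End ScalarSeries.

(** * Taylor series of functions with jets *)

Section Taylor.
Variable R : realType.
Local Notation C := (R[i]).
Implicit Types (f g : C -> C) (a z w : C) (c : nat -> C).

Lemma ratio_lt1 (x y : R) : 0 <= x -> x < y -> 0 <= x / y < 1.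
Proof.
move=> x0 xy; have y0 : 0 < y by apply: le_lt_trans xy.
by rewrite divr_ge0 ?(ltW y0) //= ltr_pdivrMr ?mul1r.
Qed.

Lemma geom_terms c z (B rho : R) : 0 < rho -> (forall k, cabs (c k) * rho ^+ k <= B) ->
  forall k, cabs z ^+ k * cabs (c k) <= B * (cabs z / rho) ^+ k.
Proof.
move=> r0 hB k; rewrite expr_div_n mulrA [B * _]mulrC -mulrA.
by rewrite ler_wpM2l ?exprn_ge0 ?cabs_ge0 // ler_pdivlMr ?exprn_gt0.
Qed.

(* The divided difference of a power series at a is a power series; its
   coefficients are the values at a of the tails of the original one. *)
Lemma sersum_divdiff c f r a (rho : R) : cabs a < rho -> rho < r ->
  (forall z, cabs z < r -> sersum c z (f z)) ->
  exists c' g, (forall z, cabs z < rho -> sersum c' z (g z)) /\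
    forall z, cabs z < rho -> f z = f a + (z - a) * g z.
Proof.
move=> ar rr hf; have rho0 : 0 < rho by apply: le_lt_trans ar; exact: cabs_ge0.
have [B hB] := sersum_geom (introT andP (conj rho0 rr)) hf.
have q01 := ratio_lt1 (cabs_ge0 a) ar.
have tl k m : cabs (c (k + m)%N) * rho ^+ m <= B / rho ^+ k.
  by rewrite ler_pdivlMr ?exprn_gt0 // -mulrA -exprD [(m + k)%N]addnC.
have /choice [d hd] : forall k, exists s, sersum (fun m => c (k + m)%N) a s.
  by move=> k; apply: (sersum_exists q01 (geom_terms a rho0 (tl k))).
have d0 : d 0%N = f a.
  by apply: (sersum_unique (hd 0%N)); apply: hf; exact: lt_trans rr.
have dS k : d k = c k + a * d k.+1.
  apply: sersum_unique (hd k) _; rewrite -{2}[k]addn0.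
  apply: (sersum_shift (c := fun m => c (k + m)%N)).
  by apply: eq_sersum (hd k.+1) => m; rewrite addSnnS.
have dB k : cabs (d k) * rho ^+ k <= B / (1 - cabs a / rho).
  rewrite -ler_pdivlMr ?exprn_gt0 // mulrAC.
  exact: (sersum_bound q01 (hd k) (geom_terms a rho0 (tl k))).
set B' := B / (1 - _) in dB.
have dB' k : cabs (d k.+1) * rho ^+ k <= B' / rho.
  by rewrite ler_pdivlMr // -mulrA -exprSr.
have /choice [g hg] : forall z, exists s, cabs z < rho -> sersum (fun k => d k.+1) z s.
  move=> z; have [zr|_] := ltP (cabs z) rho; last by exists 0.
  have [s hs] := sersum_exists (ratio_lt1 (cabs_ge0 z) zr) (geom_terms z rho0 dB').
  by exists s.
exists (fun k => d k.+1), g; split=> // z zr.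
have tele n : (z - a) * psum (fun k => d k.+1) z n = z ^+ n * d n - f a + psum c z n.
  elim: n => [|n IH]; first by rewrite /psum !big_ord0 expr0 d0; ring.
  by rewrite !psumS mulrDr IH (dS n) exprS; ring.
apply/eqP; rewrite -subr_eq0; apply/eqP; apply: cabs_le_eps => e e0.
have e3 : 0 < e / 3 by lra.
have z1 : 0 < cabs (z - a) + 1 by rewrite ltr_wpDl ?cabs_ge0.
have [N1 h1] := hf z (lt_trans zr rr) _ e3.
have [N2 h2] := hg z zr _ (divr_gt0 e3 z1).
have [N3 h3] := geom_small B' (ratio_lt1 (cabs_ge0 z) zr) e3.
pose n := maxn N1 (maxn N2 N3).
have {}h1 := h1 n (leq_maxl _ _).
have {}h2 : cabs (psum (fun k => d k.+1) z n - g z) <= e / 3 / (cabs (z - a) + 1).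
  by apply: h2; rewrite /n !leq_max leqnn !orbT.
have {}h3 : B' * (cabs z / rho) ^+ n <= e / 3 by apply: h3; rewrite /n !leq_max leqnn !orbT.
have h4 : cabs (z ^+ n * d n) <= e / 3.
  by rewrite cabsM cabsX; exact: le_trans (geom_terms z rho0 dB n) h3.
rewrite (_ : _ - _ = (z - a) * (psum (fun k => d k.+1) z n - g z) - z ^+ n * d n -
   (psum c z n - f z)); last by rewrite mulrBr tele; ring.
have h5 : cabs ((z - a) * (psum (fun k => d k.+1) z n - g z)) <= e / 3.
  rewrite cabsM mulrC; apply: le_trans (_ : _ <= e / 3 / (cabs (z - a) + 1) * (cabs (z - a) + 1)) _.
    by rewrite ler_pM ?cabs_ge0 // lerDl.
  by rewrite mulfVK ?gt_eqF.
apply: le_trans (cabsB _ _) _.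
by have := cabsB ((z - a) * (psum (fun k => d k.+1) z n - g z)) (z ^+ n * d n); lra.
Qed.

(** Induction on the order: the divided difference at [a] is again a power series, on a slightly
    smaller disc, and multiplying its expansion by z - a raises the order by one. Local boundedness
    is the base case. *)
Lemma jet_sersum c f r a : cabs a < r ->
  (forall z, cabs z < r -> sersum c z (f z)) -> jet f a.
Proof.
move=> ar hf n; elim: n c f r ar hf => [|n IH] c f r ar hf.
  pose rho := (cabs a + r) / 2; have rr : cabs a < rho < r by rewrite /rho; apply/andP; split; lra.
  have rho0 : 0 < rho < r by have := cabs_ge0 a; lra.
  have [B hB] := sersum_geom rho0 hf.
  pose r' := (cabs a + rho) / 2; have rr' : cabs a < r' < rho.
    by rewrite /r'; apply/andP; split; lra.
  exists 0, (B / (1 - r' / rho)), (r' - cabs a); split; first by lra.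
  move=> w hw; rewrite horner0 subr0 expr0 mulr1.
  have zr : cabs (a + w) <= r' by have := cabsD a w; lra.
  have q01 : 0 <= r' / rho < 1 by apply: ratio_lt1; have := cabs_ge0 a; lra.
  apply: (sersum_bound q01 (hf _ _)); first by lra.
  move=> k; apply: le_trans (_ : _ <= r' ^+ k * cabs (c k)) _.
    by rewrite ler_wpM2r ?cabs_ge0 // lerXn2r ?nnegrE ?cabs_ge0 //; have := cabs_ge0 a; lra.
  have r'A : cabs (real_complex R r') = r' by rewrite cabsR ger0_norm //; have := cabs_ge0 a; lra.
  by rewrite -r'A; apply: geom_terms => //; case/andP: rho0.
pose rho := (cabs a + r) / 2; have [ar' rr] : cabs a < rho /\ rho < r by rewrite /rho; split; lra.
have [c' [g [hg fg]]] := sersum_divdiff ar' rr hf.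
have [P [B [d [d0 hP]]]] := IH _ _ _ ar' hg.
exists ((f a)%:P + 'X * P), B, (Num.min d (rho - cabs a)); split; first by rewrite lt_min d0 subr_gt0.
move=> w; rewrite lt_min => /andP[wd wr]; rewrite fg; last by have := cabsD a w; lra.
rewrite !hornerE [a + w]addrC addrK (_ : _ - _ = w * (g (w + a) - P.[w])); last by ring.
rewrite cabsM exprS mulrCA ler_wpM2l ?cabs_ge0 // [w + a]addrC.
exact: hP.
Qed.

Definition jets_on f r := forall z, cabs z < r -> jet f z.

Lemma jet_divz f r : 0 < r -> jets_on f r ->
  exists g, jets_on g r /\ forall z, f z = f 0 + z * g z.
Proof.
move=> r0 jf; have j0 : jet f 0 by apply: jf; rewrite cabs0.
have [L [d [L0 d0 hL]]] := jet_lip j0.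
have [|w w0|v hv] := @jet_quot _ (fun z => f z - f 0) 0 1 L d _ d0.
- by apply: jetB => //; exact: jet_cst.
- by rewrite expr1; exact: hL.
exists (fun z => if z == 0 then v else (f z - f 0) / z); split=> [z zr|z]; last first.
  by case: eqVneq => [->|z0]; rewrite ?mul0r ?addr0 // mulrCA divff // mulr1 addrC subrK.
have [->|z0] := eqVneq z 0.
  by apply: eq_jet hv => w; rewrite subr0 expr1.
apply: (@jet_near _ _ (fun z => (f z - f 0) / z) _ (cabs z)); first by rewrite cabs_gt0.
  move=> w wz; rewrite ifN //; apply: contraTneq wz => zw.
  by rewrite (_ : w = - z) ?cabsN ?ltxx // -[w](addKr z) zw addr0.
apply: jet_div; [apply: jetB; [exact: jf|exact: jet_cst]|exact: jet_id|exact: z0].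
Qed.

(** X^n - 1 is separable in characteristic 0 and splits over C, so it has n distinct roots. *)
Lemma prim_root_exists n : (0 < n)%N -> exists z : C, n.-primitive_root z.
Proof.
move=> n0; have [s Ds] := closed_field_poly_normal ('X^n - 1 : {poly C}).
rewrite (monicP (monicXnsubC _ n0)) scale1r in Ds.
have us : uniq s by rewrite -separable_prod_XsubC -Ds separable_Xn_sub_1 // pnatr_eq0 -lt0n.
have /hasP [z _ pz] : has n.-primitive_root s; last by exists z.
apply: has_prim_root => //; first by apply/allP => z zs; rewrite /root_of_unity Ds root_prod_XsubC.
by rewrite -ltnS -(size_prod_XsubC s id) -Ds size_XnsubC.
Qed.

Lemma sum_prim_root n (w : C) k : n.-primitive_root w -> (0 < k < n)%N ->
  \sum_(j < n) (w ^+ j) ^+ k = 0.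
Proof.
move=> pw /andP[k0 kn].
have w1 : w ^+ k - 1 != 0.
  by rewrite subr_eq0 -(prim_order_dvd pw) gtnNdvd.
apply: (mulfI w1); rewrite mulr0.
rewrite (eq_bigr (fun j : 'I_n => (w ^+ k) ^+ j)) => [|j _]; last by rewrite exprAC.
by rewrite -subrX1 exprAC (prim_expr_order pw) expr1n subrr.
Qed.

(** [jet_divz] is iterated: [F n] is the n-th Taylor remainder divided by z^n. It has jets on the
    whole disc, the centre included, so the maximum principle applies to it. *)
Lemma jet_taylor_rem f r : 0 < r -> jets_on f r ->
  exists c (F : nat -> C -> C), forall n, [/\ jets_on (F n) r, F n 0 = c n &
     forall z, f z = psum c z n + z ^+ n * F n z].
Proof.
move=> r0 jf.
have /choice [G hG] : forall g, exists h, jets_on g r ->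
    jets_on h r /\ forall z, g z = g 0 + z * h z.
  move=> g; have [jg|ng] := pselect (jets_on g r); last by exists g.
  by have [h hh] := jet_divz r0 jg; exists h.
pose F n := iter n G f; have jF n : jets_on (F n) r.
  by elim: n => //= n IH; case: (hG _ IH).
exists (fun n => F n 0), F => n; split=> //.
elim: n => [|n IH] z; first by rewrite /psum big_ord0 add0r expr0 mul1r.
rewrite psumS IH exprSr -addrA; congr (_ + _).
by rewrite -mulrA -mulrDr; congr (_ * _); case: (hG _ (jF n)).
Qed.

(** Cauchy's estimate with means over roots of unity in place of integrals. After averaging, z^(n+1)
    h is the mean of f minus c_0; both are at most B, whence 2 B, and the maximum principle carries
    the bound on [h] from the circle to its value [c n.+1] at 0. *)
Lemma jet_coef_bound f r rho (B : R) c (F : nat -> C -> C) : 0 < rho -> rho < r ->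
  (forall z, cabs z < r -> cabs (f z) <= B) ->
  (forall n, [/\ jets_on (F n) r, F n 0 = c n & forall z, f z = psum c z n + z ^+ n * F n z]) ->
  forall n, cabs (c n) * rho ^+ n <= 2 * B.
Proof.
move=> rho0 rr fB hF n; have r0 : 0 < r by exact: lt_trans rr.
have cB : cabs (c 0%N) <= B.
  have [_ <- f0] := hF 0%N; have := fB 0; rewrite f0 cabs0 /psum big_ord0 expr0 add0r mul1r.
  exact.
case: n => [|n]; first by rewrite expr0 mulr1; have := cabs_ge0 (c 0%N); lra.
have [w pw] := prim_root_exists (ltn0Sn n).
have w1 : cabs w = 1.
  have := congr1 (@cabs R) (prim_expr_order pw); rewrite cabsX cabs1 => /eqP.
  by rewrite pexpr_eq1 ?cabs_ge0 // => /eqP.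
have [jF F0 fF] := hF n.+1.
have nn0 : (n.+1%:R : C) != 0 by rewrite pnatr_eq0.
pose h z := n.+1%:R^-1 * \sum_(j < n.+1) F n.+1 (w ^+ j * z).
have h0 : h 0 = c n.+1.
  rewrite /h (eq_bigr (fun=> c n.+1)) => [|j _]; last by rewrite mulr0 F0.
  by rewrite sumr_const card_ord -[c n.+1 *+ _]mulr_natl mulKf.
(* The mean over the roots of unity kills the coefficients 1, ..., n. *)
have hf z : z ^+ n.+1 * h z = n.+1%:R^-1 * (\sum_(j < n.+1) f (w ^+ j * z)) - c 0%N.
  have -> : \sum_(j < n.+1) f (w ^+ j * z) =
      n.+1%:R * c 0%N + z ^+ n.+1 * \sum_(j < n.+1) F n.+1 (w ^+ j * z).
    rewrite (eq_bigr (fun j : 'I_n.+1 => psum c (w ^+ j * z) n.+1 +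
        z ^+ n.+1 * F n.+1 (w ^+ j * z))) => [|j _]; last first.
      by rewrite fF exprMn exprAC (prim_expr_order pw) expr1n mul1r.
    rewrite big_split /= -mulr_sumr; congr (_ + _).
    rewrite /psum exchange_big big_ord_recl /= [X in _ + X]big1 ?addr0 => [|k _].
      rewrite (eq_bigr (fun=> c 0%N)) => [|j _]; last by rewrite expr0 mul1r.
      by rewrite sumr_const card_ord -[c 0%N *+ _]mulr_natl.
    rewrite (eq_bigr (fun j : 'I_n.+1 => (w ^+ j) ^+ k.+1 * (z ^+ k.+1 * c k.+1))) => [|j _].
      by rewrite -mulr_suml (sum_prim_root pw) ?mul0r //= ltnS.
    by rewrite exprMn mulrA.
  by rewrite /h mulrDr mulKf //; ring.
have wz j z : cabs (w ^+ j * z) = cabs z by rewrite cabsM cabsX w1 expr1n mul1r.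
have jh z : cabs z <= rho -> jet h z.
  move=> zr; apply: jetM; first exact: jet_cst.
  apply: jet_sum => j; apply: (jet_comp (g := fun z => w ^+ j * z)).
    by apply: jetM; [exact: jet_cst|exact: jet_id].
  by apply: jF; rewrite wz; exact: le_lt_trans rr.
have := max_principle (ltW rho0) jh (B := 2 * B / rho ^+ n.+1) _ (z := 0).
rewrite h0 cabs0 ler_pdivlMr ?exprn_gt0 //; apply; last exact: ltW.
move=> z zr; rewrite ler_pdivlMr ?exprn_gt0 // -zr -cabsX -cabsM mulrC hf.
apply: le_trans (cabsB _ _) _; rewrite cabsM cabsV cabs_nat.
have : cabs (\sum_(j < n.+1) f (w ^+ j * z)) <= n.+1%:R * B.
  apply: le_trans (cabs_sum _) _; apply: le_trans (_ : _ <= \sum_(j < n.+1) B) _.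
    by apply: ler_sum => j _; apply: fB; rewrite wz zr.
  by rewrite sumr_const card_ord -[B *+ _]mulr_natl.
rewrite mulrC -ler_pdivrMr ?ltr0Sn // => h1; rewrite mulrC (mulr_natl B 2) mulr2n.
exact: lerD h1 cB.
Qed.

(** That the series sums to [f] follows from the remainders [F n]: they are estimated on a circle
    around z and carried inwards by the maximum principle. *)
Theorem jet_taylor f r (B : R) : 0 < r -> jets_on f r -> (forall z, cabs z < r -> cabs (f z) <= B) ->
  exists c, forall z, cabs z < r -> sersum c z (f z).
Proof.
move=> r0 jf fB; have [c [F hF]] := jet_taylor_rem r0 jf.
exists c => z zr e e0.
pose rho := (cabs z + r) / 2; pose rho1 := (cabs z + rho) / 2.
have zg := cabs_ge0 z.
have [z1 r1 rr] : [/\ cabs z < rho1, rho1 < rho & rho < r] by rewrite /rho1 /rho; split; lra.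
have rho1_gt0 : 0 < rho1 by exact: le_lt_trans z1.
have rho0 : 0 < rho by exact: lt_trans r1.
have hc := jet_coef_bound rho0 rr fB hF.
pose q := rho1 / rho; have q01 : 0 <= q < 1 by apply: ratio_lt1; rewrite ?ltW.
pose B1 := 2 * B / (1 - q).
(* On the circle of radius rho1, z^n F_n is f minus a partial sum, hence at most B + B1; as |z| <
   rho1, the remainder at z decays geometrically. *)
have FB n w : cabs w <= rho1 -> cabs (F n w) <= (B + B1) / rho1 ^+ n.
  have [jF _ fF] := hF n; apply: max_principle; rewrite ?(ltW rho1_gt0) //.
    by move=> x xr; apply: jF; lra.
  move=> x xr; rewrite ler_pdivlMr ?exprn_gt0 // mulrC -{1}xr -cabsX -cabsM.
  rewrite (_ : x ^+ n * _ = f x - psum c x n); last by rewrite fF; ring.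
  apply: le_trans (cabsB _ _) _; rewrite lerD ?fB //; first by lra.
  have := psum_diff_le (c := c) (z := x) (B := 2 * B) q01 (leq0n n).
  rewrite /psum big_ord0 subr0 expr0 mulr1; apply.
  by move=> k; rewrite /q -xr; exact: geom_terms.
have [N hN] := geom_small (B + B1) (ratio_lt1 zg z1) e0.
exists N => n /hN; apply: le_trans; have [_ _ fF] := hF n.
rewrite fF opprD addNKr cabsN cabsM cabsX expr_div_n mulrCA ler_wpM2l ?exprn_ge0 //.
by apply: FB; exact: ltW.
Qed.

End Taylor.

(** * Matrix functions *)

Section MatrixJets.
Variable R : realType.
Local Notation C := (R[i]).

Definition mjet m n (F : C -> 'M[C]_(m, n)) a := forall i j, jet (fun z => F z i j) a.

Lemma real_gt0 (e : C) : 0 < e -> exists2 r : R, 0 < r & e = real_complex R r.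
Proof.
rewrite ltcE => /andP[/eqP /= e1 e2]; exists (complex.Re e) => //.
by case: e e1 {e2} => a b /= ->.
Qed.

Lemma pser_toP m n (c : nat -> 'M[C]_(m, n)) z f :
  pser_to c z f <-> forall i j, sersum (fun k => c k i j) z (f i j).
Proof.
have E K i j : (\sum_(k < K) z ^+ k *: c k) i j = psum (fun k => c k i j) z K.
  by rewrite /psum summxE; apply: eq_bigr => k _; rewrite mxE.
split=> [/cvg_ballP h i j e e0|h].
  have /h [N _ hN] : 0 < real_complex R e by rewrite ltcR.
  exists N => k /hN [_ /(_ i j)]; rewrite /ball /= E.
  by rewrite ltcabs cabsC => /ltW.
apply/cvg_ballP => e /real_gt0 [r r0 ->].
have r2 : 0 < r / 2 by lra.
have /choice [Nf hNf] : forall ij : 'I_m * 'I_n, exists N, forall k, (N <= k)%N ->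
    cabs (psum (fun k => c k ij.1 ij.2) z k - f ij.1 ij.2) <= r / 2.
  by move=> ij; exact: h.
exists (\max_ij Nf ij)%N => // k /= Nk; split; first by rewrite ltcR.
move=> i j; rewrite /ball /= E ltcabs cabsC.
have := hNf (i, j) k; rewrite /= => hk; apply: le_lt_trans (hk _) _; last by lra.
by apply: leq_trans Nk; exact: (leq_bigmax (i, j)).
Qed.

Lemma mjet_near m n (F G : C -> 'M[C]_(m, n)) a (d : R) : 0 < d ->
  (forall w, cabs w < d -> F (a + w) = G (a + w)) -> mjet G a -> mjet F a.
Proof.
move=> d0 FG jG i j; apply: jet_near d0 _ (jG i j) => w /FG ->; by [].
Qed.

Lemma eq_mjet m n (F G : C -> 'M[C]_(m, n)) a : F =1 G -> mjet G a -> mjet F a.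
Proof. by move=> FG jG i j; apply: eq_jet (jG i j) => z; rewrite FG. Qed.

Lemma mjet_cst m n (A : 'M[C]_(m, n)) a : mjet (fun=> A) a.
Proof. by move=> i j; exact: jet_cst. Qed.

Lemma mjetD m n (F G : C -> 'M[C]_(m, n)) a :
  mjet F a -> mjet G a -> mjet (fun z => F z + G z) a.
Proof.
by move=> jF jG i j; apply: eq_jet (jetD (jF i j) (jG i j)) => z; rewrite mxE.
Qed.

Lemma mjetZ m n (f : C -> C) (F : C -> 'M[C]_(m, n)) a :
  jet f a -> mjet F a -> mjet (fun z => f z *: F z) a.
Proof.
by move=> jf jF i j; apply: eq_jet (jetM jf (jF i j)) => z; rewrite mxE.
Qed.

Lemma mjetB m n (F G : C -> 'M[C]_(m, n)) a :
  mjet F a -> mjet G a -> mjet (fun z => F z - G z) a.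
Proof.
by move=> jF jG i j; apply: eq_jet (jetB (jF i j) (jG i j)) => z; rewrite !mxE.
Qed.

Lemma mjetM m n q (F : C -> 'M[C]_(m, n)) (G : C -> 'M[C]_(n, q)) a :
  mjet F a -> mjet G a -> mjet (fun z => F z *m G z) a.
Proof.
move=> jF jG i j.
apply: eq_jet (jet_sum _ _ (fun k => jetM (jF i k) (jG k j))) => z.
by rewrite mxE.
Qed.

Lemma jet_det n (F : C -> 'M[C]_n) a : mjet F a -> jet (fun z => \det (F z)) a.
Proof.
move=> jF; apply: jet_sum => s; apply: jetM; first exact: jet_cst.
by apply: jet_prod => i; exact: jF.
Qed.

Lemma mjet_adj n (F : C -> 'M[C]_n) a : mjet F a -> mjet (fun z => \adj (F z)) a.
Proof.
move=> jF i j; apply: eq_jet (_ : jet (fun z => (-1) ^+ (j + i) * \det (row' j (col' i (F z)))) a).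
  by move=> z; rewrite mxE.
apply: jetM; first exact: jet_cst.
by apply: jet_det => k l; apply: eq_jet (jF (lift j k) (lift i l)) => z; rewrite !mxE.
Qed.

Lemma jet_neq0 (f : C -> C) a : jet f a -> f a != 0 ->
  exists2 d : R, 0 < d & forall w, cabs w < d -> f (a + w) != 0.
Proof.
move=> jf fa; have [L [d [L0 d0 hL]]] := jet_lip jf.
have fa0 : 0 < cabs (f a) by rewrite cabs_gt0.
exists (Num.min d (cabs (f a) / (L + 1))); first by rewrite lt_min d0 divr_gt0 // ltr_wpDl.
move=> w; rewrite lt_min ltr_pdivlMr ?ltr_wpDl // => /andP[/hL h1 h2].
apply: contraTneq h2 => f0; rewrite -leNgt; move: h1; rewrite f0 sub0r cabsN => h1.
by apply: le_trans h1 _; rewrite mulrC ler_wpM2l ?cabs_ge0 // lerDl.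
Qed.

(** Cramer's formula. [invmx] returns its argument on singular matrices, so the determinant has to
    be nonzero in a whole neighbourhood. *)
Lemma mjet_inv n (F : C -> 'M[C]_n) a : mjet F a -> F a \in unitmx ->
  mjet (fun z => invmx (F z)) a.
Proof.
move=> jF uF; have jd := jet_det jF.
have d0 : \det (F a) != 0 by move: uF; rewrite unitmxE unitfE.
have [d dd hd] := jet_neq0 jd d0.
apply: mjet_near dd _ (mjetZ (jetV jd d0) (mjet_adj jF)) => w /hd h.
by rewrite /invmx unitmxE unitfE h.
Qed.

Lemma mjet_comp m n (F : C -> 'M[C]_(m, n)) (g : C -> C) a :
  jet g a -> mjet F (g a) -> mjet (fun z => F (g z)) a.
Proof. by move=> jg jF i j; exact: (jet_comp jg (jF i j)). Qed.

Lemma mjet_taylor m n (F : C -> 'M[C]_(m, n)) (r : R) (B : R) : 0 < r ->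
  (forall z, cabs z < r -> mjet F z) ->
  (forall z, cabs z < r -> forall i j, cabs (F z i j) <= B) ->
  exists c : nat -> 'M[C]_(m, n), forall z, cabs z < r -> pser_to c z (F z).
Proof.
move=> r0 jF bF.
have /choice [c hc] : forall ij : 'I_m * 'I_n, exists c, forall z, cabs z < r ->
    sersum c z (F z ij.1 ij.2).
  move=> [i j]; apply: (jet_taylor r0 (B := B)) => z zr; first exact: jF.
  exact: bF.
exists (fun k => \matrix_(i, j) c (i, j) k) => z zr; apply/pser_toP => i j.
by apply: eq_sersum (hc (i, j) z zr) => k; rewrite mxE.
Qed.

Lemma finite_min_radius (I : finType) (d : I -> R) : (forall i, 0 < d i) ->
  exists2 r : R, 0 < r & forall i, r <= d i.
Proof.
move=> d0; exists (\big[Num.min/1]_i d i).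
  by elim/big_rec: _ => // i x _ x0; rewrite lt_min d0 x0.
by move=> i; rewrite (bigD1 i) //= ge_min lexx.
Qed.

Lemma mjet_local_bounded m n (F : C -> 'M[C]_(m, n)) a : mjet F a ->
  exists (B r : R), [/\ 0 <= B, 0 < r & forall w, cabs w < r -> forall i j, cabs (F (a + w) i j) <= B].
Proof.
move=> jF; have /choice [Bd hBd] : forall ij : 'I_m * 'I_n, exists Bd : R * R,
    [/\ 0 <= Bd.1, 0 < Bd.2 & forall w, cabs w < Bd.2 -> cabs (F (a + w) ij.1 ij.2) <= Bd.1].
  by move=> [i j]; have [B [d [B0 d0 h]]] := jet_bounded (jF i j); exists (B, d).
have [|r r0 hr] := @finite_min_radius _ (fun ij => (Bd ij).2); first by move=> ij; case: (hBd ij).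
have B0 ij : 0 <= (Bd ij).1 by case: (hBd ij).
exists (\sum_ij (Bd ij).1), r; split=> //; first by apply: sumr_ge0.
move=> w wr i j; case: (hBd (i, j)) => _ _ /(_ w (lt_le_trans wr (hr _))) /= h.
apply: le_trans h _; rewrite (bigD1 (i, j)) //= lerDl; exact: sumr_ge0.
Qed.

Lemma mjet_pser m n (F : C -> 'M[C]_(m, n)) (c : nat -> 'M[C]_(m, n)) (r : R) :
  (forall z, cabs z < r -> pser_to c z (F z)) -> forall z, cabs z < r -> mjet F z.
Proof.
move=> h z zr i j; apply: (jet_sersum (c := fun k => c k i j) zr) => w wr.
by move/pser_toP : (h w wr).
Qed.

Lemma jet_shift (f : C -> C) a b : jet f (a + b) -> jet (fun w => f (a + w)) b.
Proof.
move=> jf; apply: (jet_comp (g := fun w => a + w)) => //.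
by apply: jetD; [exact: jet_cst|exact: jet_id].
Qed.

(** Bridge to the definitions of the statement. Jets are required at all nearby points: at a single
    point a jet is only an asymptotic expansion, which need not converge. *)
Lemma analytic_atP m n (F : C -> 'M[C]_(m, n)) a :
  analytic_at F a <-> exists2 d : R, 0 < d & forall z, cabs (z - a) < d -> mjet F z.
Proof.
split=> [[c [_ [/real_gt0 [r r0 ->] h]]]|[d d0 h]].
  exists r => // z zr; have zE : z = a + (z - a) by rewrite addrC subrK.
  have jG : mjet (fun w => F (a + w)) (z - a).
    apply: (@mjet_pser _ _ _ c r) => // w wr.
    have := h (a + w); rewrite [a + w]addrC addrK ltcabs; exact.
  have jz : jet (fun z => z - a) z by apply: jetB; [exact: jet_id|exact: jet_cst].
  apply: eq_mjet (mjet_comp (F := fun w => F (a + w)) jz jG) => w.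
  by rewrite addrC subrK.
have [|B [r [B0 r0 hB]]] := @mjet_local_bounded _ _ F a.
  by apply: h; rewrite subrr cabs0.
have [|||c hc] := @mjet_taylor _ _ (fun w => F (a + w)) (Num.min d r) B.
- by rewrite lt_min d0 r0.
- move=> w; rewrite lt_min => /andP[wd _] i j; apply: (@jet_shift (fun z => F z i j)).
  by apply: h; rewrite addrC addKr.
- by move=> w; rewrite lt_min => /andP[_ /hB].
exists c, (real_complex R (Num.min d r)); split; first by rewrite ltcR lt_min d0 r0.
by move=> z; rewrite ltcabs => /hc; rewrite [a + _]addrC subrK.
Qed.

Lemma analytic_mjet m n (F : C -> 'M[C]_(m, n)) a : analytic_at F a -> mjet F a.
Proof. by move=> /analytic_atP [d d0]; apply; rewrite subrr cabs0. Qed.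

Lemma analytic_near m n (F : C -> 'M[C]_(m, n)) a : analytic_at F a ->
  exists2 d : R, 0 < d & forall z, cabs (z - a) < d -> analytic_at F z.
Proof.
move=> /analytic_atP [d d0 h]; exists (d / 2); first by lra.
move=> z zd; apply/analytic_atP; exists (d / 2); first by lra.
move=> y yd; apply: h; rewrite (_ : y - a = (y - z) + (z - a)); last by ring.
by have := cabsD (y - z) (z - a); lra.
Qed.

End MatrixJets.

(** * The transfer matrix *)

Section Adjoint.
Variable R : realType.
Local Notation C := (R[i]).

Lemma adjmxE m n (A : 'M[C]_(m, n)) : adjmx A = (map_mx Num.conj A)^T.
Proof. by apply/matrixP => i j; rewrite !mxE. Qed.

Lemma adjmxM m n q (A : 'M[C]_(m, n)) (B : 'M[C]_(n, q)) :
  adjmx (A *m B) = adjmx B *m adjmx A.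
Proof. by rewrite !adjmxE map_mxM trmx_mul. Qed.

Lemma adjmxK m n : cancel (@adjmx R m n) (@adjmx R n m).
Proof. by move=> A; apply/matrixP => i j; rewrite !mxE conjCK. Qed.

Lemma adjmxD m n (A B : 'M[C]_(m, n)) : adjmx (A + B) = adjmx A + adjmx B.
Proof. by apply/matrixP => i j; rewrite !mxE rmorphD. Qed.

Lemma adjmxN m n (A : 'M[C]_(m, n)) : adjmx (- A) = - adjmx A.
Proof. by apply/matrixP => i j; rewrite !mxE rmorphN. Qed.

Lemma adjmxB m n (A B : 'M[C]_(m, n)) : adjmx (A - B) = adjmx A - adjmx B.
Proof. by rewrite adjmxD adjmxN. Qed.

Lemma adjmxZ m n a (A : 'M[C]_(m, n)) : adjmx (a *: A) = a^* *: adjmx A.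
Proof. by apply/matrixP => i j; rewrite !mxE rmorphM. Qed.

Lemma adjmx_scalar n (a : C) : adjmx (a%:M : 'M[C]_n) = (a^*)%:M.
Proof.
by apply/matrixP => i j; rewrite !mxE eq_sym; case: eqP => _; rewrite ?mulr1n // !mulr0n rmorph0.
Qed.

Lemma adjmx1 n : adjmx (1%:M : 'M[C]_n) = 1%:M.
Proof. by rewrite adjmx_scalar rmorph1. Qed.

Lemma adjmx0 m n : adjmx (0 : 'M[C]_(m, n)) = 0.
Proof. by apply/matrixP => i j; rewrite !mxE rmorph0. Qed.

Lemma adjmx_row m n q (A : 'M[C]_(m, n)) (B : 'M[C]_(m, q)) :
  adjmx (row_mx A B) = col_mx (adjmx A) (adjmx B).
Proof. by rewrite !adjmxE map_row_mx tr_row_mx. Qed.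

Lemma adjmx_col m n q (A : 'M[C]_(m, n)) (B : 'M[C]_(q, n)) :
  adjmx (col_mx A B) = row_mx (adjmx A) (adjmx B).
Proof. by rewrite !adjmxE map_col_mx tr_col_mx. Qed.

Lemma adjmx_unit n (A : 'M[C]_n) : (adjmx A \in unitmx) = (A \in unitmx).
Proof. by rewrite adjmxE unitmx_tr map_unitmx. Qed.

Lemma adjmx_inv n (A : 'M[C]_n) : adjmx (invmx A) = invmx (adjmx A).
Proof. by rewrite !adjmxE map_invmx trmx_inv. Qed.

Lemma adjmx_J p : adjmx (@Jmx R p) = Jmx R p.
Proof.
by rewrite /Jmx adjmxE map_block_mx tr_block_mx !map_mx0 !map_mx1 !trmx0 !trmx1.
Qed.

Lemma mulJ_col p q (X Y : 'M[C]_(p, q)) : Jmx R p *m col_mx X Y = col_mx Y X.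
Proof. by rewrite /Jmx mul_block_col !mul0mx !mul1mx add0r addr0. Qed.

Lemma mul_rowJ p q (X Y : 'M[C]_(q, p)) : row_mx X Y *m Jmx R p = row_mx Y X.
Proof. by rewrite /Jmx mul_row_block !mulmx0 !mulmx1 add0r addr0. Qed.

Lemma pdmx_unit n (A : 'M[C]_n) : pdmx A -> A \in unitmx.
Proof.
move=> pA; rewrite -unitmx_tr -row_free_unit -kermx_eq0; apply/negPn/negP => /rowV0Pn [v].
rewrite sub_kermx => /eqP vA v0; have := pA v^T; rewrite trmx_eq0 => /(_ v0).
by rewrite -mulmxA -[A]trmxK -trmx_mul vA trmx0 mulmx0 mxE ltxx.
Qed.

End Adjoint.

(** * Algebra of the displacement identity *)

Section MatrixIdentities.
Variable F : fieldType.
Variables (n p : nat) (S L U : 'M[F]_n) (Pi G : 'M[F]_(n, p)) (Gs : 'M[F]_(p, n)) (J : 'M[F]_p).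
Hypothesis hD : S - L *m S *m U = G *m J *m Gs.

Lemma mxD_entry m q (A B : 'M[F]_(m, q)) i j : (A + B) i j = A i j + B i j.
Proof. by rewrite mxE. Qed.
Lemma mxN_entry m q (A : 'M[F]_(m, q)) i j : (- A) i j = - A i j.
Proof. by rewrite mxE. Qed.
Lemma mxZ_entry m q a (A : 'M[F]_(m, q)) i j : (a *: A) i j = a * A i j.
Proof. by rewrite mxE. Qed.

Ltac mx_expand :=
  repeat progress rewrite ?(mulmxBl, mulmxBr, mulmxDl, mulmxDr, mulmxN, mulNmx,
    mulmx1, mul1mx, mulmxA) -?scalemxAl -?scalemxAr.
(** Noncommutative identities: once [mx_expand] has left-associated all products, each remaining
    product can become a fresh matrix, and the identity left over is linear and holds entrywise. *)
Ltac mx_ring :=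
  repeat match goal with |- context [@mulmx ?R ?a ?b ?c ?A ?B] =>
    let X := fresh "X" in move: (A *m B) => X end;
  apply/matrixP => ? ?; rewrite !(mxD_entry, mxN_entry, mxZ_entry); ring.

Lemma comm_pencil m (z : F) (V : 'M[F]_m) :
  (1%:M - z *: V) *m (1%:M - V) = (1%:M - V) *m (1%:M - z *: V).
Proof. by mx_expand; mx_ring. Qed.

Lemma half_diff m q (k : F) (X Y : 'M[F]_(m, q)) : k * k * 2 = 1 ->
  k *: (k *: (X + Y) - k *: (Y - X)) = X.
Proof.
move=> kk; rewrite -[RHS]scale1r -kk.
by apply/matrixP => ? ?; rewrite !(mxD_entry, mxN_entry, mxZ_entry); ring.
Qed.

Lemma half_sum m q (k : F) (X Y : 'M[F]_(m, q)) : k * k * 2 = 1 ->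
  k *: (k *: (X + Y) + k *: (Y - X)) = Y.
Proof.
move=> kk; rewrite -[RHS]scale1r -kk.
by apply/matrixP => ? ?; rewrite !(mxD_entry, mxN_entry, mxZ_entry); ring.
Qed.

(** This is K^* J K = diag(I, -I), with [k] the constant 1/sqrt 2 of K. *)
Lemma half_form m q r (k : F) (A B : 'M[F]_(m, q)) (As Bs : 'M[F]_(r, m)) : k * k * 2 = 1 ->
  (k *: (As - Bs)) *m (k *: (A + B)) + (k *: (As + Bs)) *m (k *: (A - B)) = As *m A - Bs *m B.
Proof. by move=> kk; rewrite -[RHS]scale1r -kk; mx_expand; mx_ring. Qed.

Lemma polar_form m q r (A B : 'M[F]_(m, q)) (As Bs : 'M[F]_(r, m)) :
  (As - Bs) *m (A - B) - (As + Bs) *m (A + B) = - 2 *: (As *m B + Bs *m A).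
Proof. by mx_expand; mx_ring. Qed.

(** [hs], [ts], [Gs] and [zb] stand for adjoints and the conjugate, and [U] for the adjoint of [L];
    as independent letters they make this an identity over any field. The coefficient 1 - z zb
    appears when G J Gs is replaced by S - L S U. *)
Lemma transfer_form q r (z zb : F) (h : 'M[F]_(p, q)) (hs : 'M[F]_(r, p)) (t : 'M[F]_(n, q)) (ts : 'M[F]_(r, n)) :
  hs *m J *m Gs = ts *m (1%:M - zb *: L) *m S *m (1%:M - U) ->
  G *m J *m h = (1%:M - L) *m S *m (1%:M - z *: U) *m t ->
  (hs - (1 - zb) *: (ts *m G)) *m J *m (h - (1 - z) *: (Gs *m t)) =
  hs *m J *m h - (1 - z * zb) *: (ts *m (1%:M - L) *m S *m (1%:M - U) *m t).
Proof.
move=> hsG Gh.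
have -> : (hs - (1 - zb) *: (ts *m G)) *m J *m (h - (1 - z) *: (Gs *m t)) =
   hs *m J *m h - (1 - z) *: (hs *m J *m Gs *m t) - (1 - zb) *: (ts *m (G *m J *m h))
   + ((1 - z) * (1 - zb)) *: (ts *m (G *m J *m Gs) *m t).
  by mx_expand; mx_ring.
rewrite hsG Gh -hD; mx_expand; mx_ring.
Qed.

Hypothesis JJ : J *m J = 1%:M.
Hypothesis hG : (1%:M - L) *m Pi = G.

(* [a] plays the role of (alpha(z), 1) with alpha(z) the Taylor polynomial, and
   [W] of the row (1, z, ..., z^N). *)
Lemma transfer_interp q m (z c : F) (W eN : 'M[F]_(m, n)) (a : 'M[F]_(m, p)) (h : 'M[F]_(p, q)) (t : 'M[F]_(n, q)) :
  S *m (1%:M - z *: U) *m t = Pi *m J *m h ->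
  W *m G = a *m J -> z *: W - W *m L = c *: eN ->
  a *m (h - (1 - z) *: (Gs *m t)) =
  c *: (eN *m Pi *m J *m h - (1 - z) *: (eN *m S *m U *m t)).
Proof.
move=> ht WG WL.
have aG : a *m Gs = W *m (S - L *m S *m U).
  by rewrite hD !mulmxA WG -[a *m J *m J]mulmxA JJ mulmx1.
have e1 : a *m Gs *m t = W *m Pi *m J *m h + c *: (eN *m S *m U *m t).
  have -> : W *m Pi *m J *m h = W *m (S *m (1%:M - z *: U) *m t) by rewrite ht !mulmxA.
  by rewrite aG !scalemxAl -WL; mx_expand; mx_ring.
have e2 : a *m h = (1 - z) *: (W *m Pi *m J *m h) + c *: (eN *m Pi *m J *m h).
  have -> : a *m h = W *m G *m J *m h by rewrite WG -[a *m J *m J]mulmxA JJ mulmx1.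
  by rewrite -hG !scalemxAl -WL; mx_expand; mx_ring.
by rewrite mulmxBr -scalemxAr mulmxA e1 e2; mx_ring.
Qed.

Hypothesis uS : S \in unitmx.
Hypothesis uL : 1%:M - L \in unitmx.
Hypothesis uU : 1%:M - U \in unitmx.

(** Inverts the transfer matrix without computing an inverse: [t] is built from [r] alone, and the
    equation shows that it is the state of g + (1 - z) Gs t, a vector which the transfer matrix then
    maps to [g]. *)
Lemma transfer_inverse (z : F) q (g : 'M[F]_(p, q)) (r : 'M[F]_(n, q)) :
  (z *: 1%:M - L) *m r = G *m J *m g ->
  let t := invmx (1%:M - U) *m invmx S *m r in
  S *m (1%:M - z *: U) *m t = Pi *m J *m (g + (1 - z) *: (Gs *m t)).
Proof.
move=> hr t.
have rE : r = S *m (1%:M - U) *m t by rewrite /t !mulmxA mulmxK // mulmxV // mul1mx.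
apply: (can_inj (mulKmx uL)); rewrite [in RHS]mulmxA [in RHS]mulmxA hG [in RHS]mulmxDr -hr.
rewrite -scalemxAr (_ : G *m J *m (Gs *m t) = (S - L *m S *m U) *m t); last by rewrite hD !mulmxA.
by rewrite rE; mx_expand; mx_ring.
Qed.

End MatrixIdentities.

(** * Block shifts and block Toeplitz matrices *)

Section BlockShift.
Variable F : fieldType.
Variables p N : nat.
Local Notation n := (\sum_(k < N.+1) p)%N.
Local Notation delta b := (if b then 1%:M else 0 : 'M[F]_p).

Definition bmx (B : nat -> nat -> 'M[F]_p) : 'M[F]_n := \mxblock_(k < N.+1, j < N.+1) B k j.
Definition bcol q (X : nat -> 'M[F]_(p, q)) : 'M[F]_(n, q) := \mxcol_(k < N.+1) X k.
Definition brow q (X : nat -> 'M[F]_(q, p)) : 'M[F]_(q, n) := \mxrow_(k < N.+1) X k.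
Definition Lmx : 'M[F]_n := bmx (fun k j => delta (k == j.+1)).
Definition Umx : 'M[F]_n := bmx (fun k j => delta (j == k.+1)).

Lemma sum_deltal q (X : nat -> 'M[F]_(p, q)) m k :
  \sum_(j < m) delta (k == j :> nat) *m X j = if (k < m)%N then X k else 0.
Proof.
case: ltnP => km.
  rewrite (bigD1 (Ordinal km)) //= eqxx mul1mx big1 ?addr0 // => j jk.
  by rewrite ifN ?mul0mx // eq_sym; apply: contra jk => /eqP jk; apply/eqP/val_inj.
by rewrite big1 // => j _; rewrite ifN ?mul0mx // neq_ltn (leq_trans _ km) ?orbT.
Qed.

Lemma sum_deltar q (X : nat -> 'M[F]_(q, p)) m k :
  \sum_(j < m) X j *m delta (k == j :> nat) = if (k < m)%N then X k else 0.
Proof.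
case: ltnP => km.
  rewrite (bigD1 (Ordinal km)) //= eqxx mulmx1 big1 ?addr0 // => j jk.
  by rewrite ifN ?mulmx0 // eq_sym; apply: contra jk => /eqP jk; apply/eqP/val_inj.
by rewrite big1 // => j _; rewrite ifN ?mulmx0 // neq_ltn (leq_trans _ km) ?orbT.
Qed.

Lemma sum_shiftl q (X : nat -> 'M[F]_(p, q)) (k : 'I_N.+1) :
  \sum_(j < N.+1) delta (k == j.+1 :> nat) *m X j = if k : nat is k'.+1 then X k' else 0.
Proof.
case: k => -[|k] kN /=; first by rewrite big1 // => j _; rewrite mul0mx.
by under eq_bigr do rewrite eqSS; rewrite sum_deltal ltnW.
Qed.

Lemma sum_shiftr q (X : nat -> 'M[F]_(q, p)) (k : 'I_N.+1) :
  \sum_(j < N.+1) X j *m delta (k == j.+1 :> nat) = if k : nat is k'.+1 then X k' else 0.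
Proof.
case: k => -[|k] kN /=; first by rewrite big1 // => j _; rewrite mulmx0.
by under eq_bigr do rewrite eqSS; rewrite sum_deltar ltnW.
Qed.

Lemma bcol_surj q (x : 'M[F]_(n, q)) : exists X, x = bcol X.
Proof.
exists (fun k => submxcol x (inord k)); rewrite -{1}[x]submxcolK.
by apply: eq_mxcol => i; rewrite inord_val.
Qed.

Lemma bmx1 : bmx (fun k j => delta (k == j)) = 1%:M.
Proof.
rewrite -[LHS]mulmx1; have [X ->] := bcol_surj (1%:M : 'M[F]_n).
rewrite mul_mxblock_mxrow; apply: eq_mxcol => i.
by rewrite (sum_deltal X) ltn_ord.
Qed.

Lemma Lmx_bcol q (X : nat -> 'M[F]_(p, q)) :
  Lmx *m bcol X = bcol (fun k => if k is k'.+1 then X k' else 0).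
Proof. by rewrite mul_mxblock_mxrow; apply: eq_mxcol => i; exact: sum_shiftl. Qed.

Lemma Lmx_bmx B : Lmx *m bmx B = bmx (fun k j => if k is k'.+1 then B k' j else 0).
Proof. by rewrite mul_mxblock; apply: eq_mxblock => i j; exact: (sum_shiftl (B^~ j)). Qed.

Lemma bmx_Umx B : bmx B *m Umx = bmx (fun k j => if j is j'.+1 then B k j' else 0).
Proof. by rewrite mul_mxblock; apply: eq_mxblock => i j; exact: (sum_shiftr (B i)). Qed.

Lemma bmx_Lmx B :
  bmx B *m Lmx = bmx (fun k j => if (j < N)%N then B k j.+1 else 0).
Proof.
rewrite mul_mxblock; apply: eq_mxblock => i j; rewrite -[(j < N)%N]ltnS -(sum_deltar (B i)).
by apply: eq_bigr => k _; rewrite eq_sym.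
Qed.

Lemma brow_Lmx q (X : nat -> 'M[F]_(q, p)) :
  brow X *m Lmx = brow (fun j => if (j < N)%N then X j.+1 else 0).
Proof.
rewrite mul_mxrow_mxblock; apply: eq_mxrow => j; rewrite -[(j < N)%N]ltnS -(sum_deltar X).
by apply: eq_bigr => k _; rewrite eq_sym.
Qed.

Lemma unitmx_inj m (A : 'M[F]_m) : (forall x : 'cV_m, A *m x = 0 -> x = 0) -> A \in unitmx.
Proof.
move=> hA; rewrite -unitmx_tr -row_free_unit -kermx_eq0; apply/negPn/negP => /rowV0Pn [v].
rewrite sub_kermx => /eqP vA /eqP; apply; apply: trmx_inj; rewrite trmx0; apply: hA.
by rewrite -[A]trmxK -trmx_mul vA trmx0.
Qed.

Lemma bcol_inj q (X Y : nat -> 'M[F]_(p, q)) : bcol X = bcol Y -> forall k, (k < N.+1)%N -> X k = Y k.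
Proof. by rewrite /bcol => /eq_mxcolP h k kN; exact: (h (Ordinal kN)). Qed.

Lemma bcolZ q z (X : nat -> 'M[F]_(p, q)) : z *: bcol X = bcol (fun k => z *: X k).
Proof. by apply/matrixP => i j; rewrite !mxE. Qed.

Lemma bmxZ z B : z *: bmx B = bmx (fun k j => z *: B k j).
Proof. by apply/matrixP => i j; rewrite !mxE. Qed.

Lemma browZ q z (X : nat -> 'M[F]_(q, p)) : z *: brow X = brow (fun k => z *: X k).
Proof. by apply/matrixP => i j; rewrite !mxE. Qed.

Lemma bcolB q (X Y : nat -> 'M[F]_(p, q)) : bcol X - bcol Y = bcol (fun k => X k - Y k).
Proof. by apply/matrixP => i j; rewrite !mxE. Qed.

Lemma browB q (X Y : nat -> 'M[F]_(q, p)) : brow X - brow Y = brow (fun k => X k - Y k).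
Proof. by apply/matrixP => i j; rewrite !mxE. Qed.

Lemma bmxB B B' : bmx B - bmx B' = bmx (fun k j => B k j - B' k j).
Proof. by apply/matrixP => i j; rewrite !mxE. Qed.

Lemma bmxD B B' : bmx B + bmx B' = bmx (fun k j => B k j + B' k j).
Proof. by apply/matrixP => i j; rewrite !mxE. Qed.

Lemma Lmx_unit z : 1%:M - z *: Lmx \in unitmx.
Proof.
apply: unitmx_inj => x; have [X ->] := bcol_surj x.
rewrite mulmxBl mul1mx -scalemxAl Lmx_bcol bcolZ => /eqP; rewrite subr_eq0 => /eqP /bcol_inj h.
have X0 k : (k < N.+1)%N -> X k = 0.
  elim: k => [|k IH] kN; rewrite h //= ?scaler0 //.
  by rewrite IH ?scaler0 // ltnW.
by apply/matrixP => i j; rewrite !mxE X0 ?ltn_ord // mxE.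
Qed.

Lemma Lmx_unit1 : 1%:M - Lmx \in unitmx.
Proof. by have := Lmx_unit 1; rewrite scale1r. Qed.

Variables (a b : nat -> 'M[F]_p).
Definition Ecol := bcol (fun k => delta (k == 0%N)).
Definition Erow := brow (fun k => delta (k == 0%N)).
Definition Tmx := bmx (fun k j => if (j < k)%N then a (k - j) else
  if (k < j)%N then b (j - k) else a 0%N + b 0%N).

(** Constancy along the diagonals lets the shifted copy cancel everything outside the first block
    row and column; the corner splits as a_0 + b_0 between the two products. *)
Lemma Tmx_displacement :
  Tmx - Lmx *m Tmx *m Umx = Ecol *m brow b + bcol a *m Erow.
Proof.
rewrite Lmx_bmx bmx_Umx bmxB !mul_mxcol_mxrow -mxblockD; apply: eq_mxblock => -[i iN] [j jN] /=.
case: i j iN jN => [|i] [|j] _ _ /=.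
- by rewrite subr0 mul1mx mulmx1 addrC.
- by rewrite subr0 mul1mx mulmx0 addr0.
- by rewrite subr0 mul0mx mulmx1 add0r.
- by rewrite !subSS !ltnS subrr mul0mx mulmx0 addr0.
Qed.

Lemma Phi1_shift : (1%:M - Lmx) *m bcol (fun=> 1%:M) = Ecol.
Proof.
rewrite mulmxBl mul1mx Lmx_bcol bcolB; apply: eq_mxcol => -[[|i] iN] /=.
  by rewrite subr0.
by rewrite subrr.
Qed.

Lemma Phi2_shift : (1%:M - Lmx) *m bcol (fun k => \sum_(l < k.+1) a l) = bcol a.
Proof.
rewrite mulmxBl mul1mx Lmx_bcol bcolB; apply: eq_mxcol => -[[|i] iN] /=.
  by rewrite subr0 big_ord1.
by rewrite big_ord_recr /= addrAC subrr add0r.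
Qed.

(** The matrix on the left is c (1 + L) (1 - L)^-1, a Cayley transform of the nilpotent shift; for c
    = i/2 it is [Amx]. *)
Lemma Amx_shift (c : F) :
  bmx (fun k j => if (j < k)%N then (c + c)%:M else if j == k then c%:M else 0) *m (1%:M - Lmx)
  = c *: (1%:M + Lmx).
Proof.
rewrite mulmxBr mulmx1 bmx_Lmx -{1}bmx1 bmxD bmxB bmxZ; apply: eq_mxblock => -[i iN] [j jN] /=.
have hc b1 b2 : c *: ((delta b1) + (delta b2)) = (if b1 then c%:M else 0) + (if b2 then c%:M else 0).
  by rewrite scalerDr; case: b1 b2 => -[]; rewrite ?scaler0 ?scalemx1.
rewrite hc; case: (ltngtP j i) => [ji|ij|<-].
- have -> : (j < N)%N = true by lia.
  have e : (i == j) = false by lia.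
  rewrite ?e ?add0r; case: (ltngtP j.+1 i) => [ji'|ij|e']; last by rewrite raddfD addrK.
    by rewrite subrr.
  by lia.
- have e1 : (j.+1 < i)%N = false by lia.
  have e2 : (j.+1 == i) = false by lia.
  have e3 : (i == j) = false by lia.
  have e4 : (i == j.+1) = false by lia.
  by rewrite ?e1 ?e2 ?e3 ?e4 if_same addr0 subrr.
- have e1 : (j.+1 < j)%N = false by lia.
  have e2 : (j.+1 == j) = false by lia.
  have e3 : (j == j.+1) = false by lia.
  by rewrite ?eqxx ?e1 ?e2 ?e3 if_same subr0 addr0.
Qed.

Definition Wrow z : 'M[F]_(p, n) := brow (fun k => (z ^+ k)%:M).

Lemma Wrow_Ecol z : Wrow z *m Ecol = 1%:M.
Proof.
rewrite mul_mxrow_mxcol big_ord_recl /= mulmx1 big1 ?addr0 // => i _.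
by rewrite mulmx0.
Qed.

Lemma Wrow_bcol z q (X : nat -> 'M[F]_(p, q)) : Wrow z *m bcol X = \sum_(k < N.+1) z ^+ k *: X k.
Proof. by rewrite mul_mxrow_mxcol; apply: eq_bigr => k _; rewrite mul_scalar_mx. Qed.

(** Only the last block survives, which is where the interpolation order N + 1 comes from. *)
Lemma Wrow_shift z : z *: Wrow z - Wrow z *m Lmx = z ^+ N.+1 *: brow (fun k => delta (k == N)).
Proof.
rewrite brow_Lmx !browZ browB; apply: eq_mxrow => -[k kN] /=.
rewrite scale_scalar_mx -exprS; move: kN; rewrite ltnS leq_eqVlt => /orP[/eqP ->|kN].
  by rewrite ltnn eqxx subr0 scalemx1.
by rewrite kN subrr ltn_eqF // scaler0.
Qed.

End BlockShift.

(** * The transfer matrix in the disc variable *)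

Section Transfer.
Variable R : realType.
Local Notation C := (R[i]).
Variables (p N : nat) (sm : nat -> 'M[C]_p) (a0 : 'M[C]_p).
Hypothesis ha0 : a0 + adjmx a0 = sm 0%N.
Hypothesis hS : pdmx (toeplitz N sm).
Local Notation n := (\sum_(k < N.+1) p)%N.
Local Notation a := (alph sm a0).
Local Notation S := (toeplitz N sm).
Local Notation L := (@Lmx C p N).
Local Notation U := (@Umx C p N).
Local Notation Pi := (Pimx N sm a0).
Local Notation J := (Jmx R p).

Definition Gmx : 'M[C]_(n, p + p) := row_mx (Ecol C p N) (bcol N a).
Local Notation G := Gmx.

Lemma adjmx_bmx (B : nat -> nat -> 'M[C]_p) : 
  adjmx (bmx N B) = bmx N (fun k j => adjmx (B j k)).
Proof. by apply/matrixP => i j; rewrite !mxE. Qed.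

Lemma adjmx_bcol q (X : nat -> 'M[C]_(p, q)) : adjmx (bcol N X) = brow N (fun k => adjmx (X k)).
Proof. by apply/matrixP => i j; rewrite !mxE. Qed.

Lemma adjmx_delta (b : bool) : adjmx (if b then 1%:M else 0 : 'M[C]_p) = if b then 1%:M else 0.
Proof. by case: b; rewrite ?adjmx1 ?adjmx0. Qed.

Lemma adjmx_L : adjmx L = U.
Proof. by rewrite adjmx_bmx; apply: eq_mxblock => i j; exact: adjmx_delta. Qed.

Lemma toeplitzE : S = Tmx N a (fun k => adjmx (a k)).
Proof.
apply: eq_mxblock => i j; rewrite /toep_blk /alph.
case: (ltngtP j i) => [ji|ij|->]; last by rewrite subnn /= ha0.
  by rewrite subn_eq0 leqNgt ji.
by rewrite subn_eq0 leqNgt ij.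
Qed.

Lemma adjmx_S : adjmx S = S.
Proof.
rewrite toeplitzE adjmx_bmx; apply: eq_mxblock => i j.
case: ltngtP => ij //; first by rewrite adjmxK.
by rewrite adjmxD adjmxK addrC.
Qed.

Lemma S_unit : S \in unitmx. Proof. exact: pdmx_unit. Qed.

Lemma adjmx_G : adjmx G = col_mx (Erow C p N) (brow N (fun k => adjmx (a k))).
Proof.
rewrite adjmx_row !adjmx_bcol; congr (col_mx _ _).
by apply: eq_mxrow => i; exact: adjmx_delta.
Qed.

Lemma Pi_shift : (1%:M - L) *m Pi = G.
Proof. by rewrite /Pimx mul_mx_row Phi1_shift Phi2_shift. Qed.

Lemma S_displacement : S - L *m S *m U = G *m J *m adjmx G.
Proof. by rewrite adjmx_G mul_rowJ mul_row_col toeplitzE Tmx_displacement addrC. Qed.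

Lemma U_unit z : 1%:M - z *: U \in unitmx.
Proof.
rewrite -(adjmx_unit (1%:M - z *: U)) adjmxB adjmxZ -adjmx_L adjmxK adjmx1.
exact: Lmx_unit.
Qed.

Lemma U_unit1 : 1%:M - U \in unitmx.
Proof. by have := U_unit 1; rewrite scale1r. Qed.

Lemma J_sqr : J *m J = 1%:M.
Proof. by rewrite /Jmx mulmx_block !mul0mx !mulmx0 !mul1mx !add0r !addr0 -scalar_mx_block. Qed.

(** The adjoint of w_A(N, -conj(l)/2) written in z. As [U] is nilpotent, 1 - z U is invertible for
    every z and there are no poles. *)
Definition What z : 'M[C]_(p + p) :=
  1%:M - (1 - z) *: (adjmx G *m invmx (1%:M - z *: U) *m invmx S *m Pi *m J).

(** The state of the linear system whose output is What z h; identities on [What] reduce to the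
    linear equation [tstateP]. *)
Definition tstate z q (h : 'M[C]_(p + p, q)) : 'M[C]_(n, q) :=
  invmx (1%:M - z *: U) *m invmx S *m Pi *m J *m h.

Lemma tstateP z q (h : 'M[C]_(p + p, q)) : S *m (1%:M - z *: U) *m tstate z h = Pi *m J *m h.
Proof. by rewrite /tstate -!mulmxA (mulKVmx (U_unit z)) (mulKVmx S_unit). Qed.

Lemma tstate_uniq z q (h : 'M[C]_(p + p, q)) t :
  S *m (1%:M - z *: U) *m t = Pi *m J *m h -> t = tstate z h.
Proof.
move=> ht; rewrite /tstate -!mulmxA [Pi *m (J *m h)]mulmxA -ht !mulmxA
  mulmxKV ?S_unit // mulVmx ?mul1mx ?U_unit //.
Qed.

Lemma What_mul z q (h : 'M[C]_(p + p, q)) : What z *m h = h - (1 - z) *: (adjmx G *m tstate z h).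
Proof. by rewrite /What mulmxBl mul1mx -scalemxAl /tstate !mulmxA. Qed.

Lemma adjA_shift : (1%:M - U) *m adjmx (Amx R p N) = (- ('i / 2)) *: (1%:M + U).
Proof.
have <- : ('i / 2 : C)^* = - ('i / 2).
  by rewrite rmorphM /= conjCi fmorphV rmorph_nat mulNr.
rewrite -adjmx_L -{1}(adjmx1 R n) -adjmxB -adjmxM -[X in _ *: (X + _)](adjmx1 R n) -adjmxD -adjmxZ.
rewrite -Amx_shift; congr (adjmx (_ *m _)); apply: eq_mxblock => i j.
by rewrite -splitr.
Qed.

Lemma invmx_right m (A B : 'M[C]_m) : A *m B = 1%:M -> invmx A = B.
Proof.
move=> AB; have [uA _] := mulmx1_unit AB.
by rewrite -[invmx A]mulmx1 -AB mulmxA mulVmx // mul1mx.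
Qed.

(** By [adjA_shift] the adjoint of A is -(i/2) (1 - U)^-1 (1 + U); for this l, adding l/2 makes it
    -i/(1 - z) times (1 - U)^-1 (1 - z U). *)
Lemma resolventE z : z != 1 -> let l := 'i * (z + 1) / (z - 1) : C in
  invmx (adjmx (Amx R p N) + (l / 2)%:M) =
  ('i * (1 - z)) *: (invmx (1%:M - z *: U) *m (1%:M - U)).
Proof.
move=> z1 l; apply: invmx_right.
have z1' : 1 - z != 0 by rewrite subr_eq0 eq_sym.
have z1'' : z - 1 != 0 by rewrite subr_eq0.
have ii : 'i * 'i = -1 :> C by rewrite -expr2 sqrCi.
have i0 : ('i : C) != 0 by rewrite neq0Ci.
set X := _ + _%:M.
have hX : (1%:M - U) *m X = (- 'i / (1 - z)) *: (1%:M - z *: U).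
  rewrite /X mulmxDr adjA_shift mul_mx_scalar /l.
  apply/matrixP => i j; rewrite !mxE; move: (U i j) => u; move: ((i == j)%:R : C) => d.
  by field; rewrite z1' z1''.
have -> : X = invmx (1%:M - U) *m ((- 'i / (1 - z)) *: (1%:M - z *: U)).
  by rewrite -hX mulKmx // U_unit1.
rewrite -!scalemxAr -scalemxAl scalerA.
have -> : 'i * (1 - z) * (- 'i / (1 - z)) = 1.
  rewrite [LHS](_ : _ = - ('i * 'i) * ((1 - z) / (1 - z))); last by ring.
  by rewrite ii opprK mul1r divff.
rewrite scale1r mulmxA -[_ *m (1%:M - z *: U) *m _]mulmxA mulmxV ?U_unit //.
by rewrite mulmx1 mulVmx ?U_unit1.
Qed.

Lemma WmxE z : z != 1 -> let l := 'i * (z + 1) / (z - 1) : C in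
  Wmx N sm a0 l = ((l - 'i) / l) ^+ N.+1 *: (What z *m Kmx R p).
Proof.
move=> z1 l; congr (_ *: (_ *m _)); rewrite /wA adjmxB adjmx1 adjmxZ conjCi /What scaleNr.
rewrite !adjmxM !adjmx_inv adjmx_S adjmx_J adjmxK adjmxB adjmx_scalar.
have -> : (- l^* / 2)^* = - (l / 2).
  by rewrite rmorphM rmorphN /= conjCK fmorphV rmorph_nat mulNr.
have eN (X : 'M[C]_n) : X - (- (l / 2))%:M = X + (l / 2)%:M by rewrite [(- _)%:M]raddfN opprK.
rewrite eN (resolventE z1).
have -> : adjmx Pi *m (('i * (1 - z) *: (invmx (1%:M - z *: U) *m (1%:M - U))) *m (invmx S *m (Pi *m J)))
  = ('i * (1 - z)) *: (adjmx G *m invmx (1%:M - z *: U) *m invmx S *m Pi *m J).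
  have -> : adjmx G = adjmx Pi *m (1%:M - U).
    by rewrite -Pi_shift adjmxM adjmxB adjmx1 adjmx_L.
  have cU : (1%:M - U) *m invmx (1%:M - z *: U) = invmx (1%:M - z *: U) *m (1%:M - U).
    apply: (can_inj (mulKmx (U_unit z))).
    by rewrite mulmxA comm_pencil -mulmxA mulmxV ?U_unit // mulmx1 mulmxA mulmxV ?mul1mx ?U_unit.
  rewrite -[adjmx Pi *m (1%:M - U) *m invmx _]mulmxA cU -scalemxAl -scalemxAr.
  by rewrite !mulmxA.
rewrite opprK scalerA mulrA.
have -> : 'i * 'i = -1 :> C by rewrite -expr2 sqrCi.
by rewrite mulN1r scaleNr.
Qed.

End Transfer.

(** * Pointwise inequalities for the transfer matrix *)

Section Pointwise.
Variable R : realType.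
Local Notation C := (R[i]).

Section Forms.
Variable p : nat.
Local Notation J := (Jmx R p).
Local Notation kap := ((sqrtC (2 : C))^-1).

Lemma kap_conj : kap^* = kap.
Proof. by rewrite fmorphV; congr (_^-1); apply/CrealP; rewrite ger0_real // sqrtC_ge0. Qed.

Lemma kap_sqr : kap * kap = 2^-1.
Proof. by rewrite -invfM -expr2 sqrtCK. Qed.

Lemma Kmx_col q (A B : 'M[C]_(p, q)) :
  Kmx R p *m col_mx A B = col_mx (kap *: (A - B)) (kap *: (A + B)).
Proof.
by rewrite /Kmx -scalemxAl mul_block_col !mul1mx mulNmx mul1mx scale_col_mx.
Qed.

Lemma Kmx_inv q (X Y : 'M[C]_(p, q)) :
  Kmx R p *m col_mx (kap *: (X + Y)) (kap *: (Y - X)) = col_mx X Y.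
Proof.
by rewrite Kmx_col half_diff ?half_sum // kap_sqr mulVf // pnatr_eq0.
Qed.

Lemma J_form q (X Y : 'M[C]_(p, q)) :
  adjmx (col_mx X Y) *m J *m col_mx X Y = adjmx X *m Y + adjmx Y *m X.
Proof. by rewrite adjmx_col mul_rowJ mul_row_col addrC. Qed.

Lemma K_form q (A B : 'M[C]_(p, q)) :
  let h := Kmx R p *m col_mx A B in
  adjmx h *m J *m h = adjmx A *m A - adjmx B *m B.
Proof.
rewrite /= Kmx_col J_form !adjmxZ kap_conj adjmxB adjmxD half_form //.
by rewrite kap_sqr mulVf // pnatr_eq0.
Qed.

End Forms.

Definition vform n (A : 'M[C]_n) (x : 'cV[C]_n) : C := (adjmx x *m A *m x) 0 0.

Lemma vformD n (A B : 'M[C]_n) x : vform (A + B) x = vform A x + vform B x.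
Proof. by rewrite /vform mulmxDr mulmxDl mxE. Qed.
Lemma vformN n (A : 'M[C]_n) x : vform (- A) x = - vform A x.
Proof. by rewrite /vform mulmxN mulNmx mxE. Qed.
Lemma vformB n (A B : 'M[C]_n) x : vform (A - B) x = vform A x - vform B x.
Proof. by rewrite vformD vformN. Qed.
Lemma vformZ n c (A : 'M[C]_n) x : vform (c *: A) x = c * vform A x.
Proof. by rewrite /vform -scalemxAr -scalemxAl mxE. Qed.
Lemma vform_congr m n (A : 'M[C]_m) (B : 'M[C]_(m, n)) x :
  vform (adjmx B *m A *m B) x = vform A (B *m x).
Proof. by rewrite /vform adjmxM !mulmxA. Qed.

Lemma vform_gram m n (B : 'M[C]_(m, n)) x : vform (adjmx B *m B) x = vform 1%:M (B *m x).
Proof. by rewrite -[adjmx B]mulmx1 vform_congr. Qed.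

Lemma sqn_ge0 n (x : 'cV[C]_n) : 0 <= vform 1%:M x.
Proof.
rewrite /vform mulmx1 mxE; apply: sumr_ge0 => i _; rewrite mxE mulrC; exact: mul_conjC_ge0.
Qed.

Lemma sqn_eq0 n (x : 'cV[C]_n) : vform 1%:M x = 0 -> x = 0.
Proof.
rewrite /vform mulmx1 mxE => /eqP; rewrite psumr_eq0 => [/allP h|i _]; last first.
  by rewrite mxE mulrC; exact: mul_conjC_ge0.
apply/matrixP => i j; rewrite ord1 mxE; have := h i (mem_index_enum _).
by rewrite /= mxE mulrC mul_conjC_eq0 => /eqP.
Qed.

Variables (p N : nat) (sm : nat -> 'M[C]_p) (a0 : 'M[C]_p).
Hypothesis ha0 : a0 + adjmx a0 = sm 0%N.
Hypothesis hS : pdmx (toeplitz N sm).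
Local Notation a := (alph sm a0).
Local Notation S := (toeplitz N sm).
Local Notation L := (@Lmx C p N).
Local Notation U := (@Umx C p N).
Local Notation Pi := (Pimx N sm a0).
Local Notation J := (Jmx R p).
Local Notation G := (Gmx N sm a0).

Lemma What_form z q (h : 'M[C]_(p + p, q)) :
  let t := tstate N sm a0 z h in let g := What N sm a0 z *m h in
  adjmx g *m J *m g =
  adjmx h *m J *m h - (1 - z * z^*) *: (adjmx t *m (1%:M - L) *m S *m (1%:M - U) *m t).
Proof.
move=> t g; have ht := tstateP a0 hS z h; rewrite -/t in ht.
rewrite /g What_mul -/t; clearbody t; rewrite adjmxB adjmxZ adjmxM adjmxK rmorphB rmorph1.
apply: transfer_form.
- exact: S_displacement.
- have := congr1 (@adjmx R _ _) ht; rewrite !adjmxM adjmx_J (adjmx_S _ ha0) adjmxB adjmx1 adjmxZ -adjmx_L adjmxK.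
  rewrite -Pi_shift adjmxM adjmxB adjmx1 !mulmxA => ->.
  by [].
- by rewrite -Pi_shift -!mulmxA; congr (_ *m _); rewrite !mulmxA ht.
Qed.

Section Dissipative.
Variables (z : C) (A B : 'M[C]_p).
Hypothesis z1 : 0 < 1 - z * z^*.
Hypothesis AB : psdmx (adjmx B *m B - adjmx A *m A).
Hypothesis AB0 : pdmx (adjmx A *m A + adjmx B *m B).
Let h := Kmx R p *m col_mx A B.
Let X := usubmx (What N sm a0 z *m h).
Let Y := dsubmx (What N sm a0 z *m h).

Let hXY : What N sm a0 z *m h = col_mx X Y. Proof. by rewrite vsubmxK. Qed.

Let dissip v : exists2 s : 'cV[C]_(\sum_(k < N.+1) p),
  s = (1%:M - U) *m (tstate N sm a0 z h *m v) &
  vform (adjmx X *m Y + adjmx Y *m X) v =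
  - vform (adjmx B *m B - adjmx A *m A) v - (1 - z * z^*) * vform S s.
Proof.
exists ((1%:M - U) *m (tstate N sm a0 z h *m v)) => //.
have := What_form z h; rewrite /= hXY J_form K_form => ->.
rewrite vformB vformZ -vformN opprB; congr (_ - _ * _).
by rewrite -!vform_congr adjmxB adjmx1 -adjmx_L adjmxK !mulmxA.
Qed.

Lemma psd_S s : 0 <= vform S s.
Proof.
have [->|s0] := eqVneq s 0; last by apply/ltW; exact: hS.
by rewrite /vform mulmx0 mxE.
Qed.

Lemma dissipative v : vform (adjmx X *m Y + adjmx Y *m X) v <= 0.
Proof.
have [s _ ->] := dissip v; rewrite -opprD oppr_le0 addr_ge0 //; first exact: AB.
by rewrite mulr_ge0 ?psd_S // ltW.
Qed.

(** For X v = 0 the form vanishes, so both nonnegative terms in [dissip] do, and strict positivity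
    of S kills the state. Then What acts on h v as the identity, the state equation gives Y v = 0,
    hence h v = 0, and the pair is nondegenerate. *)
Lemma dissipative_inj (v : 'cV[C]_p) : X *m v = 0 -> v = 0.
Proof.
move=> Xv; have [s sE] := dissip v.
have -> : vform (adjmx X *m Y + adjmx Y *m X) v = 0.
  rewrite vformD /vform.
  have -> : adjmx v *m (adjmx X *m Y) *m v = 0 by rewrite mulmxA -adjmxM Xv adjmx0 !mul0mx.
  have -> : adjmx v *m (adjmx Y *m X) *m v = 0 by rewrite -!mulmxA Xv !mulmx0.
  by rewrite mxE addr0.
move/eqP; rewrite eq_sym -opprD oppr_eq0 paddr_eq0 ?mulr_ge0 ?psd_S ?(ltW z1) //; last exact: AB.
move=> /andP[_]; rewrite mulf_eq0 gt_eqF //= => /eqP s0.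
have {}s0 : s = 0.
  by apply/eqP; case: eqP => // /eqP /hS; rewrite -/(vform S s) s0 ltxx.
have t0 : tstate N sm a0 z h *m v = 0.
  by rewrite -[LHS](mulKmx (U_unit1 R p N)) -sE s0 mulmx0.
have t0' : tstate N sm a0 z (h *m v) = 0.
  by rewrite (_ : tstate N sm a0 z (h *m v) = tstate N sm a0 z h *m v) // /tstate mulmxA.
have hv : h *m v = col_mx 0 (Y *m v).
  have := What_mul N sm a0 z (h *m v); rewrite t0' mulmx0 scaler0 subr0 => <-.
  by rewrite mulmxA hXY mul_col_mx Xv.
have : G *m J *m (h *m v) = 0.
  have := tstateP a0 hS z (h *m v); rewrite t0' mulmx0 => e0.
  by rewrite -Pi_shift -2!mulmxA [Pi *m (J *m _)]mulmxA -e0 mulmx0.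
rewrite hv -mulmxA mulJ_col mul_row_col mulmx0 addr0 => EY.
have Yv : Y *m v = 0.
  have := congr1 (mulmx (Wrow p N 0)) EY; rewrite [Wrow p N 0 *m _]mulmxA Wrow_Ecol mul1mx mulmx0.
  by [].
have {}hv : h *m v = 0 by rewrite hv Yv col_mx0.
move: hv; rewrite /h -mulmxA mul_col_mx Kmx_col => /eqP; rewrite -col_mx0 => /eqP /eq_col_mx [].
move=> /(congr1 (fun M => (sqrtC (2 : C)) *: M)) h1 /(congr1 (fun M => (sqrtC (2 : C)) *: M)) h2.
rewrite !scalerA divff ?scale1r ?scaler0 ?sqrtC_eq0 ?pnatr_eq0 // in h1 h2.
have Av : A *m v = 0.
  have : (2 : C) *: (A *m v) = 0 by rewrite scaler_nat mulr2n -[X in X + _](subrK (B *m v)) h1 add0r addrC h2.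
  by move/eqP; rewrite scaler_eq0 pnatr_eq0 /= => /eqP.
have Bv : B *m v = 0 by move: h2; rewrite Av add0r.
apply/eqP; case: eqP => // /eqP /AB0.
rewrite -/(vform _ v) vformD !vform_gram Av Bv.
by rewrite /vform !mulmx0 mxE addr0 ltxx.
Qed.

Lemma X_unit : X \in unitmx.
Proof. exact: unitmx_inj dissipative_inj. Qed.

Lemma cayley_contractive v : vform (adjmx (X + Y) *m (X + Y)) v <= vform (adjmx (X - Y) *m (X - Y)) v.
Proof.
rewrite -subr_ge0 -vformB adjmxB adjmxD polar_form vformZ mulNr -mulrN mulr_ge0 ?oppr_ge0 ?dissipative //.
Qed.

(** By contractivity a kernel vector of X - Y is also killed by X + Y, hence by X. *)
Lemma XY_unit : X - Y \in unitmx.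
Proof.
apply: unitmx_inj => v XYv.
have := cayley_contractive v; rewrite !vform_gram XYv.
rewrite {2}/vform mulmx0 mxE => h0.
have : vform 1%:M ((X + Y) *m v) = 0 by apply/eqP; rewrite eq_le h0 sqn_ge0.
move/sqn_eq0 => XYv'; apply: dissipative_inj.
have : (2 : C) *: (X *m v) = 0.
  have e : X *m v + X *m v = (X + Y) *m v + (X - Y) *m v.
    by rewrite mulmxDl mulmxBl addrACA subrr addr0.
  by rewrite scaler_nat mulr2n e XYv XYv' addr0.
by move/eqP; rewrite scaler_eq0 pnatr_eq0 /= => /eqP.
Qed.

End Dissipative.

Definition alpoly z : 'M[C]_p := \sum_(k < N.+1) z ^+ k *: a k.
Local Notation eN := (brow N (fun k => if k == N then 1%:M else 0 : 'M[C]_p)).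

Lemma interpolation z q (h : 'M[C]_(p + p, q)) :
  alpoly z *m usubmx (What N sm a0 z *m h) + dsubmx (What N sm a0 z *m h) =
  z ^+ N.+1 *: (eN *m Pi *m J *m h - (1 - z) *: (eN *m S *m U *m tstate N sm a0 z h)).
Proof.
have -> : alpoly z *m usubmx (What N sm a0 z *m h) + dsubmx (What N sm a0 z *m h) =
    row_mx (alpoly z) 1%:M *m (What N sm a0 z *m h).
  by rewrite -{3}[What N sm a0 z *m h]vsubmxK mul_row_col mul1mx.
rewrite What_mul; apply: (transfer_interp (S_displacement N ha0) (J_sqr R p) (Pi_shift N sm a0) (W := Wrow p N z)).
- exact: tstateP.
- by rewrite mul_mx_row Wrow_Ecol Wrow_bcol mul_rowJ.
- exact: Wrow_shift.
Qed.

Section Inverse.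
Variables (z : C) (f : 'M[C]_p) (r : 'M[C]_(\sum_(k < N.+1) p, p)).
Hypothesis hr : (z *: 1%:M - L) *m r = bcol N a - Ecol C p N *m f.
Let h := col_mx 1%:M (- f) + (1 - z) *: (adjmx Pi *m invmx S *m r).

(** [r] is a datum because z - L is singular at z = 0. Its equation reads (z - L) r = G J (1; -f),
    so [transfer_inverse] exhibits [h] as the preimage of (1; -f), and [What_form] gives its
    J-form. *)
Lemma inverse_transfer : What N sm a0 z *m h = col_mx 1%:M (- f) /\
  adjmx h *m J *m h = - (f + adjmx f) + (1 - z * z^*) *: (adjmx r *m invmx S *m r).
Proof.
pose t := invmx (1%:M - U) *m invmx S *m r.
have hGJ : (z *: 1%:M - L) *m r = G *m J *m col_mx 1%:M (- f).
  by rewrite hr -mulmxA mulJ_col mul_row_col mulmx1 mulmxN addrC.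
have tU : (1%:M - U) *m t = invmx S *m r by rewrite /t !mulmxA mulmxV ?mul1mx ?U_unit1.
have Gt : adjmx G *m t = adjmx Pi *m invmx S *m r.
  by rewrite -Pi_shift adjmxM adjmxB adjmx1 adjmx_L -mulmxA tU mulmxA.
have ht : t = tstate N sm a0 z h.
  apply: (tstate_uniq hS); rewrite /h -Gt.
  apply: (transfer_inverse (G := G) (L := L)) => //.
  - exact: S_displacement.
  - exact: Pi_shift.
  - exact: S_unit.
  - exact: Lmx_unit1.
  - exact: U_unit1.
have Wh : What N sm a0 z *m h = col_mx 1%:M (- f) by rewrite What_mul -ht Gt /h addrK.
split=> //; have := What_form z h; rewrite /= -ht Wh J_form adjmx1 mul1mx mulmx1 adjmxN => /eqP.
rewrite eq_sym subr_eq => /eqP ->; rewrite -opprD; congr (_ + _ *: _).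
have -> : adjmx t *m (1%:M - L) = adjmx r *m invmx S.
  have := congr1 (@adjmx R _ _) tU; rewrite !adjmxM adjmxB adjmx1 -adjmx_L adjmxK => ->.
  by rewrite adjmx_inv (adjmx_S _ ha0).
by rewrite mulmxKV ?S_unit // -mulmxA tU mulmxA.
Qed.

End Inverse.

End Pointwise.

(** * Causal contractions *)

Section SeriesAlgebra.
Variable R : realType.
Local Notation C := (R[i]).
Implicit Types (f g : C -> C) (z w : C) (c d : nat -> C).

Lemma sersumD c d z s t : sersum c z s -> sersum d z t -> sersum (fun k => c k + d k) z (s + t).
Proof.
move=> hc hd e e0; have e2 : 0 < e / 2 by lra.
have [N1 h1] := hc _ e2; have [N2 h2] := hd _ e2.
exists (maxn N1 N2) => n; rewrite geq_max => /andP[/h1 k1 /h2 k2].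
rewrite (_ : psum _ z n = psum c z n + psum d z n); last first.
  by rewrite /psum -big_split /=; apply: eq_bigr => k _; rewrite mulrDr.
by rewrite opprD addrACA; apply: le_trans (cabsD _ _) _; lra.
Qed.

Lemma sersumZ c z s a : sersum c z s -> sersum (fun k => a * c k) z (a * s).
Proof.
move=> hc e e0; have a1 : 0 < cabs a + 1 by rewrite ltr_wpDl ?cabs_ge0.
have [N hN] := hc _ (divr_gt0 e0 a1); exists N => n /hN h.
rewrite (_ : psum _ z n = a * psum c z n); last first.
  by rewrite /psum mulr_sumr; apply: eq_bigr => k _; rewrite mulrCA.
rewrite -mulrBr cabsM; apply: le_trans (ler_wpM2l (cabs_ge0 a) h) _.
by rewrite mulrCA ger_pMr // ler_pdivrMr ?mul1r // lerDl.
Qed.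

Lemma sersum0 z : sersum (fun=> 0) z 0.
Proof.
move=> e e0; exists 0%N => n _; rewrite /psum big1 ?subr0 ?cabs0 ?ltW // => k _.
by rewrite mulr0.
Qed.

Lemma sersum_shiftn c z s j : sersum c z s ->
  sersum (fun k => if (j <= k)%N then c (k - j)%N else 0) z (z ^+ j * s).
Proof.
move=> hc; elim: j => [|j IH].
  by rewrite mul1r; apply: eq_sersum hc => k; rewrite subn0.
rewrite exprS -mulrA -[_ * _]add0r.
pose c' k := if (j.+1 <= k)%N then c (k - j.+1)%N else 0.
by rewrite -[X in X + _]/(c' 0%N); apply: sersum_shift.
Qed.

Definition cconv n c (x : nat -> C) k := \sum_(j < n) if (j <= k)%N then c (k - j)%N * x j else 0.

Lemma sersum_cconv n c x z s : sersum c z s ->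
  sersum (cconv n c x) z (s * psum x z n).
Proof.
move=> hc; elim: n => [|n IH].
  by rewrite /psum big_ord0 mulr0; apply: eq_sersum (sersum0 z) => k; rewrite /cconv big_ord0.
rewrite psumS mulrDr mulrCA mulrA [z ^+ n * s * _]mulrC.
apply: eq_sersum (sersumD IH (sersumZ (x n) (sersum_shiftn n hc))) => k.
by rewrite /cconv big_ord_recr /=; case: ifP => _; rewrite ?mulr0 // mulrC.
Qed.

(** h = O(z^n) at 0, the centre included. *)
Definition small n (h : C -> C) := exists (B d : R), 0 < d /\
  forall z, cabs z < d -> cabs (h z) <= B * cabs z ^+ n.

Lemma smallD n h k : small n h -> small n k -> small n (fun z => h z + k z).
Proof.
move=> [B [d [d0 h1]]] [B' [d' [d'0 h2]]]; exists (B + B'), (Num.min d d').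
split; first by rewrite lt_min d0 d'0.
move=> z; rewrite lt_min => /andP[/h1 a1 /h2 a2].
by rewrite mulrDl; apply: le_trans (cabsD _ _) (lerD a1 a2).
Qed.

Lemma smallM_bounded n h k (K d : R) : 0 < d -> (forall z, cabs z < d -> cabs (k z) <= K) ->
  small n h -> small n (fun z => h z * k z).
Proof.
move=> d0 hk [B [d' [d'0 hh]]]; exists (B * K), (Num.min d d').
split; first by rewrite lt_min d0 d'0.
move=> z; rewrite lt_min => /andP[/hk a1 /hh a2].
by rewrite mulrAC cabsM ler_pM ?cabs_ge0.
Qed.

Lemma eq_small n h k (d : R) : 0 < d -> (forall z, cabs z < d -> h z = k z) -> small n h -> small n k.
Proof.
move=> d0 hk [B [d' [d'0 hh]]]; exists B, (Num.min d d'); split; first by rewrite lt_min d0 d'0.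
by move=> z; rewrite lt_min => /andP[/hk <- /hh].
Qed.

Lemma small0 n : small n (fun=> 0).
Proof. by exists 0, 1; split=> // z _; rewrite cabs0 mul0r. Qed.

Lemma small_sum n (I : Type) (r : seq I) (h : I -> C -> C) :
  (forall i, small n (h i)) -> small n (fun z => \sum_(i <- r) h i z).
Proof.
move=> hh; elim: r => [|i r IH].
  by apply: (eq_small ltr01) (small0 n) => z _; rewrite big_nil.
by apply: (eq_small ltr01) (smallD (hh i) IH) => z _; rewrite big_cons.
Qed.

Definition tpoly n c : {poly C} := \poly_(k < n) c k.

Lemma tpolyE n c z : (tpoly n c).[z] = psum c z n.
Proof. by rewrite horner_poly /psum; apply: eq_bigr => k _; rewrite mulrC. Qed.

Lemma small_poly n (P : {poly C}) : small n (fun z => P.[z]) -> forall k, (k < n)%N -> P`_k = 0.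
Proof.
move=> [B [d [d0 h]]]; have [|Q ->] := @poly_small R P n B d d0.
  by move=> w _; exact: h.
by move=> k kn; rewrite coefMXn kn.
Qed.

Section Near0.
Variable r : R.
Hypothesis r0 : 0 < r.

Lemma sersum_small c f n : (forall z, cabs z < r -> sersum c z (f z)) ->
  small n (fun z => f z - psum c z n).
Proof.
move=> hf; have [rho rho0 rr] : exists2 rho, 0 < rho & rho < r.
  by exists (r / 2); rewrite ?divr_gt0 ?ltr_pdivrMr ?ltr_pMr ?ltr1n.
have hrho : 0 < rho < r by rewrite rho0.
have [B hB] := sersum_geom hrho hf.
exists (B / rho ^+ n / (1 - 2^-1)), (rho / 2); split; first by lra.
move=> z zr; have q01 : 0 <= cabs z / rho < 1 by apply: ratio_lt1; [exact: cabs_ge0|lra].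
have zr' : cabs z < r by lra.
have := sersum_tail n q01 (hf z zr') (geom_terms z rho0 hB).
rewrite cabsC => /le_trans; apply.
have B0 : 0 <= B by have := hB 0%N; rewrite expr0 mulr1; apply: le_trans; exact: cabs_ge0.
have q2 : cabs z / rho <= 2^-1 by rewrite ler_pdivrMr //; lra.
rewrite expr_div_n (_ : B * _ / _ = B / rho ^+ n * (1 - cabs z / rho)^-1 * cabs z ^+ n); last by ring.
rewrite ler_wpM2r ?exprn_ge0 ?cabs_ge0 // ler_wpM2l //.
  by rewrite mulr_ge0 ?invr_ge0 ?exprn_ge0 ?(ltW rho0).
by rewrite lef_pV2 ?posrE ?subr_gt0 ?invf_lt1 ?ltr1n //; [lra|case/andP: q01].
Qed.

Lemma sersum_coef_uniq c c' f n : (forall z, cabs z < r -> sersum c z (f z)) ->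
  small n (fun z => f z - psum c' z n) -> forall k, (k < n)%N -> c k = c' k.
Proof.
move=> hf hs k kn; have h1 := sersum_small n hf.
have : small n (fun z => (tpoly n c' - tpoly n c).[z]).
  have h2 : small n (fun z => -1 * (f z - psum c' z n)).
    apply: (eq_small ltr01) (smallM_bounded (k := fun=> -1) (K := 1) ltr01 _ hs) => [z _|z _].
      by rewrite mulrC.
    by rewrite cabsN cabs1.
  by apply: (eq_small ltr01) (smallD h1 h2) => z _; rewrite hornerD hornerN !tpolyE; ring.
move/small_poly/(_ k kn); rewrite coefB !coef_poly kn => /eqP.
by rewrite subr_eq0 => /eqP.
Qed.

(** Everything is compared modulo O(z^n), where each series may be replaced by its truncation:
    products of series become products of polynomials, whose coefficients are the convolutions. *)
Lemma cauchy_coef m (g h : 'I_m -> nat -> C) (w : nat -> C) (G H : 'I_m -> C -> C) (W : C -> C) n :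
  (forall i z, cabs z < r -> sersum (g i) z (G i z)) ->
  (forall i z, cabs z < r -> sersum (h i) z (H i z)) ->
  (forall z, cabs z < r -> sersum w z (W z)) ->
  (forall z, cabs z < r -> \sum_i G i z * H i z = W z) ->
  forall k, (k < n)%N -> \sum_i cconv n (g i) (h i) k = w k.
Proof.
move=> hg hh hw GHW k kn.
have bnd i : exists (K d : R), 0 < d /\ forall z, cabs z < d -> cabs (H i z) <= K.
  have j0 : jet (H i) 0 by apply: (jet_sersum (c := h i) (r := r)) => //; [rewrite cabs0|exact: hh].
  have [K [d [K0 d0 hK]]] := jet_bounded j0; exists K, d; split=> // z zd.
  by have := hK z zd; rewrite add0r.
have bndP (P : {poly C}) : exists (K d : R), 0 < d /\ forall z, cabs z < d -> cabs P.[z] <= K.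
  have [K K0 hK] := poly_bounded P ler01; exists K, 1; split=> // z zd.
  by apply: hK; exact: ltW.
have h1 i : small n (fun z => G i z * H i z - (tpoly n (g i) * tpoly n (h i)).[z]).
  have [K [d [d0 hK]]] := bnd i; have [K' [d' [d'0 hK']]] := bndP (tpoly n (g i)).
  apply: (eq_small ltr01) (smallD (smallM_bounded d0 hK (sersum_small n (hg i)))
     (smallM_bounded d'0 hK' (sersum_small n (hh i)))) => z _.
  by rewrite hornerM !tpolyE; ring.
have h2 : small n (fun z => W z - (\sum_i tpoly n (g i) * tpoly n (h i)).[z]).
  apply: (eq_small r0) (small_sum (index_enum 'I_m) h1) => z /GHW <-.
  by rewrite horner_sum -sumrB.
pose c' l := (\sum_i tpoly n (g i) * tpoly n (h i))`_l.
have : small n (fun z => (tpoly n w - \sum_i tpoly n (g i) * tpoly n (h i)).[z]).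
  have h3 : small n (fun z => -1 * (W z - psum w z n)).
    apply: (eq_small ltr01) (smallM_bounded (k := fun=> -1) (K := 1) ltr01 _ (sersum_small n hw)) => [z _|z _].
      by rewrite mulrC.
    by rewrite cabsN cabs1.
  by apply: (eq_small ltr01) (smallD h2 h3) => z _; rewrite hornerD hornerN !tpolyE; ring.
move/small_poly/(_ k kn)/eqP; rewrite coefB coef_poly kn subr_eq0 => /eqP ->.
rewrite coef_sum; apply: eq_bigr => i _; rewrite coefMr /cconv (big_ord_widen n (fun j => (tpoly n (g i))`_(k - j) * (tpoly n (h i))`_j) kn) [RHS]big_mkcond /=.
apply: eq_bigr => j _; rewrite ltnS; case: ifP => // jk.
by rewrite !coef_poly ltn_ord (leq_ltn_trans (leq_subr _ _) kn).
Qed.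

End Near0.
End SeriesAlgebra.

(** * Parseval's identity and contractions on coefficients *)

Section Parseval.
Variable R : realType.
Local Notation C := (R[i]).
Implicit Types (z w : C).

Lemma cabs_prim_root n (w : C) : n.-primitive_root w -> cabs w = 1.
Proof.
move=> pw; have := congr1 (@cabs R) (prim_expr_order pw); rewrite cabsX cabs1 => /eqP.
by rewrite pexpr_eq1 ?cabs_ge0 ?(prim_order_gt0 pw) // => /eqP.
Qed.

(** Distinct powers below n are orthogonal on the n-th roots of unity, so sampling is exact for n
    terms. *)
Lemma parseval_poly n (w : C) (u : nat -> C) : n.-primitive_root w ->
  \sum_(j < n) cabs (psum u (w ^+ j) n) ^+ 2 = n%:R * \sum_(k < n) cabs (u k) ^+ 2.
Proof.
move=> pw; apply: (@complexI R); rewrite rmorphM rmorph_nat !rmorph_sum /=.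
have n0 := prim_order_gt0 pw.
have ww : w * w^* = 1 by rewrite -sqr_cabs (cabs_prim_root pw) expr1n.
have orth (k l : 'I_n) : \sum_(j < n) (w ^+ j) ^+ k * ((w ^+ j) ^+ l)^* = n%:R *+ (k == l).
  rewrite (eq_bigr (fun j : 'I_n => (w ^+ k * (w ^+ l)^*) ^+ j)) => [|j _]; last first.
    by rewrite exprMn -rmorphXn /= -!exprM ![(j * _)%N]mulnC.
  have [<-|kl] := eqVneq k l.
    rewrite rmorphXn /= -exprMn ww expr1n (eq_bigr (fun=> 1)) => [|j _]; last by rewrite expr1n.
    by rewrite sumr_const card_ord mulr1n.
  rewrite mulr0n; set q := w ^+ k * _.
  have q1 : q - 1 != 0.
    rewrite subr_eq0; apply: contra kl => /eqP q1.
    have : w ^+ k = w ^+ l.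
      have e : w ^+ l * (w ^+ l)^* = 1 by rewrite rmorphXn /= -exprMn ww expr1n.
      by rewrite -[LHS]mulr1 -e mulrA mulrAC -/q q1 mul1r.
    move/eqP; rewrite (eq_prim_root_expr pw) !modn_small //.
  apply: (mulfI q1); rewrite mulr0 -subrX1 /q exprMn -rmorphXn /= -!exprM.
  by rewrite ![(_ * n)%N]mulnC !exprM (prim_expr_order pw) !expr1n rmorph1 mulr1 subrr.
rewrite (eq_bigr (fun j : 'I_n => \sum_(k < n) \sum_(l < n)
   (u k * (u l)^*) * ((w ^+ j) ^+ k * ((w ^+ j) ^+ l)^*))) => [|j _]; last first.
  rewrite sqr_cabs /psum rmorph_sum /= mulr_suml; apply: eq_bigr => k _.
  rewrite mulr_sumr; apply: eq_bigr => l _; rewrite rmorphM /=; ring.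
rewrite exchange_big /= mulr_sumr; apply: eq_bigr => k _.
rewrite exchange_big /= (bigD1 k) //= [X in _ + X]big1 => [|l lk].
  by rewrite -mulr_sumr orth eqxx mulr1n addr0 sqr_cabs mulrC.
by rewrite -mulr_sumr orth eq_sym (negPf lk) mulr0n mulr0.
Qed.

Lemma psum_scale c z (t : C) n : psum c (t * z) n = psum (fun k => t ^+ k * c k) z n.
Proof. by rewrite /psum; apply: eq_bigr => k _; rewrite exprMn mulrAC mulrA mulrC mulrA. Qed.

(** Replacing F by its partial sum of n terms costs an error geometric in n, uniformly on the circle
    of radius rho, so the exact identity for polynomials applies once n is large. *)
Lemma parseval_lower (f : nat -> C) (F : C -> C) (rho e : R) K :
  (forall z, cabs z < 1 -> sersum f z (F z)) -> 0 < rho < 1 -> 0 < e ->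
  exists N, forall n (w : C), (N <= n)%N -> n.-primitive_root w ->
    n%:R * (\sum_(k < K) cabs (f k) ^+ 2 * (rho ^+ k) ^+ 2 - e) <=
    \sum_(j < n) cabs (F (real_complex R rho * w ^+ j)) ^+ 2.
Proof.
move=> hf /andP[rho0 rho1] e0.
have [rho' r1 r2] : exists2 rho', rho < rho' & rho' < 1 by exists ((rho + 1) / 2); lra.
have rho'0 : 0 < rho' by lra.
have [B hB] := sersum_geom (introT andP (conj rho'0 r2)) hf.
pose q := rho / rho'; have q01 : 0 <= q < 1 by apply: ratio_lt1; rewrite ?ltW.
have [q0 q1] := andP q01.
pose B1 := B / (1 - q).
have B0 : 0 <= B by have := hB 0%N; rewrite expr0 mulr1; apply: le_trans; exact: cabs_ge0.
have B10 : 0 <= B1 by rewrite divr_ge0 // subr_ge0 ltW.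
(* Squaring |psum| <= |F| + |psum - F| costs at most 3 B1^2 q^n: twice for the cross term and once
   for the square. *)
have [N hN] := geom_small (3 * B1 ^+ 2) q01 e0.
exists (maxn N K) => n w; rewrite geq_max => /andP[/hN hn Kn] pw.
have n0 := prim_order_gt0 pw.
have rA : cabs (real_complex R rho) = rho by rewrite cabsR gtr0_norm.
have step (j : 'I_n) : cabs (psum f (real_complex R rho * w ^+ j) n) ^+ 2 - e <=
    cabs (F (real_complex R rho * w ^+ j)) ^+ 2.
  set z := _ * _; have zA : cabs z = rho.
    by rewrite cabsM cabsX (cabs_prim_root pw) expr1n mulr1.
  have z1 : cabs z < 1 by rewrite zA.
  have ht k : cabs z ^+ k * cabs (f k) <= B * q ^+ k by rewrite /q -zA; exact: geom_terms.
  have t1 := sersum_tail n q01 (hf z z1) ht.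
  have t2 := sersum_bound q01 (hf z z1) ht.
  rewrite -/B1 in t2; rewrite mulrAC -/B1 in t1.
  have qn : 0 <= q ^+ n <= 1 by rewrite exprn_ge0 //= exprn_ile1 // ltW.
  have t3 : cabs (psum f z n) <= cabs (F z) + cabs (psum f z n - F z).
    by have := cabsD (F z) (psum f z n - F z); rewrite addrC subrK.
  have g0 := cabs_ge0 (psum f z n); have g1 := cabs_ge0 (F z); have g2 := cabs_ge0 (psum f z n - F z).
  have t4 : cabs (psum f z n) ^+ 2 <= (cabs (F z) + cabs (psum f z n - F z)) ^+ 2.
    by rewrite lerXn2r ?nnegrE ?addr_ge0.
  have t5 : cabs (F z) * cabs (psum f z n - F z) <= B1 * (B1 * q ^+ n) by rewrite ler_pM.
  have t6 : cabs (psum f z n - F z) * cabs (psum f z n - F z) <= B1 * (B1 * q ^+ n).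
    apply: ler_pM => //; apply: le_trans t1 _; rewrite ler_piMr //; by case/andP: qn.
  move: hn; rewrite expr2 -mulrA -mulrA => hn.
  rewrite !expr2 in t4 *; lra.
have := ler_sum (index_enum 'I_n) (P := xpredT) (fun j _ => step j).
rewrite sumrB sumr_const card_ord -[e *+ n]mulr_natl => h.
apply: le_trans h; rewrite mulrBr lerD2r.
rewrite (eq_bigr (fun j : 'I_n => cabs (psum (fun k => real_complex R rho ^+ k * f k) (w ^+ j) n) ^+ 2))
  => [|j _]; last by rewrite psum_scale.
rewrite (parseval_poly _ pw) ler_wpM2l // (big_ord_widen n (fun k => cabs (f k) ^+ 2 * (rho ^+ k) ^+ 2) Kn).
rewrite [leLHS]big_mkcond /=; apply: ler_sum => k _; case: ifP => _.
  by rewrite cabsM cabsX rA exprMn mulrC.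
by rewrite sqr_ge0.
Qed.

Definition sqn p (v : 'cV[C]_p) : R := \sum_i cabs (v i 0) ^+ 2.

Lemma sqn_nneg p (v : 'cV[C]_p) : 0 <= sqn v.
Proof. by apply: sumr_ge0 => i _; exact: sqr_ge0. Qed.

Lemma bernoulli_lower (d : R) m : 0 <= d <= 1 -> 1 - m%:R * d <= (1 - d) ^+ m.
Proof.
move=> /andP[d0 d1]; elim: m => [|m IH]; first by rewrite mul0r subr0 expr0.
rewrite exprS; apply: le_trans (ler_wpM2l _ IH); last by lra.
rewrite -natr1; have : 0 <= m%:R * (d * d) by rewrite !mulr_ge0.
lra.
Qed.

(** Block [k] of the lower triangular block Toeplitz matrix of [c], with M block columns, applied to
    [x]; also a coefficient of the series of [c] times a vector polynomial. *)
Definition mconv p M (c : nat -> 'M[C]_p) (x : nat -> 'cV[C]_p) k :=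
  \sum_(j < M) if (j <= k)%N then c (k - j)%N *m x j else 0.

Lemma mconvE p M c x k (i : 'I_p) :
  mconv M c x k i 0 = \sum_l cconv M (fun k => c k i l) (fun j => x j l 0) k.
Proof.
rewrite summxE /cconv exchange_big /=; apply: eq_bigr => j _.
by case: ifP => _; rewrite mxE // big1.
Qed.

Lemma sersum_sum p (c : 'I_p -> nat -> C) z (s : 'I_p -> C) :
  (forall i, sersum (c i) z (s i)) -> sersum (fun k => \sum_i c i k) z (\sum_i s i).
Proof.
move=> h; elim: (index_enum _) => [|i r IH].
  by rewrite big_nil; apply: eq_sersum (sersum0 z) => k; rewrite big_nil.
by rewrite big_cons; apply: eq_sersum (sersumD (h i) IH) => k; rewrite big_cons.
Qed.

Definition polyvec p M (x : nat -> 'cV[C]_p) z : 'cV[C]_p := \sum_(j < M) z ^+ j *: x j.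

Lemma polyvecE p M (x : nat -> 'cV[C]_p) z l : polyvec M x z l 0 = psum (fun j => x j l 0) z M.
Proof. by rewrite /polyvec summxE; apply: eq_bigr => j _; rewrite mxE. Qed.

Lemma sersum_mconv p M c x z (V : 'M[C]_p) i : pser_to c z V ->
  sersum (fun k => mconv M c x k i 0) z ((V *m polyvec M x z) i 0).
Proof.
move=> /pser_toP hz; rewrite mxE.
apply: eq_sersum (sersum_sum (c := fun l => cconv M (fun k => c k i l) (fun j => x j l 0))
  (s := fun l => V i l * polyvec M x z l 0) _) => [k|l]; first by rewrite mconvE.
by rewrite polyvecE; exact: sersum_cconv.
Qed.

(** On a circle of radius rho < 1 the mean of |V x|^2 is at most that of |x|^2, where x(z) is the
    vector polynomial. Parseval turns both means into sums over coefficients with weights rho^(2k),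
    and rho tends to 1. *)
Theorem causal_contraction p M (V : C -> 'M[C]_p) c (x : nat -> 'cV[C]_p) :
  (forall z, cabs z < 1 -> pser_to c z (V z)) ->
  (forall z v, cabs z < 1 -> sqn (V z *m v) <= sqn v) ->
  \sum_(k < M) sqn (mconv M c x k) <= \sum_(k < M) sqn (x k).
Proof.
move=> hV hc; set X := \sum_(k < M) sqn (x k).
pose xz := polyvec M x.
have xzE z l : xz z l 0 = psum (fun j => x j l 0) z M by exact: polyvecE.
have hF i z : cabs z < 1 -> sersum (fun k => mconv M c x k i 0) z ((V z *m xz z) i 0).
  by move=> z1; apply: sersum_mconv; exact: hV.
have meanX n (w : C) (rho : R) : 0 < rho < 1 -> (M <= n)%N -> n.-primitive_root w ->
    \sum_(j < n) sqn (xz (real_complex R rho * w ^+ j)) <= n%:R * X.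
  move=> /andP[rho0 rho1] Mn pw; rewrite /sqn exchange_big /=.
  rewrite /X /sqn [in leRHS]exchange_big /= mulr_sumr; apply: ler_sum => l _.
  pose u k : C := if (k < M)%N then real_complex R rho ^+ k * x k l 0 else 0.
  rewrite (eq_bigr (fun j : 'I_n => cabs (psum u (w ^+ j) n) ^+ 2)) => [|j _]; last first.
    rewrite xzE psum_scale /psum; congr (cabs _ ^+ 2).
    rewrite (big_ord_widen n (fun k => (w ^+ j) ^+ k * (real_complex R rho ^+ k * x k l 0)) Mn).
    rewrite big_mkcond /=; apply: eq_bigr => k _; rewrite /u; case: ifP => //.
    by rewrite mulr0.
  rewrite (parseval_poly _ pw) ler_wpM2l // (big_ord_widen n (fun k => cabs (x k l 0) ^+ 2) Mn).
  rewrite [leRHS]big_mkcond /=; apply: ler_sum => k _; rewrite /u; case: ifP => _.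
    rewrite lerXn2r ?nnegrE ?cabs_ge0 // cabsM cabsX cabsR gtr0_norm //.
    by rewrite ler_piMl ?cabs_ge0 // exprn_ile1 // ltW.
  by rewrite cabs0 expr0n.
pose Y (rho : R) := \sum_(k < M) sqn (mconv M c x k) * (rho ^+ k) ^+ 2.
have step (rho : R) : 0 < rho < 1 -> Y rho <= X.
  move=> hrho; apply/ler_addgt0Pr => e e0.
  (* The error is shared among the p coordinates; p + 1 avoids a division by zero. *)
  have ep : 0 < e / p.+1%:R by rewrite divr_gt0.
  have /choice [Nf hN] := fun i => parseval_lower M (hF i) hrho ep.
  pose n := (maxn M.+1 (\max_i Nf i))%N.
  have n0 : (0 < n)%N by rewrite leq_max.
  have [w pw] := prim_root_exists R n0.
  have h1 : n%:R * (Y rho - e) <= \sum_(j < n) sqn (V (real_complex R rho * w ^+ j) *m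
        xz (real_complex R rho * w ^+ j)).
    rewrite /sqn exchange_big /=.
    apply: le_trans (ler_sum _ (fun i _ => hN i n w _ pw)); last first.
      by move=> i _; rewrite /n leq_max (leq_bigmax i) orbT.
    rewrite -mulr_sumr ler_wpM2l // sumrB sumr_const card_ord.
    have -> : \sum_(i < p) \sum_(k < M) cabs (mconv M c x k i 0) ^+ 2 * (rho ^+ k) ^+ 2 = Y rho.
      by rewrite exchange_big; apply: eq_bigr => k _; rewrite /sqn mulr_suml.
    rewrite lerD2l lerN2 -[_ / _ *+ _]mulr_natl mulrCA ger_pMr // ler_pdivrMr // mul1r ler_nat.
    exact: leqnSn.
  have h2 : \sum_(j < n) sqn (V (real_complex R rho * w ^+ j) *m
        xz (real_complex R rho * w ^+ j)) <= n%:R * X.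
    apply: le_trans (meanX n w rho hrho _ pw); last by rewrite /n leq_max leqnSn.
    apply: ler_sum => j _; apply: hc; rewrite cabsM cabsX (cabs_prim_root pw) expr1n mulr1.
    by rewrite cabsR gtr0_norm; case/andP: hrho.
  have := le_trans h1 h2; rewrite ler_pM2l ?ltr0n // lerBlDr.
  by [].
apply/ler_addgt0Pr => e e0; set Y1 := \sum_(k < M) _.
have Y10 : 0 <= Y1 by apply: sumr_ge0 => k _; exact: sqn_nneg.
(* By Bernoulli, (1 - d)^(2k) >= 1 - 2 M d for k < M, so passing from Y1 to [Y (1 - d)] loses at
   most 2 M Y1 d; [A] exceeds 2 M Y1 and is positive. *)
pose A : R := (2 * M)%:R * Y1 + 1; have A0 : 0 < A by rewrite ltr_wpDl // mulr_ge0.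
pose d := Num.min 2^-1 (e / A).
have d0 : 0 < d by rewrite lt_min divr_gt0 // invr_gt0 ltr0n.
have d2 : d <= 2^-1 by rewrite ge_min lexx.
have dA : d * A <= e by rewrite -ler_pdivlMr // ge_min lexx orbT.
have hr : 0 < 1 - d < 1 by lra.
have hd : 0 <= d <= 1 by lra.
have h1 := step _ hr.
have h2 : Y1 * (1 - (2 * M)%:R * d) <= Y (1 - d).
  rewrite mulr_suml; apply: ler_sum => k _; rewrite ler_wpM2l ?sqn_nneg //.
  apply: le_trans (bernoulli_lower _ hd) _; rewrite -exprM mulnC.
  apply: ler_wiXn2l; [by lra|by lra|].
  by rewrite leq_mul2r /= ltnW.
have h3 : A * d = (2 * M)%:R * Y1 * d + d by rewrite /A mulrDl mul1r.
move: dA; rewrite mulrC h3 => dA.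
have h4 : Y1 * (1 - (2 * M)%:R * d) = Y1 - (2 * M)%:R * Y1 * d by ring.
lra.
Qed.

End Parseval.

(** * Toeplitz forms *)

Section ToeplitzForms.
Variable R : realType.
Local Notation C := (R[i]).

Section Bil.
Variable p : nat.
Implicit Types u v w : 'cV[C]_p.

Definition bil u v : C := (adjmx u *m v) 0 0.

Lemma bil_conj u v : (bil u v)^* = bil v u.
Proof.
have -> : bil v u = adjmx (adjmx u *m v) 0 0 by rewrite adjmxM adjmxK.
by rewrite mxE.
Qed.
Lemma bilDr u v w : bil u (v + w) = bil u v + bil u w.
Proof. by rewrite /bil mulmxDr mxE. Qed.
Lemma bilDl u v w : bil (u + v) w = bil u w + bil v w.
Proof. by rewrite /bil adjmxD mulmxDl mxE. Qed.
Lemma bilNr u v : bil u (- v) = - bil u v.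
Proof. by rewrite /bil mulmxN mxE. Qed.
Lemma bilNl u v : bil (- u) v = - bil u v.
Proof. by rewrite /bil adjmxN mulNmx mxE. Qed.
Lemma bilZr u c v : bil u (c *: v) = c * bil u v.
Proof. by rewrite /bil -scalemxAr mxE. Qed.
Lemma bilZl u c v : bil (c *: u) v = c^* * bil u v.
Proof. by rewrite /bil adjmxZ -scalemxAl mxE. Qed.
Lemma bil0r u : bil u 0 = 0. Proof. by rewrite /bil mulmx0 mxE. Qed.
Lemma bil0l u : bil 0 u = 0. Proof. by rewrite /bil adjmx0 mul0mx mxE. Qed.
Lemma bil_adj (A : 'M[C]_p) u v : bil u (adjmx A *m v) = (bil v (A *m u))^*.
Proof. by rewrite bil_conj /bil adjmxM mulmxA. Qed.

Lemma bil_sqn u : bil u u = real_complex R (sqn u).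
Proof.
rewrite /bil mxE /sqn rmorph_sum /=; apply: eq_bigr => i _.
by rewrite mxE sqr_cabs mulrC.
Qed.

Lemma sqn_polar u v :
  real_complex R (sqn (u + v)) - real_complex R (sqn (u - v)) = 2 * (bil u v + (bil u v)^*).
Proof.
rewrite -!bil_sqn bil_conj !(bilDl, bilDr, bilNl, bilNr).
by move: (bil u u) (bil v v) (bil u v) (bil v u) => a b c d; ring.
Qed.

End Bil.

Section Form.
Variable p : nat.
Variables A t : nat -> 'M[C]_p.
Hypothesis t0 : t 0%N = A 0%N + adjmx (A 0%N).
Hypothesis tS : forall k, t k.+1 = A k.+1.

Definition TF n (x : nat -> 'cV[C]_p) : C :=
  \sum_(k < n) \sum_(j < n) bil (x k) (toep_blk t k j *m x j).

Lemma toeplitz_TF M (x : nat -> 'cV[C]_p) :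
  vform (toeplitz M t) (bcol M x) = TF M.+1 x.
Proof.
have -> : vform (toeplitz M t) (bcol M x) =
    (adjmx (bcol M x) *m (toeplitz M t *m bcol M x)) 0 0 by rewrite /vform mulmxA.
have -> : adjmx (bcol M x) = brow M (fun k => adjmx (x k)).
  by apply/matrixP => i j; rewrite !mxE.
rewrite mul_mxblock_mxrow mul_mxrow_mxcol summxE; apply: eq_bigr => k _.
by rewrite mulmx_sumr summxE.
Qed.

Lemma psd_TF M : psdmx (toeplitz M t) <-> forall x, 0 <= TF M.+1 x.
Proof.
split=> [h x|h v]; first by rewrite -toeplitz_TF; exact: h.
by have [x ->] := bcol_surj v; have := h x; rewrite -toeplitz_TF.
Qed.

(** Half of the terms of the form that involve the first vector [u], the diagonal block being split
    into A_0 and its adjoint. *)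
Definition Dterm n (x : nat -> 'cV[C]_p) (u : 'cV[C]_p) : C :=
  bil u (A 0%N *m u) + \sum_(k < n) bil (x k) (A k.+1 *m u).

Lemma TFS n x : TF n.+1 x = TF n (fun k => x k.+1) +
  (Dterm n (fun k => x k.+1) (x 0%N) + (Dterm n (fun k => x k.+1) (x 0%N))^*).
Proof.
have S1 (f : nat -> nat -> C) : \sum_(k < n.+1) \sum_(j < n.+1) f k j =
   \sum_(k < n) \sum_(j < n) f k.+1 j.+1 +
   (f 0%N 0%N + \sum_(k < n) f k.+1 0%N + \sum_(j < n) f 0%N j.+1).
  have E : \sum_(k < n) \sum_(j < n.+1) f k.+1 j =
      \sum_(k < n) f k.+1 0%N + \sum_(k < n) \sum_(j < n) f k.+1 j.+1.
    by rewrite -big_split; apply: eq_bigr => k _; rewrite big_ord_recl.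
  rewrite big_ord_recl /= E big_ord_recl /=.
  move: (\sum_(k < n) \sum_(j < n) _) (\sum_(k < n) f k.+1 0%N) (\sum_(j < n) f 0%N _).
  by move=> a b c; ring.
rewrite /TF (S1 (fun k j => bil (x k) (toep_blk t k j *m x j))); congr (_ + _).
rewrite /toep_blk /= t0 mulmxDl bilDr bil_adj /Dterm rmorphD rmorph_sum /=.
rewrite (eq_bigr (fun k : 'I_n => bil (x k.+1) (A k.+1 *m x 0%N))) => [|k _]; last by rewrite tS.
rewrite [X in _ + X = _](eq_bigr (fun k : 'I_n => (bil (x k.+1) (A k.+1 *m x 0%N))^*)) => [|k _].
  by move: (bil _ _) (\sum_(i < n) bil _ _) (\sum_(i < n) _^*) => a b c; ring.
by rewrite tS bil_adj.
Qed.

(** The Hermitian Toeplitz matrix is a lower triangular one plus its adjoint; [TFS] peels off the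
    first vector, so the induction never reorders double sums. *)
Lemma TF_causal n x :
  TF n x = \sum_(k < n) bil (x k) (mconv n A x k) + (\sum_(k < n) bil (x k) (mconv n A x k))^*.
Proof.
elim: n x => [|n IH] x; first by rewrite /TF !big_ord0 rmorph0 addr0.
rewrite TFS IH.
have -> : \sum_(k < n.+1) bil (x k) (mconv n.+1 A x k) =
   \sum_(k < n) bil (x k.+1) (mconv n A (fun k => x k.+1) k) + Dterm n (fun k => x k.+1) (x 0%N).
  rewrite big_ord_recl /= /mconv big_ord_recl /= subn0 big1 ?addr0 // /Dterm.
  rewrite (eq_bigr (fun k : 'I_n => bil (x k.+1) (A k.+1 *m x 0%N) +
     bil (x k.+1) (mconv n A (fun k => x k.+1) k))) => [|k _].
    by rewrite big_split /= addrA addrC.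
  by rewrite big_ord_recl /= subn0 bilDr.
by rewrite [in RHS]rmorphD addrACA.
Qed.

(* The Cayley transform turns a causal contraction into a positive form. *)
Lemma TF_cayley n x (g : nat -> 'M[C]_p) :
  (forall k, (k < n)%N -> mconv n g (fun j => x j + mconv n A x j) k = x k - mconv n A x k) ->
  \sum_(k < n) sqn (mconv n g (fun j => x j + mconv n A x j) k) <=
    \sum_(k < n) sqn (x k + mconv n A x k) ->
  0 <= TF n x.
Proof.
move=> hg hc; rewrite TF_causal -(pmulr_rge0 _ (ltr0Sn C 1)).
have -> : 2 * (\sum_(k < n) bil (x k) (mconv n A x k) + (\sum_(k < n) bil (x k) (mconv n A x k))^*) =
   real_complex R (\sum_(k < n) sqn (x k + mconv n A x k) - \sum_(k < n) sqn (x k - mconv n A x k)).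
  rewrite rmorphB !rmorph_sum -sumrB -big_split /= mulr_sumr /=.
  by apply: eq_bigr => k _; rewrite sqn_polar.
rewrite ler0c subr_ge0; apply: le_trans hc; rewrite le_eqVlt; apply/orP; left; apply/eqP.
by apply: eq_bigr => k _; rewrite hg.
Qed.

End Form.
End ToeplitzForms.

(** * The fundamental matrix inequality *)

Section FundamentalInequality.
Variable R : realType.
Local Notation C := (R[i]).
Variable p : nat.
Variables A t : nat -> 'M[C]_p.
Hypothesis t0 : t 0%N = A 0%N + adjmx (A 0%N).
Hypothesis tS : forall k, t k.+1 = A k.+1.
Variable N : nat.
Hypothesis hTF : forall n x, (N.+1 < n)%N -> 0 <= TF t n x.

Lemma TF_single n k v : (k < n)%N -> TF t n (fun j => if j == k then v else 0) = bil v (t 0%N *m v).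
Proof.
move=> kn; rewrite /TF (bigD1 (Ordinal kn)) //= [X in _ + X]big1 ?addr0 => [|l lk]; last first.
  by rewrite big1 // => j _; rewrite ifN ?bil0l.
rewrite (bigD1 (Ordinal kn)) //= big1 ?addr0 => [|l lk].
  by rewrite eqxx /toep_blk leqnn subnn.
by rewrite [if l == k :> nat then _ else _]ifN ?mulmx0 ?bil0r.
Qed.

Lemma bil_delta (B : 'M[C]_p) i j :
  bil (delta_mx i 0) (B *m delta_mx j 0) = B i j.
Proof.
rewrite /bil (_ : adjmx (delta_mx i 0 : 'cV[C]_p) = delta_mx 0 i); last first.
  by apply/matrixP => k l; rewrite !mxE andbC rmorph_nat.
by rewrite -rowE -colE !mxE.
Qed.

(** The form is evaluated on two vectors, tau e_j in position 0 and e_i in position k + 1: the phase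
    tau makes the cross terms -2 |A_ij|, and the diagonal terms do not depend on k. *)
Lemma coef_bound k i j : cabs (A k.+1 i j) <= cabs (t 0%N i i) + cabs (t 0%N j j).
Proof.
have [->|A0] := eqVneq (A k.+1 i j) 0; first by rewrite cabs0 addr_ge0 ?cabs_ge0.
pose tau := - (A k.+1 i j)^* / `|A k.+1 i j|.
have nA : `|A k.+1 i j| != 0 by rewrite normr_eq0.
have tau1 : tau^* * tau = 1.
  rewrite /tau rmorphM rmorphN /= conjCK fmorphV /= conj_normC.
  by rewrite mulrACA mulrNN -normCK -expr2 exprVn divff // expf_neq0.
have tauA : tau * A k.+1 i j = - `|A k.+1 i j|.
  by rewrite /tau mulrAC mulNr [_^* * _]mulrC -normCK expr2 mulNr mulfK.
pose u : 'cV[C]_p := tau *: delta_mx j 0; pose v : 'cV[C]_p := delta_mx i 0.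
pose x l := if l == 0%N then u else if l == k.+1 then v else 0.
(* Padding by zeros: positivity is given for more than N + 1 blocks only. *)
pose n := (k.+1 + N.+1)%N.
have := hTF x (_ : (N.+1 < n.+1)%N); rewrite (TFS t0 tS).
have -> : TF t n (fun l => x l.+1) = bil v (t 0%N *m v).
  by rewrite -(TF_single (n := n) (k := k)) // /n; lia.
have -> : Dterm A n (fun l => x l.+1) (x 0%N) = bil u (A 0%N *m u) + bil v (A k.+1 *m u).
  rewrite /Dterm; congr (_ + _); have kn : (k < n)%N by rewrite /n; lia.
  rewrite (bigD1 (Ordinal kn)) //= big1 ?addr0 /x /= ?eqxx // => l lk.
  by rewrite eqSS ifN ?bil0l.
have -> : forall a : C, a + (bil u (A 0%N *m u) + bil v (A k.+1 *m u) +
    (bil u (A 0%N *m u) + bil v (A k.+1 *m u))^*) =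
    a + bil u (t 0%N *m u) + (bil v (A k.+1 *m u) + (bil v (A k.+1 *m u))^*).
  move=> a; rewrite t0 mulmxDl bilDr bil_adj rmorphD /=.
  by move: (bil _ _) (bil _ _) (bil _ _)^* (bil _ _)^* => c1 c2 c3 c4; ring.
have -> : bil u (t 0%N *m u) = t 0%N j j 
  by rewrite bilZl -scalemxAr bilZr bil_delta mulrA tau1 mul1r.
have -> : bil v (t 0%N *m v) = t 0%N i i by exact: bil_delta.
have -> : bil v (A k.+1 *m u) = - `|A k.+1 i j| 
  by rewrite -scalemxAr bilZr bil_delta.
rewrite rmorphN /= conj_normC.
move=> /(_ _) h; have {h} : 0 <= t 0%N i i + t 0%N j j - (`|A k.+1 i j| + `|A k.+1 i j|).
  by rewrite opprD; apply: h; rewrite /n; lia.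
rewrite subr_ge0 => h.
have h1 : `|A k.+1 i j| <= t 0%N i i + t 0%N j j by apply: le_trans h; rewrite lerDl.
rewrite -lecR -normcR; apply: le_trans h1 _; apply: le_trans (real_ler_norm _) _.
  by rewrite ger0_real // (le_trans _ h) // addr_ge0.
by rewrite normcR lecR; exact: cabsD.
Qed.

Variables (z : C) (y : 'cV[C]_p) (X : nat -> 'cV[C]_p).

(* The Toeplitz form is evaluated at (z^(n-1) y, ..., z y, y, X_0, ..., X_N); the
   inequality is what remains of its positivity as n tends to infinity. *)
Fixpoint geomvec n : nat -> 'cV[C]_p :=
  if n is m.+1 then fun k => if k is k'.+1 then geomvec m k' else z ^+ m *: y else X.

Lemma geomvec_lt n k : (k < n)%N -> geomvec n k = z ^+ (n.-1 - k) *: y.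
Proof.
elim: n k => [//|n IH] [|k] kn /=; first by rewrite subn0.
by rewrite IH //; congr (z ^+ _ *: y); lia.
Qed.

Lemma geomvec_ge n m : geomvec n (n + m) = X m.
Proof. by elim: n. Qed.

Let ph d := bil y (A d *m y).
Let be l := \sum_(m < N.+1) bil (X m) (A (l + m).+1 *m y).
Let kap := z * z^*.
(** The terms of [Dterm] that pair z^n y with the geometric part of the vector; those with [X]
    amount to z^n times [be n]. *)
Let e n := \sum_(d < n.+1) (z^*) ^+ (n - d) * z ^+ n * ph d.

Let eS n : e n.+1 = kap * e n + z ^+ n.+1 * ph n.+1.
Proof.
rewrite /e big_ord_recr /= subnn expr0 mul1r; congr (_ + _).
rewrite mulr_sumr; apply: eq_bigr => d _; have dn : (d <= n)%N by rewrite -ltnS.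
rewrite subSn // !exprS /kap; move: (_ ^+ (n - d)) (z ^+ n) (ph d) => b c f.
by move: (z^* ) => a; ring.
Qed.

Let Dn n : Dterm A (n + N.+1) (geomvec n) (z ^+ n *: y) = e n + z ^+ n * be n.
Proof.
rewrite /Dterm big_split_ord /= addrA; congr (_ + _); last first.
  by rewrite /be mulr_sumr; apply: eq_bigr => m _; rewrite geomvec_ge -scalemxAr bilZr.
rewrite /e big_ord_recl /= subn0 -scalemxAr bilZl bilZr rmorphXn mulrA; congr (_ + _).
apply: eq_bigr => k _; rewrite geomvec_lt // -scalemxAr bilZl bilZr rmorphXn mulrA /bump /= add1n.
by congr (_ ^+ _ * _ * _); case: n k => [[]//|n] k /=; rewrite subSS.
Qed.

Let TFn n : TF t (n + N.+1) (geomvec n) =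
  TF t N.+1 X + (\sum_(l < n) e l + psum be z n) + (\sum_(l < n) e l + psum be z n)^*.
Proof.
elim: n => [|n IH]; first by rewrite /psum !big_ord0 !addr0 rmorph0 addr0.
rewrite addSn (TFS t0 tS) Dn IH !psumS big_ord_recr /= !rmorphD /=.
by move: (TF _ _ _) (\sum_(l < n) _) (psum _ _ _) => a b c; ring.
Qed.

(** The recurrence [eS] telescopes: multiplied by 1 - kap, the geometric part of the form is a
    partial sum of the series of [ph], up to e n, which tends to 0. *)
Let En n : (1 - kap) * \sum_(l < n) e l = psum ph z n.+1 - e n.
Proof.
have E1 m : \sum_(l < m.+1) e l = kap * \sum_(l < m) e l + psum ph z m.+1.
  elim: m => [|m IH].
    by rewrite big_ord_recl !big_ord0 /psum big_ord_recl big_ord0 /e big_ord_recl big_ord0 /= !expr0; ring.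
  rewrite big_ord_recr /= eS [psum _ _ m.+2]psumS {1}IH [in RHS]big_ord_recr /=.
  by move: (\sum_(l < m) _) (psum _ _ _) (e m) (z ^+ _ * _) => a1 a2 a3 a4; ring.
have := E1 n; rewrite big_ord_recr /= => E2.
move: (\sum_(l < n) _) (psum _ _ _) (e n) E2 => a b c E2.
have E3 : a = kap * a + b - c by rewrite -E2 addrK.
by rewrite mulrBl mul1r {1}E3; move: (kap * a) => u; ring.
Qed.

Hypothesis z1 : cabs z < 1.
Variables (F b : C) (B : R).
Hypothesis hF : sersum ph z F.
Hypothesis hb : sersum be z b.
Hypothesis phB : forall d, cabs (ph d) <= B.

Let e_small n : cabs (e n) <= B / (1 - cabs z) * cabs z ^+ n.
Proof.
have z0 := cabs_ge0 z.
have B0 : 0 <= B by apply: le_trans (phB 0%N); exact: cabs_ge0.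
apply: le_trans (cabs_sum _) _.
apply: le_trans (_ : _ <= \sum_(d < n.+1) cabs z ^+ n * B * cabs z ^+ (n - d)) _.
  apply: ler_sum => d _; rewrite !cabsM !cabsX cabs_conj mulrC mulrA [_ * B]mulrC -!mulrA.
  apply: ler_pM; rewrite ?cabs_ge0 ?mulr_ge0 ?exprn_ge0 //.
  by rewrite mulrC.
rewrite -mulr_sumr (reindex_inj rev_ord_inj) /=.
rewrite (eq_bigr (fun d : 'I_n.+1 => cabs z ^+ d)) => [|d _]; last by rewrite subSS subKn // -ltnS.
rewrite [leRHS]mulrC mulrA ler_wpM2l ?mulr_ge0 ?exprn_ge0 //.
by apply: geom_sum_le; rewrite z0.
Qed.

(** In the order of C, 0 <= v includes that v is real, so the imaginary part has to be shown to
    vanish as well. *)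
Lemma ge0_limit (v : C) : (forall d : R, 0 < d -> exists2 s : C, 0 <= s & cabs (v - s) <= d) -> 0 <= v.
Proof.
move=> h; have I0 : complex.Im v = 0.
  apply/eqP; rewrite -normr_le0; apply/ler_addgt0Pr => d /h [s s0 hs].
  rewrite add0r; apply: le_trans hs; apply: le_trans (cabs_Im _).
  by rewrite raddfB /= (ger0_Im s0) subr0.
have R0 : 0 <= complex.Re v.
  rewrite -oppr_le0; apply/ler_addgt0Pr => d /h [s s0 hs].
  have := cabs_Re (v - s); rewrite raddfB /= => h1.
  have h2 : 0 <= complex.Re s by move: s0; rewrite lecE => /andP[].
  by have := ler_norm (- (complex.Re v - complex.Re s)); rewrite normrN; lra.
by rewrite lecE /= I0 eqxx R0.
Qed.

Theorem fundamental_inequality :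
  0 <= (1 - kap) * TF t N.+1 X + (F + F^*) + (1 - kap) * (b + b^*).
Proof.
have kapR : kap^* = kap by rewrite /kap rmorphM /= conjCK mulrC.
have kapE : kap = real_complex R (cabs z ^+ 2) by rewrite sqr_cabs.
have z0 := cabs_ge0 z.
have k1 : 0 <= 1 - kap.
  by rewrite kapE -(rmorph1 (real_complex R)) -rmorphB ler0c subr_ge0 exprn_ile1 // ltW.
have ck : cabs (1 - kap) <= 1.
  rewrite kapE -(rmorph1 (real_complex R)) -rmorphB cabsR ger0_norm; last first.
    by rewrite subr_ge0 exprn_ile1 // ltW.
  by rewrite gerBl exprn_ge0.
apply: ge0_limit => d d0; have d6 : 0 < d / 6 by rewrite divr_gt0.
have [N1 h1] := hF d6; have [N2 h2] := hb d6.
have [N3 h3] := geom_small (B / (1 - cabs z)) (introT andP (conj z0 z1)) d6.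
(* n >= 1 brings the size n + N + 1 into the range of positivity. Three errors of at most d/6 are
   added, and the conjugate doubles their sum. *)
pose n := (maxn 1 (maxn N1 (maxn N2 N3)))%N.
have {}h1 : cabs (psum ph z n.+1 - F) <= d / 6 by apply: h1; rewrite leqW // !leq_max leqnn !orbT.
have {}h2 : cabs (psum be z n - b) <= d / 6 by apply: h2; rewrite !leq_max leqnn !orbT.
have {}h3 : cabs (e n) <= d / 6 
  by apply: le_trans (e_small n) (h3 _ _); rewrite !leq_max leqnn !orbT.
exists ((1 - kap) * TF t (n + N.+1) (geomvec n)).
  by rewrite mulr_ge0 // hTF // -[ltnLHS]add0n ltn_add2r leq_max.
have -> : (1 - kap) * TF t N.+1 X + (F + F^*) + (1 - kap) * (b + b^*) -
    (1 - kap) * TF t (n + N.+1) (geomvec n) =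
    (F - psum ph z n.+1 + e n + (1 - kap) * (b - psum be z n)) +
    (F - psum ph z n.+1 + e n + (1 - kap) * (b - psum be z n))^*.
  have EC : ((1 - kap) * \sum_(l < n) e l)^* = (psum ph z n.+1 - e n)^* by rewrite En.
  rewrite TFn; move: EC (En n); rewrite !rmorphD !rmorphM !rmorphN !rmorphD !rmorphN !rmorphM !rmorph1 /= conjCK.
  rewrite [z^* * z]mulrC -/kap.
  move: (TF _ _ _) (\sum_(l < n) e l) (\sum_(l < n) e l)^* (e n) (e n)^* => a b1 b2 b3 b4.
  move: (psum ph z n.+1) (psum ph z n.+1)^* (psum be z n) (psum be z n)^* => c1 c2 c3 c4 EC EN.
  rewrite !mulrDr EC EN; ring.
set v := F - _ + _ + _.
have hv : cabs v <= d / 2.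
  have g1 := cabsD (F - psum ph z n.+1 + e n) ((1 - kap) * (b - psum be z n)).
  have g2 := cabsD (F - psum ph z n.+1) (e n).
  have g3 : cabs ((1 - kap) * (b - psum be z n)) <= d / 6.
    rewrite cabsM cabsC in h2 *; rewrite -[leRHS]mul1r ler_pM ?cabs_ge0 //.
  rewrite cabsC in h1; rewrite -/v in g1; lra.
by apply: le_trans (cabsD _ _) _; rewrite cabs_conj; lra.
Qed.

End FundamentalInequality.

(** * Removable singularities *)

Section Removable.
Variable R : realType.
Local Notation C := (R[i]).

Lemma jet_local_series (D : C -> C) a (r : R) : 0 < r ->
  (forall z, cabs (z - a) < r -> jet D z) ->
  exists d r', 0 < r' /\ forall w, cabs w < r' -> sersum d w (D (a + w)).
Proof.
move=> r0 jD; have ja : jet D a by apply: jD; rewrite subrr cabs0.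
have [B [d [B0 d0 hB]]] := jet_bounded ja.
have [|||c hc] := @jet_taylor _ (fun w => D (a + w)) (Num.min r d) B.
- by rewrite lt_min r0.
- move=> w; rewrite lt_min => /andP[wr _]; apply: jet_shift.
  by apply: jD; rewrite addrC addKr.
- by move=> w; rewrite lt_min => /andP[_ /hB].
by exists c, (Num.min r d); split=> //; rewrite lt_min r0.
Qed.

(** The power series of [D] at [a] is not zero, since [D] does not vanish at nearby points other
    than [a]. Let m' be the index of its first nonzero coefficient. Dividing by (z - a)^m' leaves a
    function that is nonzero at [a], and |P| <= |D| allows the same division of [P]. *)
Lemma removable (P D : C -> C) a (r : R) : 0 < r ->
  (forall z, cabs (z - a) < r -> jet P z) -> (forall z, cabs (z - a) < r -> jet D z) ->
  (forall z, z != a -> cabs (z - a) < r -> D z != 0 /\ cabs (P z) <= cabs (D z)) ->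
  exists v, jet (fun z => if z == a then v else P z / D z) a.
Proof.
move=> r0 jP jD hPD; have [d [r' [r'0 hd]]] := jet_local_series r0 jD.
have aa : cabs (a - a) < r by rewrite subrr cabs0.
have [m dm0] : exists m, d m != 0.
  apply: contrapT => nd; pose x := Num.min (r / 2) (r' / 2).
  have x0 : 0 < x by rewrite lt_min !divr_gt0.
  have [x1 x2] : x <= r / 2 /\ x <= r' / 2 by rewrite /x !ge_min !lexx orbT.
  have xA : cabs (real_complex R x) = x by rewrite cabsR gtr0_norm.
  have [] := hPD (a + real_complex R x).
  - by rewrite -subr_eq0 addrC addKr -cabs_gt0 xA.
  - by rewrite addrC addKr xA; lra.
  have s1 : sersum d (real_complex R x) (D (a + real_complex R x)) by apply: hd; rewrite xA; lra.
  have -> : D (a + real_complex R x) = 0.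
    apply: (sersum_unique s1); apply: eq_sersum (sersum0 _) => k.
    by apply/eqP; rewrite eq_sym; apply/negPn/negP => dk; apply: nd; exists k.
  by rewrite eqxx.
pose m' := ex_minn (ex_intro (fun m => d m != 0) m dm0).
have [dm' mmin] : d m' != 0 /\ forall k, (k < m')%N -> d k = 0.
  rewrite /m'; case: ex_minnP => l dl lmin; split=> // k kl.
  by apply/eqP/negPn/negP => /lmin; rewrite leqNgt kl.
have [B [e [e0 hB]]] := sersum_small r'0 m' hd.
have {}hB w : cabs w < e -> cabs (D (a + w)) <= B * cabs w ^+ m'.
  move=> /hB; rewrite (_ : psum d w m' = 0) ?subr0 // /psum big1 // => k _.
  by rewrite mmin ?mulr0.
have [vD jD1] := @jet_quot _ D a m' B e (jD a aa) e0 (fun w _ => hB w).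
have [||vP jP1] := @jet_quot _ P a m' B (Num.min e r) (jP a aa).
- by rewrite lt_min e0 r0.
- move=> w w0; rewrite lt_min => /andP[we wr]; apply: le_trans (hB w we).
  by have [] := hPD (a + w); rewrite ?[a + w]addrC ?addrK // -subr_eq0 addrK.
(* If vD were 0, the quotient would be O(w) and D would be O(w^(m' + 1)), against the choice of
   m'. *)
have vD0 : vD != 0.
  apply/negP => /eqP vD0; have [L [e1 [L0 e10 hL]]] := jet_lip jD1.
  move/negP: dm'; apply; apply/eqP.
  apply: (sersum_coef_uniq (c' := fun=> 0) (n := m'.+1) r'0 hd) => //.
  have hD w : w != 0 -> cabs w < e1 -> cabs (D (a + w)) <= L * cabs w ^+ m'.+1.
    move=> w0 we1; have := hL w we1.
    rewrite eqxx vD0 subr0 [a + w]addrC addrK -subr_eq0 addrK (negPf w0).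
    by rewrite cabsM cabsV cabsX ler_pdivrMr ?exprn_gt0 ?cabs_gt0 // exprS mulrA; apply.
  exists L, (Num.min e e1); split; first by rewrite lt_min e0.
  move=> w; rewrite lt_min => /andP[we we1].
  rewrite (_ : psum _ w _ = 0) ?subr0; last by rewrite /psum big1 // => k _; rewrite mulr0.
  have [->|w0] := eqVneq w 0.
    rewrite addr0 cabs0 expr0n mulr0 (_ : D a = 0) ?cabs0 //.
    have [L1 [d1 [L10 d10 hL1]]] := jet_lip (jD a aa).
    apply: (@cabs_small_eq0 R _ (L + L1) (Num.min 1 (Num.min e1 d1))).
      by rewrite !lt_min ltr01 e10.
    move=> w' w'0; rewrite !lt_min => /and3P[w1 w2 w3].
    rewrite (_ : D a = D (a + w') - (D (a + w') - D a)); last by ring.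
    apply: le_trans (cabsB _ _) _; rewrite mulrDl lerD ?hL1 //.
    apply: le_trans (hD w' w'0 w2) _; rewrite ler_wpM2l // exprS ler_piMr ?cabs_ge0 //.
    by rewrite exprn_ile1 ?cabs_ge0 // ltW.
  exact: hD.
exists (vP / vD).
have jr := jet_div jP1 jD1; rewrite eqxx in jr.
apply: (@jet_near _ _ _ a r) (jr vD0) => // w wr.
have [->|w0] := eqVneq w 0; first by rewrite addr0 eqxx.
rewrite -subr_eq0 [a + w]addrC addrK (negPf w0).
by rewrite invf_div mulrA mulfVK // expf_neq0.
Qed.

(** Carries contractivity over to exceptional points, where it is known only in a punctured
    neighbourhood. *)
Lemma sqn_limit p (F : C -> 'cV[C]_p) a (B r : R) : mjet F a -> 0 < r ->
  (forall w, w != 0 -> cabs w < r -> sqn (F (a + w)) <= B) -> sqn (F a) <= B.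
Proof.
move=> jF r0 hB.
have /choice [Kd hK] : forall i, exists Kd : R * R, [/\ 0 <= Kd.1, 0 < Kd.2 &
    forall w, cabs w < Kd.2 -> cabs (F a i 0) ^+ 2 <= cabs (F (a + w) i 0) ^+ 2 + Kd.1 * cabs w].
  move=> i; have [L [d [L0 d0 hL]]] := jet_lip (jF i 0).
  have [M [d' [M0 d'0 hM]]] := jet_bounded (jF i 0).
  (* From the square of x + L |w| with x <= M; the radius 1 allows |w|^2 to be replaced by |w|. *)
  exists (2 * M * L + L ^+ 2, Num.min 1 (Num.min d d')); split=> /=.
  - by rewrite addr_ge0 ?mulr_ge0 ?sqr_ge0.
  - by rewrite !lt_min ltr01 d0.
  move=> w; rewrite !lt_min => /and3P[w1 /hL h1 /hM h2].
  have h3 : cabs (F a i 0) <= cabs (F (a + w) i 0) + L * cabs w.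
    by have := cabs_subr (F a i 0) (F (a + w) i 0); rewrite [cabs (_ - _)]cabsC; lra.
  have g0 := cabs_ge0 (F a i 0); have g1 := cabs_ge0 (F (a + w) i 0); have g2 := cabs_ge0 w.
  have : cabs (F a i 0) ^+ 2 <= (cabs (F (a + w) i 0) + L * cabs w) ^+ 2.
    by rewrite lerXn2r ?nnegrE ?addr_ge0 ?mulr_ge0.
  have h4 : cabs (F (a + w) i 0) * (L * cabs w) <= M * (L * cabs w) by rewrite ler_wpM2r ?mulr_ge0.
  have h5 : (L * cabs w) ^+ 2 <= L ^+ 2 * cabs w.
    by rewrite exprMn ler_wpM2l ?sqr_ge0 // expr2 ler_piMr // ltW.
  rewrite sqrrD mulrDl => h6; apply: le_trans h6 _.
  by rewrite mulr2n; lra.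
have [|d d0 hd] := @finite_min_radius R _ (fun i => (Kd i).2); first by move=> i; case: (hK i).
pose K := \sum_i (Kd i).1; have K0 : 0 <= K by apply: sumr_ge0 => i _; case: (hK i).
apply/ler_addgt0Pr => e e0.
pose x := Num.min (Num.min (d / 2) (r / 2)) (e / (K + 1)).
have x0 : 0 < x by rewrite !lt_min !divr_gt0 // ltr_wpDl.
have [[x1 x2] x3] : (x <= d / 2 /\ x <= r / 2) /\ x <= e / (K + 1).
  by rewrite /x !ge_min !lexx !orbT.
pose w := real_complex R x; have wA : cabs w = x by rewrite cabsR gtr0_norm.
have wB : sqn (F (a + w)) <= B by apply: hB; [rewrite -cabs_gt0 wA|rewrite wA; lra].
apply: le_trans (_ : _ <= sqn (F (a + w)) + K * x) _.
  rewrite /sqn /K mulr_suml -big_split /=; apply: ler_sum => i _.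
  by case: (hK i) => _ _ /(_ w); rewrite wA; apply; have := hd i; lra.
apply: lerD wB _; move: x3; rewrite ler_pdivlMr ?ltr_wpDl // mulrDr mulr1 mulrC; lra.
Qed.

(** The relation g (1 + f) = 1 - f is applied to the vector polynomial of [x] and read off
    coefficientwise; it concerns germs at 0, so [r] may be small. *)
Lemma cayley_conv p (f g : C -> 'M[C]_p) c gc (r : R) n (x : nat -> 'cV[C]_p) : 0 < r ->
  (forall z, cabs z < r -> pser_to c z (f z)) ->
  (forall z, cabs z < r -> pser_to gc z (g z)) ->
  (forall z, cabs z < r -> g z *m (1%:M + f z) = 1%:M - f z) ->
  forall k, (k < n)%N -> mconv n gc (fun j => x j + mconv n c x j) k = x k - mconv n c x k.
Proof.
move=> r0 hf hg gf k kn; apply/matrixP => i o; rewrite ord1 mconvE.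
(* [x] is cut off at n: the vector polynomial is then the sum of a power series and [cauchy_coef]
   applies. *)
pose xt j (l : 'I_p) : C := if (j < n)%N then x j l 0 else 0.
have hx z l : sersum (fun j => xt j l) z (polyvec n x z l 0).
  rewrite polyvecE => e e0; exists n => m nm.
  rewrite (_ : psum _ z m = psum (fun j => x j l 0) z n) ?subrr ?cabs0 ?ltW //.
  rewrite /psum (big_ord_widen m (fun j => z ^+ j * x j l 0) nm) [RHS]big_mkcond /=.
  by apply: eq_bigr => j _; rewrite /xt; case: ifP => // _; rewrite mulr0.
have E1 l : cconv n (fun k => gc k i l) (fun j => (x j + mconv n c x j) l 0) k =
    cconv n (fun k => gc k i l) (fun j => xt j l + mconv n c x j l 0) k.
  apply: eq_bigr => j _; case: ifP => // _; congr (_ * _).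
  by rewrite mxE /xt ltn_ord.
rewrite (eq_bigr _ (fun l _ => E1 l)).
rewrite (cauchy_coef r0 (n := n) (w := fun j => xt j i + -1 * mconv n c x j i 0)
  (G := fun l z => g z i l) (H := fun l z => polyvec n x z l 0 + (f z *m polyvec n x z) l 0)
  (W := fun z => polyvec n x z i 0 + -1 * (f z *m polyvec n x z) i 0)) //.
- by rewrite !mxE /xt kn mulN1r.
- by move=> l z zr; move/pser_toP : (hg z zr).
- by move=> l z zr; apply: sersumD; [exact: hx|apply: sersum_mconv; exact: hf].
- by move=> z zr; apply: sersumD; [exact: hx|apply: sersumZ; apply: sersum_mconv; exact: hf].
move=> z zr; have := congr1 (mulmx^~ (polyvec n x z)) (gf z zr).
rewrite -mulmxA mulmxDl mulmxBl !mul1mx => /matrixP /(_ i 0); rewrite mxE => E2.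
have -> : polyvec n x z i 0 + -1 * (f z *m polyvec n x z) i 0 =
    (polyvec n x z - f z *m polyvec n x z) i 0.
  by rewrite mulN1r [RHS]mxE; congr (_ + _); rewrite [RHS]mxE.
by rewrite -E2; apply: eq_bigr => l _; rewrite [in RHS]mxE.
Qed.

End Removable.

(** * The change of variable *)

Section Moebius.
Variable R : realType.
Local Notation C := (R[i]).

Definition lamz (z : C) : C := 'i * (z + 1) / (z - 1).
Definition zlam (l : C) : C := (l + 'i) / (l - 'i).

Lemma Ci_neq0 : ('i : C) != 0. Proof. exact: neq0Ci. Qed.

Lemma cabs_lt1_neq1 (z : C) : cabs z < 1 -> z != 1.
Proof. by apply: contraTneq => ->; rewrite cabs1 ltxx. Qed.

Lemma cayley_norm (l : C) : `|l + 'i| ^+ 2 - `|l - 'i| ^+ 2 = 4 * 'Im l.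
Proof.
rewrite !normCK rmorphD rmorphB /= conjCi.
have ii : 'i * 'i = -1 :> C by rewrite -expr2 sqrCi.
have -> : (l + 'i) * (l^* - 'i) - (l - 'i) * (l^* - - 'i) = 2 * ('i * (l^* - l)).
  by move: (l^* ) => lb; rewrite opprK; ring.
rewrite [in RHS]ImE; move: ('i * _) => x.
by field.
Qed.

Lemma lower_hpP (l : C) : lower_hp l <-> cabs (l + 'i) < cabs (l - 'i).
Proof.
have -> : lower_hp l <-> 4 * 'Im l < 0.
  by rewrite /lower_hp /= pmulr_rlt0 ?ltr0n.
rewrite -cayley_norm subr_lt0 ltr_pXn2r ?nnegrE ?normr_ge0 //.
by rewrite !normcR ltcR.
Qed.

Lemma lower_neq_i (l : C) : lower_hp l -> l - 'i != 0.
Proof.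
move=> /lower_hpP h; rewrite -cabs_gt0; apply: le_lt_trans h; exact: cabs_ge0.
Qed.

Lemma zlam_lt1 (l : C) : lower_hp l -> cabs (zlam l) < 1.
Proof.
move=> hl; have h0 := lower_neq_i hl; move/lower_hpP: hl => h.
by rewrite /zlam cabsM cabsV ltr_pdivrMr ?cabs_gt0 // mul1r.
Qed.

Lemma lamz_zlam (l : C) : l - 'i != 0 -> lamz (zlam l) = l.
Proof.
move=> h; rewrite /lamz /zlam.
field; rewrite h /= (_ : l + 'i + -1 * (l - 'i) = 2 * 'i); last by ring.
by rewrite mulf_neq0 ?Ci_neq0 ?pnatr_eq0.
Qed.

Lemma zlam_lamz (z : C) : z != 1 -> zlam (lamz z) = z.
Proof.
rewrite -subr_eq0 => h; rewrite /lamz /zlam.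
field; rewrite h /= (_ : 'i * (z + 1) + - 'i * (z - 1) = 2 * 'i); last by ring.
by rewrite mulf_neq0 ?Ci_neq0 ?pnatr_eq0.
Qed.

Lemma lamz_lower (z : C) : cabs z < 1 -> lower_hp (lamz z).
Proof.
move=> z1; have := cabs_lt1_neq1 z1; rewrite -subr_eq0 => h.
have e1 : lamz z + 'i = z * (2 * 'i / (z - 1)) by rewrite /lamz; field.
have e2 : lamz z - 'i = 2 * 'i / (z - 1) by rewrite /lamz; field.
apply/lower_hpP; rewrite e1 e2 cabsM -[ltRHS]mul1r ltr_pM2r // cabs_gt0.
by rewrite !mulf_neq0 ?invr_neq0 ?Ci_neq0 ?pnatr_eq0.
Qed.

Lemma lamz0 : lamz 0 = - 'i.
Proof. by rewrite /lamz add0r mulr1 sub0r invrN invr1 mulrN1. Qed.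

Lemma jet_lamz z : z != 1 -> jet lamz z.
Proof.
move=> z1; apply: jet_div.
- by apply: jetM; [exact: jet_cst|apply: jetD; [exact: jet_id|exact: jet_cst]].
- by apply: jetB; [exact: jet_id|exact: jet_cst].
- by rewrite subr_eq0.
Qed.

Lemma jet_zlam l : l - 'i != 0 -> jet zlam l.
Proof.
move=> l1; apply: jet_div => //.
- by apply: jetD; [exact: jet_id|exact: jet_cst].
- by apply: jetB; [exact: jet_id|exact: jet_cst].
Qed.

Lemma lamz_inj z w : z != 1 -> w != 1 -> lamz z = lamz w -> z = w.
Proof. by move=> z1 w1 h; rewrite -(zlam_lamz z1) h zlam_lamz. Qed.

Lemma jet_cvg (f : C -> C) a (e : R) : jet f a -> 0 < e ->
  exists2 d : R, 0 < d & forall z, cabs (z - a) < d -> cabs (f z - f a) < e.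
Proof.
move=> /jet_lip [L [d [L0 d0 hL]]] e0.
exists (Num.min d (e / (L + 1))); first by rewrite lt_min d0 divr_gt0 // ltr_wpDl.
move=> z; rewrite lt_min ltr_pdivlMr ?ltr_wpDl // => /andP[/hL].
rewrite [a + _]addrC subrK => h1 h2; apply: le_lt_trans h1 (le_lt_trans _ h2).
by rewrite mulrC ler_wpM2l ?cabs_ge0 // lerDl.
Qed.

End Moebius.

Section Admissible.
Variable R : realType.
Local Notation C := (R[i]).
Variable p : nat.

Lemma pser0 m n (c : nat -> 'M[C]_(m, n)) : pser_to c 0 (c 0%N).
Proof.
apply/pser_toP => i j e e0; exists 1%N => -[//|k] _.
by rewrite psumSl mul0r addr0 subrr cabs0 ltW.
Qed.

(** [meromorphic_on] gives an expansion at l0 only; analyticity of F at the nearby points, where the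
    pair is constrained, comes from dividing E by a power of l - l0. *)
Lemma meromorphic_punctured m n (F : C -> 'M[C]_(m, n)) (l0 : C) :
  meromorphic_on (@lower_hp R) F -> lower_hp l0 ->
  exists (k : nat) (E : C -> 'M[C]_(m, n)) (r : R), [/\ 0 < r,
    forall l, cabs (l - l0) < r -> mjet E l &
    forall l, l != l0 -> cabs (l - l0) < r ->
      E l = (l - l0) ^+ k *: F l /\ analytic_at F l].
Proof.
move=> mF hl; have [k [c [_ [/real_gt0 [r r0 ->] h]]]] := mF l0 hl.
pose E l := if l == l0 then c 0%N else (l - l0) ^+ k *: F l.
have aE : analytic_at E l0.
  exists c, (real_complex R r); split; first by rewrite ltcR.
  move=> l lr; rewrite /E; case: eqVneq => [->|ll]; first by rewrite subrr; exact: pser0.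
  by apply: h; rewrite normr_gt0 subr_eq0 ll.
have /analytic_atP [d d0 jE] := aE.
exists k, E, d; split=> // l ll ld; split; first by rewrite /E (negPf ll).
have l1 : 0 < cabs (l - l0) by rewrite cabs_gt0 subr_eq0.
apply/analytic_atP; exists (Num.min (cabs (l - l0)) (d - cabs (l - l0))).
  by rewrite lt_min l1 subr_gt0.
move=> l'; rewrite lt_min => /andP[h1 h2].
have ll' : l' - l0 != 0.
  apply: contraTneq h1 => e; rewrite -leNgt (_ : l' - l = (l' - l0) - (l - l0)); last by ring.
  by rewrite e sub0r cabsN.
have ld' : cabs (l' - l0) < d.
  by rewrite (_ : l' - l0 = (l' - l) + (l - l0)); [have := cabsD (l' - l) (l - l0); lra|ring].
have jx : jet (fun x => x - l0) l' by apply: jetB; [exact: jet_id|exact: jet_cst].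
have jv := jetV (jetX k jx) (expf_neq0 k ll').
apply: (@mjet_near _ _ _ _ _ _ (cabs (l' - l0))) (mjetZ jv (jE l' ld')); first by rewrite cabs_gt0.
move=> w wl; have wl' : l' + w - l0 != 0.
  apply: contraTneq wl => e; rewrite -leNgt -cabsN.
  by rewrite (_ : - (l' - l0) = w) // -[w](addKr (l' - l0)) addrAC e addr0.
rewrite /E -subr_eq0 (negPf wl') scalerA mulVf ?scale1r //.
by rewrite expf_neq0.
Qed.

End Admissible.

(** * From admissible pairs to extensions *)

Section Forward.
Variable R : realType.
Local Notation C := (R[i]).
Variables (p N : nat) (sm : nat -> 'M[C]_p) (a0 : 'M[C]_p).
Hypothesis ha0 : a0 + adjmx a0 = sm 0%N.
Hypothesis hS : pdmx (toeplitz N sm).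
Local Notation What := (What N sm a0).

Lemma mjet_col m1 m2 n (F : C -> 'M[C]_(m1, n)) (G : C -> 'M[C]_(m2, n)) a :
  mjet F a -> mjet G a -> mjet (fun z => col_mx (F z) (G z)) a.
Proof.
move=> jF jG i j; rewrite -(splitK i); case: (fintype.split i) => k /=.
  by apply: eq_jet (jF k j) => z; rewrite col_mxEu.
by apply: eq_jet (jG k j) => z; rewrite col_mxEd.
Qed.

Lemma mjet_usub m1 m2 n (F : C -> 'M[C]_(m1 + m2, n)) a : mjet F a -> mjet (fun z => usubmx (F z)) a.
Proof. by move=> jF i j; apply: eq_jet (jF (lshift _ i) j) => z; rewrite mxE. Qed.
Lemma mjet_dsub m1 m2 n (F : C -> 'M[C]_(m1 + m2, n)) a : mjet F a -> mjet (fun z => dsubmx (F z)) a.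
Proof. by move=> jF i j; apply: eq_jet (jF (rshift _ i) j) => z; rewrite mxE. Qed.

Lemma usubmxZ m1 m2 n s (M : 'M[C]_(m1 + m2, n)) : usubmx (s *: M) = s *: usubmx M.
Proof. by apply/matrixP => i j; rewrite !mxE. Qed.
Lemma dsubmxZ m1 m2 n s (M : 'M[C]_(m1 + m2, n)) : dsubmx (s *: M) = s *: dsubmx M.
Proof. by apply/matrixP => i j; rewrite !mxE. Qed.

Lemma mjet_pencil z : mjet (fun z => 1%:M - z *: @Umx C p N) z.
Proof. by apply: mjetB; [exact: mjet_cst|apply: mjetZ; [exact: jet_id|exact: mjet_cst]]. Qed.

Lemma mjet_What z : mjet What z.
Proof.
apply: mjetB; first exact: mjet_cst.
apply: mjetZ; first by apply: jetB; [exact: jet_cst|exact: jet_id].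
do 3![apply: mjetM; last exact: mjet_cst].
apply: mjetM; first exact: mjet_cst.
by apply: mjet_inv; [exact: mjet_pencil|exact: U_unit].
Qed.

Lemma disc_gap (z : C) : cabs z < 1 -> 0 < 1 - z * z^*.
Proof.
move=> z1; rewrite -sqr_cabs -(rmorph1 (real_complex R)) -rmorphB ltcR subr_gt0.
by rewrite expr_lt1 ?cabs_ge0.
Qed.

Lemma contraction_entry (V : 'M[C]_p) i j : (forall v, sqn (V *m v) <= sqn v) -> cabs (V i j) <= 1.
Proof.
move=> /(_ (delta_mx j 0)); rewrite -colE.
have -> : sqn (delta_mx j 0 : 'cV[C]_p) = 1.
  rewrite /sqn (bigD1 j) //= big1 ?addr0 => [|l lj]; first by rewrite mxE !eqxx cabs1 expr1n.
  by rewrite mxE (negPf lj) cabs0 expr0n.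
rewrite /sqn (bigD1 i) //= mxE => h.
have : 0 <= \sum_(l < p | l != i) cabs (col j V l 0) ^+ 2.
  by apply: sumr_ge0 => l _; exact: sqr_ge0.
by move=> h0; rewrite -(@expr_le1 _ 2) ?cabs_ge0 //; lra.
Qed.

Section Pair.
Variables A B : C -> 'M[C]_p.

Definition hpair z := Kmx R p *m col_mx (A (lamz z)) (B (lamz z)).
Definition Xp z := usubmx (What z *m hpair z).
Definition Yp z := dsubmx (What z *m hpair z).

Lemma iphi_discE z : cabs z < 1 -> Xp z \in unitmx ->
  iphi_disc N sm a0 A B z = - (Yp z *m invmx (Xp z)).
Proof.
move=> z1 uX; have nz1 := cabs_lt1_neq1 z1.
rewrite /iphi_disc /phi -/(lamz z); set W := Wmx N sm a0 (lamz z).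
pose s := ((lamz z - 'i) / lamz z) ^+ N.+1.
have WE : W = s *: (What z *m Kmx R p) by exact: WmxE.
(* The factor degenerates only at l = i and l = 0, neither of which lies in the lower half-plane. *)
have s0 : s != 0.
  have hl := lamz_lower z1; rewrite expf_neq0 // mulf_neq0 ?lower_neq_i //.
  by rewrite invr_neq0 //; apply: contraTneq hl => ->; rewrite /lower_hp /= raddf0 ltxx.
have WAB : W *m col_mx (A (lamz z)) (B (lamz z)) = s *: col_mx (Xp z) (Yp z).
  by rewrite WE -scalemxAl -mulmxA vsubmxK.
have : W *m col_mx (A (lamz z)) (B (lamz z)) =
  col_mx (ulsubmx W *m A (lamz z) + ursubmx W *m B (lamz z))
         (dlsubmx W *m A (lamz z) + drsubmx W *m B (lamz z)).
  by rewrite -{1}[W]submxK mul_block_col.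
rewrite WAB scale_col_mx => /eq_col_mx [<- <-].
have -> : invmx (s *: Xp z) = s^-1 *: invmx (Xp z).
  by apply: invmx_right; rewrite -scalemxAl -scalemxAr scalerA mulmxV // divff // scale1r.
rewrite -scalemxAl -scalemxAr !scalerA.
have ii : 'i * 'i = -1 :> C by rewrite -expr2 sqrCi.
by rewrite ii mulN1r mulNr divff // scaleN1r.
Qed.

Hypothesis adm : admissible_pair A B.

(** The points of the disc where the inequalities of [admissible_pair] are available. *)
Definition good z := analytic_at A (lamz z) /\ analytic_at B (lamz z).

Lemma good0 : good 0.
Proof. by case: adm => _ _ hA hB _; rewrite /good lamz0. Qed.

Section Good.
Variable z : C.
Hypothesis z1 : cabs z < 1.
Hypothesis gz : good z.

Let pos := let: And5 _ _ _ _ h := adm in h _ (lamz_lower z1) gz.1 gz.2.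

Lemma Xp_unit : Xp z \in unitmx.
Proof. exact: (X_unit ha0 hS (disc_gap z1) pos.2 pos.1). Qed.

Lemma XYp_unit : Xp z - Yp z \in unitmx.
Proof. exact: (XY_unit ha0 hS (disc_gap z1) pos.2 pos.1). Qed.

Lemma XYp_contractive v :
  vform (adjmx (Xp z + Yp z) *m (Xp z + Yp z)) v <= vform (adjmx (Xp z - Yp z) *m (Xp z - Yp z)) v.
Proof. exact: (cayley_contractive ha0 hS (disc_gap z1) pos.2). Qed.

Lemma mjet_hpair : mjet hpair z.
Proof.
apply: mjetM; first exact: mjet_cst.
have jl := jet_lamz (cabs_lt1_neq1 z1).
by apply: mjet_col; apply: mjet_comp => //; apply: analytic_mjet; case: gz.
Qed.

Lemma mjet_Xp : mjet Xp z.
Proof. by apply: mjet_usub; apply: mjetM; [exact: mjet_What|exact: mjet_hpair]. Qed.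
Lemma mjet_Yp : mjet Yp z.
Proof. by apply: mjet_dsub; apply: mjetM; [exact: mjet_What|exact: mjet_hpair]. Qed.

End Good.

Definition Vp z := (Xp z + Yp z) *m invmx (Xp z - Yp z).

Lemma mjet_Vp z : cabs z < 1 -> good z -> mjet Vp z.
Proof.
move=> z1 gz; have jX := mjet_Xp z1 gz; have jY := mjet_Yp z1 gz.
by apply: mjetM; [exact: mjetD|apply: mjet_inv; [exact: mjetB|exact: XYp_unit]].
Qed.

Lemma Vp_contractive z v : cabs z < 1 -> good z -> sqn (Vp z *m v) <= sqn v.
Proof.
move=> z1 gz; have := XYp_contractive z1 gz (invmx (Xp z - Yp z) *m v).
rewrite !vform_gram !mulmxA.
rewrite mulmxV ?XYp_unit // mul1mx -/(Vp z) /vform !mulmx1 -!/(bil _ _) !bil_sqn.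
by rewrite lecR.
Qed.

Lemma good_near z : cabs z < 1 -> good z ->
  exists2 r : R, 0 < r & forall w, cabs (w - z) < r -> cabs w < 1 /\ good w.
Proof.
move=> z1 [gA gB]; have [dA dA0 hA] := analytic_near gA; have [dB dB0 hB] := analytic_near gB.
have jl := jet_lamz (cabs_lt1_neq1 z1).
have [e1 e10 h1] := jet_cvg jl dA0; have [e2 e20 h2] := jet_cvg jl dB0.
exists (Num.min (1 - cabs z) (Num.min e1 e2)); first by rewrite !lt_min subr_gt0 z1 e10.
move=> w; rewrite !lt_min => /and3P[w1 /h1 /hA gA' /h2 /hB gB']; split; last by [].
by have := cabsD (w - z) z; rewrite subrK; lra.
Qed.

(** Exceptional points are isolated, and near each of them one scalar factor clears the poles of
    both functions; such a factor cancels in [Vp]. *)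
Lemma good_punctured z0 : cabs z0 < 1 -> exists (r : R) (k : nat) (H : C -> 'M[C]_(p + p, p)),
  [/\ 0 < r, forall z, cabs (z - z0) < r -> mjet H z &
   forall z, z != z0 -> cabs (z - z0) < r -> [/\ cabs z < 1, good z &
     H z = (lamz z - lamz z0) ^+ k *: (What z *m hpair z)]].
Proof.
move=> z01; have [mA mB _ _ _] := adm; have l0 := lamz_lower z01.
have [kA [EA [rA [rA0 jA hA]]]] := meromorphic_punctured mA l0.
have [kB [EB [rB [rB0 jB hB]]]] := meromorphic_punctured mB l0.
have jl := jet_lamz (cabs_lt1_neq1 z01).
have [e1 e10 h1] := jet_cvg jl rA0; have [e2 e20 h2] := jet_cvg jl rB0.
pose r := Num.min (1 - cabs z0) (Num.min e1 e2).
have r1 z : cabs (z - z0) < r -> [/\ cabs z < 1, cabs (lamz z - lamz z0) < rA & cabs (lamz z - lamz z0) < rB].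
  rewrite !lt_min => /and3P[w1 /h1 ? /h2 ?]; split=> //.
  by have := cabsD (z - z0) z0; rewrite subrK; lra.
(* Each function receives the power that clears the other, so that both carry the exponent kA +
   kB. *)
exists r, (kA + kB)%N, (fun z => What z *m (Kmx R p *m col_mx ((lamz z - lamz z0) ^+ kB *: EA (lamz z))
   ((lamz z - lamz z0) ^+ kA *: EB (lamz z)))); split.
- by rewrite !lt_min subr_gt0 z01 e10.
- move=> z /r1 [z1 zA zB]; have jz := jet_lamz (cabs_lt1_neq1 z1).
  have jd k : jet (fun z => (lamz z - lamz z0) ^+ k) z.
    by apply: jetX; apply: jetB => //; exact: jet_cst.
  apply: mjetM; first exact: mjet_What.
  apply: mjetM; first exact: mjet_cst.
  apply: mjet_col; apply: mjetZ => //; apply: mjet_comp => //; [exact: jA|exact: jB].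
move=> z zz0 /r1 [z1 zA zB].
have ll : lamz z != lamz z0.
  by apply: contra zz0 => /eqP /lamz_inj ->; rewrite ?cabs_lt1_neq1.
have [eA aA] := hA _ ll zA; have [eB aB] := hB _ ll zB.
split=> //; rewrite eA eB !scalerA -!exprD [(kB + kA)%N]addnC -scale_col_mx.
by rewrite -!scalemxAr.
Qed.

(** Entry by entry, V is a quotient of P times the adjugate of D by det D, with analytic numerator
    and denominator; the entries of a contraction have modulus at most 1, which is the bound that
    [removable] asks for. *)
Lemma Vp_removable z0 : cabs z0 < 1 -> exists v : 'M[C]_p,
  mjet (fun z => if z == z0 then v else Vp z) z0.
Proof.
move=> z01; have [r [k [H [r0 jH hH]]]] := good_punctured z01.
pose P z := usubmx (H z) + dsubmx (H z); pose D z := usubmx (H z) - dsubmx (H z).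
have jP z : cabs (z - z0) < r -> mjet P z.
  by move=> /jH jh; apply: mjetD; [exact: mjet_usub|exact: mjet_dsub].
have jD z : cabs (z - z0) < r -> mjet D z.
  by move=> /jH jh; apply: mjetB; [exact: mjet_usub|exact: mjet_dsub].
pose Q z := P z *m \adj (D z).
have key z : z != z0 -> cabs (z - z0) < r -> \det (D z) != 0 /\ forall i j, Q z i j / \det (D z) = Vp z i j.
  move=> zz0 zr; have [z1 gz hz] := hH z zz0 zr.
  have s0 : (lamz z - lamz z0) ^+ k != 0.
    rewrite expf_neq0 // subr_eq0; apply: contra zz0 => /eqP /lamz_inj ->; rewrite ?cabs_lt1_neq1 //.
  set s := (_ ^+ k) in hz s0.
  have DE : D z = s *: (Xp z - Yp z) by rewrite /D hz usubmxZ dsubmxZ -scalerBr.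
  have PE : P z = s *: (Xp z + Yp z) by rewrite /P hz usubmxZ dsubmxZ -scalerDr.
  have uXY := XYp_unit z1 gz.
  have uD : D z \in unitmx by rewrite DE unitmxZ // unitfE.
  split; first by move: uD; rewrite unitmxE unitfE.
  move=> i j; have -> : Vp z = P z *m invmx (D z).
    rewrite /Vp PE DE (_ : invmx (s *: _) = s^-1 *: invmx (Xp z - Yp z)); last first.
      by apply: invmx_right; rewrite -scalemxAl -scalemxAr scalerA mulmxV // divff // scale1r.
    by rewrite -scalemxAl -scalemxAr scalerA divff // scale1r.
  by rewrite /invmx uD -scalemxAr [in RHS]mxE mulrC.
have ent z i j : z != z0 -> cabs (z - z0) < r -> cabs (Vp z i j) <= 1.
  move=> zz0 zr; have [z1 gz _] := hH z zz0 zr.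
  by apply: contraction_entry => v; exact: Vp_contractive.
have /choice [v hv] : forall ij : 'I_p * 'I_p, exists v,
    jet (fun z => if z == z0 then v else Q z ij.1 ij.2 / \det (D z)) z0.
  move=> [i j]; apply: (removable (P := fun z => Q z i j) (D := fun z => \det (D z)) r0).
  - move=> z zr; have jQ : mjet Q z by apply: mjetM; [exact: jP|apply: mjet_adj; exact: jD].
    exact: jQ.
  - by move=> z zr; apply: jet_det; exact: jD.
  move=> z zz0 zr; have [d0 hq] := key z zz0 zr; split=> //.
  have := ent z i j zz0 zr; rewrite -hq cabsM cabsV ler_pdivrMr ?mul1r //.
  by rewrite cabs_gt0.
exists (\matrix_(i, j) v (i, j)) => i j.
apply: jet_near r0 _ (hv (i, j)) => w wr; rewrite /=.
case: eqVneq => [_|wz]; first by rewrite mxE.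
have wr' : cabs (z0 + w - z0) < r by rewrite [z0 + w]addrC addrK.
by have [_ ->] := key _ wz wr'.
Qed.

Lemma Vp_series : exists gc : nat -> 'M[C]_p, exists Vt : C -> 'M[C]_p,
  [/\ forall z, cabs z < 1 -> pser_to gc z (Vt z),
      forall z v, cabs z < 1 -> sqn (Vt z *m v) <= sqn v &
      forall z, cabs z < 1 -> good z -> Vt z = Vp z].
Proof.
have /choice [v hv] : forall z0, exists v : 'M[C]_p, cabs z0 < 1 ->
    mjet (fun z => if z == z0 then v else Vp z) z0.
  move=> z0; have [h|_] := ltP (cabs z0) 1; last by exists 0.
  by have [v hv] := Vp_removable h; exists v.
(* At points that are not good, [Vp] is replaced by the value that removes the singularity. *)
pose Vt z := if pselect (good z) then Vp z else v z.
have Vtg z : good z -> Vt z = Vp z by rewrite /Vt; case: pselect.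
have jV z : cabs z < 1 -> mjet Vt z.
  move=> z1; have [gz|ngz] := pselect (good z).
    have [r r0 hr] := good_near z1 gz.
    apply: mjet_near r0 _ (mjet_Vp z1 gz) => w wr; apply: Vtg.
    have wr' : cabs (z + w - z) < r by rewrite [z + w]addrC addrK.
    by have [] := hr _ wr'.
  have [r [k [H [r0 _ hH]]]] := good_punctured z1.
  apply: mjet_near r0 _ (hv z z1) => w wr.
  case: eqVneq => [->|wz]; first by rewrite /Vt; case: pselect.
  have wr' : cabs (z + w - z) < r by rewrite [z + w]addrC addrK.
  by apply: Vtg; have [] := hH _ wz wr'.
have cV z u : cabs z < 1 -> sqn (Vt z *m u) <= sqn u.
  move=> z1; have [r [k [H [r0 _ hH]]]] := good_punctured z1.
  apply: (@sqn_limit _ _ (fun z => Vt z *m u) z _ r) => //.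
    by apply: mjetM; [exact: jV|exact: mjet_cst].
  move=> w w0 wr; have wz : z + w != z by rewrite -subr_eq0 [z + w]addrC addrK.
  have wr' : cabs (z + w - z) < r by rewrite [z + w]addrC addrK.
  by have [z1' gz _] := hH _ wz wr'; rewrite Vtg //; exact: Vp_contractive.
have [|||gc hgc] := @mjet_taylor _ _ _ Vt 1 1 => //.
  by move=> z z1 i j; apply: contraction_entry => u; exact: cV.
by exists gc, Vt; split=> // z _; exact: Vtg.
Qed.

End Pair.
End Forward.

Section ForwardTheorem.
Variable R : realType.
Local Notation C := (R[i]).
Variables (p N : nat) (sm : nat -> 'M[C]_p) (a0 : 'M[C]_p).
Hypothesis ha0 : a0 + adjmx a0 = sm 0%N.
Hypothesis hS : pdmx (toeplitz N sm).

Lemma pser_at0 m n (c : nat -> 'M[C]_(m, n)) F : pser_to c 0 F -> F = c 0%N.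
Proof.
move=> h; apply/matrixP => i j; have /pser_toP h0 := @pser0 R m n c.
by move/pser_toP : h => h; apply: sersum_unique (h i j) (h0 i j).
Qed.

Lemma cayley_quotient (X Y : 'M[C]_p) : X \in unitmx -> X - Y \in unitmx ->
  (X + Y) *m invmx (X - Y) *m (1%:M + - (Y *m invmx X)) = 1%:M - - (Y *m invmx X).
Proof.
move=> uX uXY; have -> : 1%:M + - (Y *m invmx X) = (X - Y) *m invmx X by rewrite mulmxBl mulmxV.
by rewrite mulmxA mulmxKV // mulmxDl mulmxV // opprK.
Qed.

Lemma admissible_forward (A B : C -> 'M[C]_p) : admissible_pair A B ->
  'i *: phi N sm a0 A B (- 'i) = a0 /\
  exists c : nat -> 'M[C]_p,
   [/\ taylor_at0 (iphi_disc N sm a0 A B) c,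
       (forall k, (0 < k <= N)%N -> c k = sm k) &
       (forall M, (N < M)%N ->
         psdmx (toeplitz M (fun k => if (k <= N)%N then sm k else c k)))].
Proof.
move=> adm; pose X := Xp N sm a0 A B; pose Y := Yp N sm a0 A B.
have g0 := good0 adm; have c01 : cabs (0 : C) < 1 by rewrite cabs0.
have [r0 r00 hr0] := good_near c01 g0.
pose F z := - (Y z *m invmx (X z)).
have hgood z : cabs z < r0 -> [/\ cabs z < 1, good A B z, X z \in unitmx & X z - Y z \in unitmx].
  move=> zr; have [|z1 gz] := hr0 z; first by rewrite subr0.
  by split=> //; [apply: (Xp_unit ha0 hS adm z1 gz)|apply: (XYp_unit ha0 hS adm z1 gz)].
have jF z : cabs z < r0 -> mjet F z.
  move=> /hgood [z1 gz uX _].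
  have jXY : mjet (fun z => Y z *m invmx (X z)) z.
    by apply: mjetM; [exact: mjet_Yp|apply: mjet_inv => //; exact: mjet_Xp].
  by apply: eq_mjet (mjetB (mjet_cst 0 z) jXY) => w; rewrite sub0r.
have [B0 [r1 [B00 r10 hB0]]] : exists (B0 r1 : R), [/\ 0 <= B0, 0 < r1 &
    forall w, cabs w < r1 -> forall i j, cabs (F w i j) <= B0].
  have jF0 : mjet F 0 by apply: jF; rewrite cabs0.
  have [B0 [r1 [B00 r10 h]]] := mjet_local_bounded jF0.
  exists B0, r1; split; [exact: B00|exact: r10|move=> w wr i j].
  by have := h w wr i j; rewrite add0r.
pose r := Num.min r0 r1; have rp : 0 < r by rewrite lt_min r00.
have [|||c hc] := @mjet_taylor _ _ _ F r B0 => //.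
- by move=> z; rewrite lt_min => /andP[zr _]; exact: jF.
- by move=> z; rewrite lt_min => /andP[_ zr]; exact: hB0.
have fF z : cabs z < r -> iphi_disc N sm a0 A B z = F z.
  by rewrite lt_min => /andP[/hgood [z1 gz uX _] _]; exact: iphi_discE.
have ca k : (k < N.+1)%N -> c k = alph sm a0 k.
  move=> kN; apply/matrixP => i j.
  apply: (sersum_coef_uniq (c := fun k => c k i j) (c' := fun k => alph sm a0 k i j)
    (f := fun z => F z i j) rp _ _ kN).
    by move=> z zr; move/pser_toP : (hc z zr).
  pose eN : 'M[C]_(p, \sum_(k < N.+1) p) := brow N (fun k => if k == N then 1%:M else 0).
  (* The bracket in [interpolation]: F minus the prescribed polynomial is -z^(N+1) G X^-1, and G
     X^-1 is bounded near 0. *)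
  pose G z := eN *m Pimx N sm a0 *m Jmx R p *m hpair A B z -
    (1 - z) *: (eN *m toeplitz N sm *m @Umx C p N *m tstate N sm a0 z (hpair A B z)).
  have jh : mjet (hpair A B) 0 := mjet_hpair c01 g0.
  have jG : mjet (fun z => G z *m invmx (X z)) 0.
    apply: mjetM; last by apply: mjet_inv; [exact: mjet_Xp|case: (hgood 0) => //; rewrite cabs0].
    apply: mjetB; first by apply: mjetM; [exact: mjet_cst|].
    apply: mjetZ; first by apply: jetB; [exact: jet_cst|exact: jet_id].
    apply: mjetM; first exact: mjet_cst.
    apply: mjetM; last exact: jh.
    do 3![apply: mjetM; last exact: mjet_cst].
    by apply: mjet_inv; [exact: mjet_pencil|exact: U_unit].
  have [K [d [K0 d0 hK]]] := mjet_local_bounded jG.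
  exists K, (Num.min d r); split; first by rewrite lt_min d0.
  move=> z; rewrite lt_min => /andP[zd]; rewrite lt_min => /andP[/hgood [z1 gz uX _] _].
  have -> : F z i j - psum (fun k => alph sm a0 k i j) z N.+1 =
      (- z ^+ N.+1) * (G z *m invmx (X z)) i j.
    have -> : psum (fun k => alph sm a0 k i j) z N.+1 = alpoly N sm a0 z i j.
      by rewrite /psum /alpoly summxE; apply: eq_bigr => l _; rewrite mxE.
    have E : F z - alpoly N sm a0 z = (- z ^+ N.+1) *: (G z *m invmx (X z)).
      rewrite scaleNr scalemxAl /G -(interpolation ha0 hS) -/(Xp N sm a0 A B z) -/(Yp N sm a0 A B z).
      by rewrite mulmxDl mulmxK // opprD addrC.
    have -> : F z i j - alpoly N sm a0 z i j = (F z - alpoly N sm a0 z) i j.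
      by rewrite [RHS]mxE; congr (_ + _); rewrite [RHS]mxE.
    by rewrite E [LHS]mxE.
  rewrite cabsM cabsN cabsX mulrC ler_wpM2r ?exprn_ge0 ?cabs_ge0 //.
  by have := hK z zd i j; rewrite add0r.
have c0 : c 0%N = a0 by rewrite ca.
split.
  have := fF 0; rewrite cabs0 => /(_ rp); rewrite /iphi_disc -/(lamz 0) lamz0 => ->.
  by rewrite -c0; apply: pser_at0; apply: hc; rewrite cabs0.
exists c; split.
- exists (real_complex R r); split; first by rewrite ltcR.
  by move=> z; rewrite ltcabs => zr; rewrite fF //; exact: hc.
- by move=> k /andP[k0 kN]; rewrite ca ?ltnS // /alph gtn_eqF.
move=> M NM; pose t k := if (k <= N)%N then sm k else c k; rewrite -/(toeplitz M t).
have t0 : t 0%N = c 0%N + adjmx (c 0%N) by rewrite /t /= c0 ha0.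
have tS k : t k.+1 = c k.+1.
  by rewrite /t; case: ifP => // kN; rewrite ca.
apply/psd_TF => x; have [gc [Vt [hVt cVt eVt]]] := Vp_series ha0 hS adm.
have hVt' z : cabs z < r -> pser_to gc z (Vt z).
  by rewrite lt_min => /andP[/hgood [z1 _ _ _] _]; exact: hVt.
have hgf z : cabs z < r -> Vt z *m (1%:M + F z) = 1%:M - F z.
  rewrite lt_min => /andP[/hgood [z1 gz uX uXY] _].
  by rewrite eVt //; exact: cayley_quotient.
have hcc := @cayley_conv R p F Vt c gc r M.+1 x rp hc hVt' hgf.
exact: (TF_cayley t0 tS hcc (causal_contraction M.+1 _ hVt cVt)).
Qed.

End ForwardTheorem.

(** * From extensions to admissible pairs *)

Section BackwardTheorem.
Variable R : realType.
Local Notation C := (R[i]).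

Lemma pser_exists m n (c : nat -> 'M[C]_(m, n)) (B : R) z :
  (forall k i j, cabs (c k i j) <= B) -> cabs z < 1 -> exists F, pser_to c z F.
Proof.
move=> hB z1; have /choice [s hs] : forall ij : 'I_m * 'I_n, exists s, sersum (fun k => c k ij.1 ij.2) z s.
  move=> [i j]; apply: (@sersum_exists _ _ _ B (cabs z)); first by rewrite cabs_ge0.
  by move=> k; rewrite mulrC ler_wpM2r ?exprn_ge0 ?cabs_ge0.
exists (\matrix_(i, j) s (i, j)); apply/pser_toP => i j.
by rewrite mxE; exact: (hs (i, j)).
Qed.

Lemma bil_expand p (u v : 'cV[C]_p) (M : 'M[C]_p) :
  bil u (M *m v) = \sum_(i < p) \sum_(j < p) (u i 0)^* * v j 0 * M i j.
Proof.
rewrite /bil mxE; apply: eq_bigr => i _; rewrite !mxE mulr_sumr.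
by apply: eq_bigr => j _; rewrite [M i j * _]mulrC mulrA.
Qed.

Lemma sersum_bil p (u v : 'cV[C]_p) (c : nat -> 'M[C]_p) z F :
  pser_to c z F -> sersum (fun k => bil u (c k *m v)) z (bil u (F *m v)).
Proof.
move=> /pser_toP h; rewrite bil_expand.
apply: (@eq_sersum _ (fun k => \sum_(i < p) \sum_(j < p) (u i 0)^* * v j 0 * c k i j)).
  by move=> k; rewrite bil_expand.
by apply: sersum_sum => i; apply: sersum_sum => j; apply: sersumZ.
Qed.

Lemma bil_bound p (u v : 'cV[C]_p) (B : R) : exists B' : R, forall M : 'M[C]_p,
  (forall i j, cabs (M i j) <= B) -> cabs (bil u (M *m v)) <= B'.
Proof.
exists (\sum_(i < p) \sum_(j < p) cabs ((u i 0)^* * v j 0) * B) => M hM; rewrite bil_expand.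
apply: le_trans (cabs_sum _) (ler_sum _ _) => i _.
apply: le_trans (cabs_sum _) (ler_sum _ _) => j _.
by rewrite [leLHS]cabsM ler_wpM2l ?cabs_ge0.
Qed.

Variables (p N : nat) (sm : nat -> 'M[C]_p) (a0 : 'M[C]_p).
Hypothesis ha0 : a0 + adjmx a0 = sm 0%N.
Hypothesis hS : pdmx (toeplitz N sm).
Variable ext : nat -> 'M[C]_p.
Let t k := if (k <= N)%N then sm k else ext k.
Hypothesis hext : forall M, (N < M)%N -> psdmx (toeplitz M t).
Let A := alph t a0.
Local Notation S := (toeplitz N sm).
Local Notation L := (@Lmx C p N).
Local Notation Pi := (Pimx N sm a0).
Local Notation kap := ((sqrtC (2 : C))^-1).

Let t0 : t 0%N = A 0%N + adjmx (A 0%N).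
Proof. by rewrite /t /A /alph /= ha0. Qed.
Let tS k : t k.+1 = A k.+1.
Proof. by []. Qed.
Let hTF n x : (N.+1 < n)%N -> 0 <= TF t n x.
Proof. by case: n => // M /hext /psd_TF; apply. Qed.
Let AE k : (k < N.+1)%N -> A k = alph sm a0 k.
Proof. by rewrite ltnS /A /alph /t => ->. Qed.
Let toeplitz_t : toeplitz N t = S.
Proof.
apply: eq_mxblock => i j; rewrite /toep_blk /t.
by rewrite !(leq_trans (leq_subr _ _)) // -ltnS.
Qed.

(** [coef_bound] involves only the diagonal of [t 0], whence a bound uniform in k and convergence on
    the whole disc. It concerns k >= 1, so the entries of a0 are added. *)
Let A_bound : exists B : R, forall k i j, cabs (A k i j) <= B.
Proof.
exists (\sum_(i < p) \sum_(j < p) cabs (a0 i j) +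
  (\sum_(i < p) cabs (t 0%N i i) + \sum_(i < p) cabs (t 0%N i i))).
have le1 (f : 'I_p -> R) i : (forall i, 0 <= f i) -> f i <= \sum_(i < p) f i.
  by move=> f0; rewrite (bigD1 i) //= lerDl sumr_ge0.
have c0 i j : 0 <= cabs (a0 i j) by exact: cabs_ge0.
have d0 i : 0 <= cabs (t 0%N i i) by exact: cabs_ge0.
have s0 i : 0 <= \sum_(j < p) cabs (a0 i j) by exact: sumr_ge0.
have h1 i := le1 _ i d0.
case=> [|k] i j.
  have h2 := le1 _ i s0; have h3 := le1 _ j (c0 i).
  have h4 : 0 <= \sum_(i < p) cabs (t 0%N i i) by exact: sumr_ge0.
  by rewrite /A /alph eqxx; lra.
have h2 : 0 <= \sum_(i < p) \sum_(j < p) cabs (a0 i j) by exact: sumr_ge0.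
by have := coef_bound t0 tS hTF k i j; have := h1 i; have := h1 j; lra.
Qed.

(** [Q m] is the tail of order m + 1 of [f], given as a series and not as a quotient by z^(m+1), so
    that it is defined at z = 0 too. *)
Let series : exists (f : C -> 'M[C]_p) (Q : nat -> C -> 'M[C]_p), forall z, cabs z < 1 ->
  pser_to A z (f z) /\ forall m, pser_to (fun l => A (l + m).+1) z (Q m z).
Proof.
have [B hB] := A_bound.
have /choice [f hf] : forall z, exists F, cabs z < 1 -> pser_to A z F.
  move=> z; have [z1|_] := ltP (cabs z) 1; last by exists 0.
  by have [F hF] := pser_exists hB z1; exists F.
have /choice [Q hQ] : forall mz : nat * C, exists F, cabs mz.2 < 1 -> pser_to (fun l => A (l + mz.1).+1) mz.2 F.
  move=> [m z]; have [/= z1|_] := ltP (cabs z) 1; last by exists 0.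
  have [F hF] := pser_exists (fun k => hB (k + m).+1) z1.
  by exists F.
by exists f, (fun m z => Q (m, z)) => z z1; split=> [|m]; [exact: hf|exact: (hQ (m, z))].
Qed.

Lemma eq_pser m n (c d : nat -> 'M[C]_(m, n)) z F : c =1 d -> pser_to c z F -> pser_to d z F.
Proof. by move=> /funext ->. Qed.

Lemma pser_shift m n (c : nat -> 'M[C]_(m, n)) z F G :
  pser_to c z F -> pser_to (fun k => c k.+1) z G -> F = c 0%N + z *: G.
Proof.
move=> /pser_toP hF /pser_toP hG; apply/matrixP => i j; rewrite !mxE.
by apply: sersum_unique (hF i j) (sersum_shift (hG i j)).
Qed.

(** A Schur complement: X = S^-1 w minimises X^* S X - 2 Re X^* w, the part of the fundamental
    inequality that depends on X, and the minimum is -w^* S^-1 w. *)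
Lemma schur_ge0 z (f : 'M[C]_p) (Q : nat -> 'M[C]_p) v : cabs z < 1 ->
  pser_to A z f -> (forall m, pser_to (fun l => A (l + m).+1) z (Q m)) ->
  0 <= vform (f + adjmx f) v - (1 - z * z^*) * vform (invmx S) ((- bcol N Q) *m v).
Proof.
move=> z1 hf hQ; set w := (- bcol N Q) *m v; have [B hB] := A_bound.
have [X hX] := bcol_surj (invmx S *m w).
have [B' hB'] := bil_bound v v B.
have aS := adjmx_S N ha0; have uS := S_unit hS.
have wE : adjmx (invmx S *m w) = adjmx w *m invmx S by rewrite adjmxM adjmx_inv aS.
pose b := \sum_(m < N.+1) bil (X m) (Q m *m v).
have bE : b = - vform (invmx S) w.
  have -> : b = (adjmx (bcol N X) *m (bcol N Q *m v)) 0 0.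
    have -> : bcol N Q *m v = bcol N (fun m => Q m *m v) by exact: mxcol_mul.
    by rewrite adjmx_bcol mul_mxrow_mxcol summxE.
  have -> : bcol N Q *m v = - w by rewrite /w mulNmx opprK.
  by rewrite -hX wE /vform mulmxN mxE.
have wC : (vform (invmx S) w)^* = vform (invmx S) w.
  rewrite /vform; move: (w) => u.
  have -> : ((adjmx u *m invmx S *m u) 0 0)^* = adjmx (adjmx u *m invmx S *m u) 0 0 by rewrite [RHS]mxE.
  by rewrite adjmxM adjmxM adjmxK adjmx_inv aS mulmxA.
have wT : TF t N.+1 X = vform (invmx S) w.
  by rewrite -toeplitz_TF toeplitz_t -hX /vform wE -!mulmxA mulKVmx // mulmxA.
have hb : sersum (fun l => \sum_(m < N.+1) bil (X m) (A (l + m).+1 *m v)) z b.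
  by apply: sersum_sum => m; apply: (sersum_bil _ _ (hQ m)).
have := fundamental_inequality t0 tS hTF z1 (sersum_bil v v hf) hb (fun d => hB' _ (hB d)).
rewrite wT bE rmorphN /= wC vformD.
have -> : vform f v = bil v (f *m v) by rewrite /vform /bil mulmxA.
have -> : vform (adjmx f) v = (bil v (f *m v))^* by rewrite -bil_adj /vform /bil mulmxA.
move: (vform _ _) (bil _ _) (bil _ _)^* (1 - _) => a1 a2 a3 a4.
by congr (0 <= _); ring.
Qed.

Lemma exists_admissible : exists Rf Qf : C -> 'M[C]_p, admissible_pair Rf Qf /\
  exists c : nat -> 'M[C]_p, taylor_at0 (iphi_disc N sm a0 Rf Qf) c /\
    forall k, (N < k)%N -> c k = ext k.
Proof.
have [f [Q hfQ]] := series; have [B hB] := A_bound.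
pose r z : 'M[C]_(\sum_(k < N.+1) p, p) := - bcol N (fun m => Q m z).
(* Block by block: f = A_0 + z Q_0 in the first row and Q_k = A_(k+1) + z Q_(k+1) in the others. *)
have hr z : cabs z < 1 -> (z *: 1%:M - L) *m r z = bcol N (alph sm a0) - Ecol C p N *m f z.
  move=> z1; have [hf hQ] := hfQ z z1.
  rewrite /r mulmxN mulmxBl -scalemxAl mul1mx Lmx_bcol bcolZ bcolB.
  have -> : Ecol C p N *m f z = bcol N (fun k => (if k == 0%N then 1%:M else 0) *m f z).
    exact: mxcol_mul.
  rewrite bcolB -scaleN1r bcolZ; apply: eq_mxcol => -[[|k] kN] /=; rewrite scaleN1r opprB -AE //.
    have h0 : pser_to (fun l => A l.+1) z (Q 0%N z) by apply: eq_pser (hQ 0%N) => l; rewrite addn0.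
    by rewrite mul1mx (pser_shift hf h0) opprD addNKr sub0r.
  have hk : pser_to (fun l => A (l.+1 + k).+1) z (Q k.+1 z).
    by apply: eq_pser (hQ k.+1) => l; rewrite addSnnS.
  by rewrite mul0mx subr0 (pser_shift (hQ k) hk) addrK.
pose h z := col_mx 1%:M (- f z) + (1 - z) *: (adjmx Pi *m invmx S *m r z).
have hW z z1 := (inverse_transfer ha0 hS (hr z z1)).1.
have hJ z z1 := (inverse_transfer ha0 hS (hr z z1)).2.
(* The two components of K^-1 h. *)
pose Az z := kap *: (usubmx (h z) + dsubmx (h z)).
pose Bz z := kap *: (dsubmx (h z) - usubmx (h z)).
have hK z : Kmx R p *m col_mx (Az z) (Bz z) = h z by rewrite Kmx_inv vsubmxK.
pose Rf l := Az (zlam l); pose Qf l := Bz (zlam l).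
have jh z : cabs z < 1 -> mjet h z.
  move=> z1; apply: mjetD.
    apply: mjet_col; first exact: mjet_cst.
    apply: eq_mjet (mjetB (mjet_cst 0 z) _) => [w|]; first by rewrite sub0r.
    exact: (@mjet_pser R p p f A 1 (fun w w1 => (hfQ w w1).1)).
  apply: mjetZ; first by apply: jetB; [exact: jet_cst|exact: jet_id].
  apply: mjetM; first exact: mjet_cst.
  apply: eq_mjet (mjetB (mjet_cst 0 z) _) => [w|]; first by rewrite sub0r.
  move=> i j; have jQ := @mjet_pser R p p (Q _) _ 1 (fun w w1 => (hfQ w w1).2 _) z z1.
  by apply: eq_jet (jQ _ _ _) => w; rewrite mxE.
have jRQ l : lower_hp l -> mjet Rf l /\ mjet Qf l.
  move=> hl; have jz := jet_zlam (lower_neq_i hl); have jhl := jh _ (zlam_lt1 hl).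
  have jU := mjet_usub jhl; have jD := mjet_dsub jhl.
  by split; apply: (mjet_comp jz); (apply: mjetZ; first exact: jet_cst); [apply: mjetD|apply: mjetB].
have near l : lower_hp l -> exists2 d : R, 0 < d & forall w, cabs (w - l) < d -> lower_hp w.
  move=> hl; have li := lower_neq_i hl.
  have e0 : 0 < 1 - cabs (zlam l) by rewrite subr_gt0 zlam_lt1.
  have [d d0 hd] := jet_cvg (jet_zlam li) e0.
  exists (Num.min d (cabs (l - 'i))); first by rewrite lt_min d0 cabs_gt0.
  move=> w; rewrite lt_min => /andP[/hd wl wi].
  (* zlam 'i = 0 because of division by zero, so 'i must be excluded separately. *)
  have wi0 : w - 'i != 0.
    by apply: contraTneq wi => /eqP; rewrite subr_eq0 => /eqP ->; rewrite cabsC ltxx.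
  rewrite -(lamz_zlam wi0); apply: lamz_lower.
  by have := cabsD (zlam w - zlam l) (zlam l); rewrite subrK; lra.
have aR l : lower_hp l -> analytic_at Rf l.
  by move=> /near [d d0 hd]; apply/analytic_atP; exists d => // w /hd /jRQ [].
have aQ l : lower_hp l -> analytic_at Qf l.
  by move=> /near [d d0 hd]; apply/analytic_atP; exists d => // w /hd /jRQ [].
have mer (F : C -> 'M[C]_p) : (forall l, lower_hp l -> analytic_at F l) -> meromorphic_on (@lower_hp R) F.
  move=> aF l /aF [c [d [d0 hd]]]; exists 0%N, c, d; split=> // w /andP[_ /hd].
  by rewrite expr0 scale1r.
have li : @lower_hp R (- 'i) by rewrite -lamz0; apply: lamz_lower; rewrite cabs0.
exists Rf, Qf; split.
  split; [exact: mer|exact: mer|exact: aR|exact: aQ|move=> l hl _ _].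
  have z1 := zlam_lt1 hl; rewrite /Rf /Qf; move: (zlam l) z1 => z z1.
  split=> [v v0|v]; last first.
    rewrite -/(vform _ v) -opprB -K_form hK hJ // vformN vformD vformN vformZ vform_congr opprD opprK.
    by have [hf hQ] := hfQ z z1; exact: schur_ge0.
  have gram (P Q' : 'M[C]_p) : (adjmx v *m (adjmx P *m P + adjmx Q' *m Q') *m v) 0 0 =
      vform 1%:M (P *m v) + vform 1%:M (Q' *m v) by rewrite -!vform_gram -vformD.
  rewrite gram.
  rewrite lt_neqAle addr_ge0 ?sqn_ge0 // andbT eq_sym paddr_eq0 ?sqn_ge0 //.
  apply: contra v0 => /andP[/eqP /sqn_eq0 Av /eqP /sqn_eq0 Bv].
  (* [What] maps h v to (v; -f v), so h v = 0 forces v = 0. *)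
  have hv : h z *m v = 0 by rewrite -hK -mulmxA mul_col_mx Av Bv col_mx0 mulmx0.
  have := congr1 (mulmx (What N sm a0 z)) hv; rewrite mulmx0 mulmxA hW // mul_col_mx mul1mx.
  by rewrite -col_mx0 => /eq_col_mx [->].
exists A; split; last by move=> k kN; rewrite /A /alph /t gtn_eqF ?(leq_ltn_trans _ kN) // leqNgt kN.
exists 1; split=> // z; rewrite -(rmorph1 (real_complex R)) ltcabs => z1.
have hp : hpair Rf Qf z = h z by rewrite /hpair /Rf /Qf zlam_lamz ?hK ?cabs_lt1_neq1.
(* Here X = 1 and Y = -f, so the transform returns f itself on the whole unit disc. *)
have Xp1 : Xp N sm a0 Rf Qf z = 1%:M by rewrite /Xp hp hW // col_mxKu.
have Yp1 : Yp N sm a0 Rf Qf z = - f z by rewrite /Yp hp hW // col_mxKd.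
rewrite iphi_discE // Xp1 ?unitmx1 // Yp1 invmx1 mulmx1 opprK.
by have [] := hfQ z z1.
Qed.
End BackwardTheorem.

Theorem theorem6p2 (R : realType) (p N : nat) (sm : nat -> 'M[R[i]]_p)
    (a0 : 'M[R[i]]_p) :
  (0 < p)%N ->
  pdmx (toeplitz N sm) ->
  a0 + adjmx a0 = sm 0%N ->
  (forall Rf Qf : R[i] -> 'M[R[i]]_p, admissible_pair Rf Qf ->
     'i *: phi N sm a0 Rf Qf (- 'i) = a0 /\
     exists c : nat -> 'M[R[i]]_p,
       [/\ taylor_at0 (iphi_disc N sm a0 Rf Qf) c,
           (forall k, (0 < k <= N)%N -> c k = sm k) &
           (forall M, (N < M)%N ->
              psdmx (toeplitz M (fun k => if (k <= N)%N then sm k else c k)))])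
  /\
  (forall ext : nat -> 'M[R[i]]_p,
     (forall M, (N < M)%N ->
        psdmx (toeplitz M (fun k => if (k <= N)%N then sm k else ext k))) ->
     exists Rf Qf : R[i] -> 'M[R[i]]_p,
       admissible_pair Rf Qf /\
       exists c : nat -> 'M[R[i]]_p,
         taylor_at0 (iphi_disc N sm a0 Rf Qf) c /\
         (forall k, (N < k)%N -> c k = ext k)).
Proof.
move=> _ hS ha0; split=> [Rf Qf|ext hext]; first exact: admissible_forward.
exact: exists_admissible.
Qed.
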